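(* Let $k$ be an algebraically closed field of characteristic $0$. Every affine spherical $SL_2$-variety over $k$ is $SL_2$-equivariantly isomorphic to exactly one of the following: (a) $SL_2/SL_2=\mathrm{Spec}(k)$; (b) $SL_2/T$; (c) $SL_2/N_T$; (d) $SL_2/\!/(\mu_f\ltimes\overline{U})=\mathrm{Spec}\left(R_\infty^{(f)}\right)$ for a unique positive integer $f$.
   Context: An $SL_2$-variety is a variety over $k$ with a left action of the algebraic group $SL_2$. Write $k[SL_2]=k[a,b,c,d]/(ad-bc-1)$, where $\begin{bmatrix} a&b\\c&d\end{bmatrix}$ is the generic matrix. $SL_2$ acts on $k[SL_2]$ by the left regular representation $(g\cdot f)(x)=f(g^{-1}x)$ and by the right regular representation $(g\cdot f)(x)=f(xg)$; the superscript $(-)^{op}$ indicates the action through the right regular representation. $T=\left\{\begin{bmatrix} t^{-1}&0\\0&t\end{bmatrix}\right\}\cong\mathbb{G}_m$, $N_T$ is its normalizer in $SL_2$, $\overline{B}$ is the Borel subgroup of lower triangular matrices, $\overline{U}$ is the unipotent radical of $\overline{B}$, and $\mu_f\subset T$ is the $f$-torsion subgroup. An affine normal $SL_2$-variety is called spherical if it has a dense $\overline{B}$-orbit. For a positive integer $f$, $R_\infty^{(f)}=k[b^f,db^{f-1},d^2b^{f-2},\dots,d^f]\subset k[SL_2]$; it is the left-$SL_2$-stable subalgebra generated by $k[b^f]$, and equals $k[SL_2]^{(\mu_f\ltimes\overline{U})^{op}}$, where $\mu_f\ltimes\overline{U}\subset T\ltimes\overline{U}=\overline{B}$. The $SL_2$-action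 on $\mathrm{Spec}(R_\infty^{(f)})$ is induced by the left regular action. *)

(* Defs.v *)
From HB Require Import structures.
From mathcomp Require Import all_boot all_order all_algebra.
From mathcomp Require Import mpoly.
From Stdlib Require Import FunctionalExtensionality PropExtensionality.

Set Implicit Arguments.
Unset Strict Implicit.
Unset Printing Implicit Defensive.

Import GRing.Theory.
Local Open Scope ring_scope.

(** Varieties over the algebraically closed field [k] are treated classically,
    as sets of [k]-points with [k]-valued regular functions.  Subsets are
    [Prop]-valued predicates. *)

Definition SL2 (k : fieldType) : Type := {g : 'M[k]_2 | \det g == 1}.
HB.instance Definition _ (k : fieldType) := Choice.on (SL2 k).

Section SL2Group.
Variable k : fieldType.
Implicit Types g h : SL2 k.

Fact SL2_mul_subproof g h : \det (val g *m val h) == 1.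
Proof. by rewrite det_mulmx (eqP (valP g)) (eqP (valP h)) mulr1. Qed.

Fact SL2_one_subproof : \det (1%:M : 'M[k]_2) == 1.
Proof. by rewrite det1. Qed.

Fact SL2_inv_subproof g : \det (invmx (val g)) == 1.
Proof. by rewrite det_inv (eqP (valP g)) invr1. Qed.

Definition SL2_mul g h : SL2 k :=
  exist (fun u : 'M[k]_2 => \det u == 1) _ (SL2_mul_subproof g h).
Definition SL2_one : SL2 k :=
  exist (fun u : 'M[k]_2 => \det u == 1) _ SL2_one_subproof.
Definition SL2_inv g : SL2 k :=
  exist (fun u : 'M[k]_2 => \det u == 1) _ (SL2_inv_subproof g).

Fact SL2_mulA : associative SL2_mul.
Proof. by move=> x y z; apply: val_inj; rewrite /= mulmxA. Qed.

Fact SL2_mul1 : left_id SL2_one SL2_mul.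
Proof. by move=> x; apply: val_inj; rewrite /= mul1mx. Qed.

Fact SL2_mul1r : right_id SL2_one SL2_mul.
Proof. by move=> x; apply: val_inj; rewrite /= mulmx1. Qed.

Fact SL2_unit g : val g \in unitmx.
Proof. by rewrite unitmxE (eqP (valP g)) unitr1. Qed.

Fact SL2_mulV : left_inverse SL2_one SL2_inv SL2_mul.
Proof. by move=> x; apply: val_inj; rewrite /= mulVmx ?SL2_unit. Qed.

Fact SL2_mulrV : right_inverse SL2_one SL2_inv SL2_mul.
Proof. by move=> x; apply: val_inj; rewrite /= mulmxV ?SL2_unit. Qed.

HB.instance Definition _ := isGroup.Build (SL2 k)
  SL2_mulA SL2_mul1 SL2_mul1r SL2_mulV SL2_mulrV.

End SL2Group.

(** Entries of the generic matrix [[a b; c d]]. *)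
Definition mx_a (k : fieldType) (g : SL2 k) : k := val g 0 0.
Definition mx_b (k : fieldType) (g : SL2 k) : k := val g 0 1.
Definition mx_c (k : fieldType) (g : SL2 k) : k := val g 1 0.
Definition mx_d (k : fieldType) (g : SL2 k) : k := val g 1 1.

Definition torus (k : fieldType) (g : SL2 k) : Prop :=
  exists2 t : k, t != 0 &
    [/\ mx_a g = t^-1, mx_b g = 0, mx_c g = 0 & mx_d g = t].

Definition normalizer (k : fieldType) (H : SL2 k -> Prop) (g : SL2 k) : Prop :=
  forall h : SL2 k, H h <-> H (g * h * g^-1)%g.

Definition lower_borel (k : fieldType) (g : SL2 k) : Prop := mx_b g = 0.

(** Raw data, without axioms: [coord] is meant to be the coordinate ring
    [k[X]], as a set of functions on the points. *)
Record affine_SL2 (k : fieldType) := AffineSL2 {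
  apt :> Type;
  coord : (apt -> k) -> Prop;
  aact : SL2 k -> apt -> apt
}.

Definition zariski_open (k : fieldType) (X : affine_SL2 k) (U : X -> Prop) :
    Prop :=
  exists S : (X -> k) -> Prop,
    (forall f, S f -> coord f) /\
    (forall x, U x <-> exists f, S f /\ f x != 0).

(** [X] is identified by [s] with a Zariski-closed subset of affine [n]-space,
    its coordinate ring being the restrictions of polynomials. *)
Definition embeds_closed (k : fieldType) (X : affine_SL2 k) : Prop :=
  exists (n : nat) (s : X -> 'I_n -> k) (I : {mpoly k[n]} -> Prop),
    [/\ forall x y, s x =1 s y -> x = y,
        forall v : 'I_n -> k,
          (exists x, s x =1 v) <-> (forall p, I p -> p.@[v] = 0)
      & forall f : X -> k,
          coord f <-> exists p : {mpoly k[n]}, forall x, f x = p.@[s x]].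

Definition irreducible_space (k : fieldType) (X : affine_SL2 k) : Prop :=
  (exists x : X, True) /\
  forall U V : X -> Prop, zariski_open U -> zariski_open V ->
    (exists x, U x) -> (exists x, V x) -> exists x, U x /\ V x.

Definition affine_variety (k : fieldType) (X : affine_SL2 k) : Prop :=
  embeds_closed X /\ irreducible_space X.

(** [k[SL_2]]: polynomial functions in [a], [b], [c], [d]; the operation is
    left multiplication. *)
Definition SL2_coord (k : fieldType) (f : SL2 k -> k) : Prop :=
  exists p : {mpoly k[4]},
    forall g, f g = p.@[tnth [tuple mx_a g; mx_b g; mx_c g; mx_d g]].

Definition SL2_affine (k : fieldType) : affine_SL2 k :=
  @AffineSL2 k (SL2 k) (@SL2_coord k) (fun g x => (g * x)%g).

(** A left action that is a morphism [SL_2 x X -> X]: pullback along it sends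
    [k[X]] into [k[SL_2 x X]], the tensor product of [k[SL_2]] and [k[X]]. *)
Definition algebraic_action (k : fieldType) (X : affine_SL2 k) : Prop :=
  [/\ forall x : X, aact 1%g x = x,
      forall (g h : SL2 k) (x : X), aact (g * h)%g x = aact g (aact h x)
    & forall f : X -> k, coord f ->
        exists (m : nat) (p : 'I_m -> SL2 k -> k) (q : 'I_m -> X -> k),
          [/\ forall i, SL2_coord (p i), forall i, coord (q i)
            & forall g x, f (aact g x) = \sum_(i < m) p i g * q i x]].

(** [k[X]] is integrally closed in its fraction field: if the fraction [p / q]
    is a root of the monic polynomial ['X^m + \sum_(i < m) c i *: 'X^i] over
    [k[X]] (the equation is multiplied by [q ^+ m]), then [p / q] is in
    [k[X]]. *)
Definition normal_variety (k : fieldType) (X : affine_SL2 k) : Prop :=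
  forall (p q : X -> k) (m : nat) (c : 'I_m -> X -> k),
    coord p -> coord q -> (forall i, coord (c i)) ->
    (exists x, q x != 0) ->
    (forall x, p x ^+ m + \sum_(i < m) c i x * p x ^+ i * q x ^+ (m - i) = 0) ->
    exists2 r : X -> k, coord r & forall x, p x = r x * q x.

Definition has_dense_borel_orbit (k : fieldType) (X : affine_SL2 k) : Prop :=
  exists x : X, forall U : X -> Prop, zariski_open U -> (exists y, U y) ->
    exists g : SL2 k, lower_borel g /\ U (aact g x).

Definition affine_spherical (k : fieldType) (X : affine_SL2 k) : Prop :=
  [/\ affine_variety X, algebraic_action X, normal_variety X
    & has_dense_borel_orbit X].

(** Topological spaces with a sheaf of [k]-valued functions and an operation
    of SL_2(k).  [section U f] only concerns the restriction of [f] to [U]. *)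
Record SL2_space (k : fieldType) := SL2Space {
  spt :> Type;
  sopen : (spt -> Prop) -> Prop;
  section : (spt -> Prop) -> (spt -> k) -> Prop;
  sact : SL2 k -> spt -> spt
}.

(** Regular functions on an open set: locally quotients of elements of the
    coordinate ring. *)
Definition regular_on (k : fieldType) (X : affine_SL2 k)
    (U : X -> Prop) (f : X -> k) : Prop :=
  forall x, U x -> exists (V : X -> Prop) (p q : X -> k),
    [/\ zariski_open V, V x, forall y, V y -> U y, coord p /\ coord q
      & forall y, V y -> q y != 0 /\ f y = p y / q y].

Definition space_of (k : fieldType) (X : affine_SL2 k) : SL2_space k :=
  @SL2Space k X (@zariski_open k X) (@regular_on k X) (@aact k X).

Definition SL2_isomorphic (k : fieldType) (X Y : SL2_space k) : Prop :=
  exists (phi : X -> Y) (psi : Y -> X),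
    [/\ cancel phi psi, cancel psi phi,
        forall (g : SL2 k) (x : X), phi (sact g x) = sact g (phi x),
        forall U : Y -> Prop, sopen U <-> sopen (fun x => U (phi x))
      & forall (U : Y -> Prop) (f : Y -> k), sopen U ->
          (section U f <-> section (fun x => U (phi x)) (fun x => f (phi x)))].

(** SL_2/H: the set of cosets [xH] with the quotient topology and the
    functions whose pullback to SL_2 is regular. *)
Definition coset_of (k : fieldType) (H : SL2 k -> Prop) (x y : SL2 k) : Prop :=
  exists2 h : SL2 k, H h & y = (x * h)%g.

Definition cosets (k : fieldType) (H : SL2 k -> Prop) : Type :=
  {C : SL2 k -> Prop | exists x, C = coset_of H x}.

Definition coset_proj (k : fieldType) (H : SL2 k -> Prop) (x : SL2 k) :
    cosets H :=
  exist _ (coset_of H x) (ex_intro _ x erefl).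

Fact coset_act_subproof (k : fieldType) (H : SL2 k -> Prop) (g : SL2 k)
    (C : cosets H) :
  exists x, (fun y => sval C (g^-1 * y)%g) = coset_of H x.
Proof.
case: C => C /= [x ->]; exists (g * x)%g.
apply: functional_extensionality => y; apply: propositional_extensionality.
split=> -[h Hh].
  by move/(congr1 (fun z => (g * z)%g)); rewrite mulVKg mulgA => ->; exists h.
by move=> ->; exists h => //; rewrite -mulgA mulKg.
Qed.

Definition coset_act (k : fieldType) (H : SL2 k -> Prop) (g : SL2 k)
    (C : cosets H) : cosets H :=
  exist _ _ (coset_act_subproof g C).

Definition homogeneous_space (k : fieldType) (H : SL2 k -> Prop) :
    SL2_space k :=
  @SL2Space k (cosets H)
    (fun U => @sopen k (space_of (SL2_affine k))
                (fun x => U (coset_proj H x)))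
    (fun U f => @section k (space_of (SL2_affine k))
                  (fun x => U (coset_proj H x)) (fun x => f (coset_proj H x)))
    (@coset_act k H).

Definition left_regular (k : fieldType) (g : SL2 k) (f : SL2 k -> k) :
    SL2 k -> k :=
  fun x => f (g^-1 * x)%g.

Definition left_stable (k : fieldType) (R : (SL2 k -> k) -> Prop) : Prop :=
  forall g f, R f -> R (left_regular g f).

Section Spec.
Variables (k : fieldType) (R : (SL2 k -> k) -> Prop) (Rst : left_stable R).

Definition is_kalg_hom (phi : {f | R f} -> k) : Prop :=
  [/\ forall (c : k) (u : {f | R f}), (forall x, sval u x = c) -> phi u = c,
      forall u v w : {f | R f},
        (forall x, sval w x = sval u x + sval v x) -> phi w = phi u + phi v
    & forall u v w : {f | R f},
        (forall x, sval w x = sval u x * sval v x) -> phi w = phi u * phi v].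

Definition spec_point : Type := {phi : {f | R f} -> k | is_kalg_hom phi}.

Definition left_regular_sub (g : SL2 k) (u : {f | R f}) : {f | R f} :=
  exist _ (left_regular g (sval u)) (Rst g (proj2_sig u)).

Fact spec_act_subproof (g : SL2 k) (phi : spec_point) :
  is_kalg_hom (fun u => sval phi (left_regular_sub g^-1%g u)).
Proof.
case: phi => phi /= [h1 h2 h3]; split.
- by move=> c u hu; apply: h1 => x; apply: hu.
- by move=> u v w hw; apply: h2 => x; apply: hw.
- by move=> u v w hw; apply: h3 => x; apply: hw.
Qed.

(** The operation on points for which [(g . u)(phi) = u(g^-1 . phi)], where
    [u] in [R] is viewed as a function on the spectrum. *)
Definition spec_act (g : SL2 k) (phi : spec_point) : spec_point :=
  exist _ _ (spec_act_subproof g phi).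

Definition Spec : affine_SL2 k :=
  @AffineSL2 k spec_point
    (fun F => exists u : {f | R f}, forall phi : spec_point, F phi = sval phi u)
    spec_act.

End Spec.

(** [R_infty f] is [k[b^f, d b^(f-1), ..., d^f]]. *)
Definition R_infty (k : fieldType) (f : nat) (F : SL2 k -> k) : Prop :=
  exists p : {mpoly k[f.+1]},
    forall x, F x = p.@[fun i : 'I_f.+1 => mx_d x ^+ i * mx_b x ^+ (f - i)].

Section RInftyStable.
Variable k : fieldType.

Lemma linear_forms_prod (n : nat) (al be : 'I_n -> k) :
  exists e : nat -> k, forall B D : k,
    \prod_(i < n) (al i * B + be i * D)
    = \sum_(j < n.+1) e j * (D ^+ j * B ^+ (n - j)).
Proof.
elim: n al be => [|n IH] al be.
  exists (fun=> 1) => B D.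
  by rewrite big_ord0 big_ord_recl big_ord0 !mul1r addr0.
have [e He] := IH (fun i => al (widen_ord (leqnSn n) i))
                  (fun i => be (widen_ord (leqnSn n) i)).
pose a0 := al ord_max; pose b0 := be ord_max.
exists (fun j => (if (j <= n)%N then a0 * e j else 0)
               + (if j is j'.+1 then b0 * e j' else 0)) => B D.
rewrite big_ord_recr /= He -/a0 -/b0 mulrC mulrDl.
under [RHS]eq_bigr => j _ do rewrite mulrDl.
rewrite big_split /= [X in _ = X + _]big_ord_recr /= ltnn mul0r addr0.
rewrite [X in _ = _ + X]big_ord_recl /= mul0r add0r.
congr (_ + _); rewrite mulr_sumr; apply: eq_bigr => j _.
  have lej : (j <= n)%N by rewrite -ltnS.
  by rewrite lej subSn // exprS; rewrite -!mulrA; congr (_ * _);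
     rewrite mulrCA; congr (_ * _); rewrite mulrCA.
by rewrite /bump /= add1n subSS exprS -!mulrA; congr (_ * _);
   rewrite mulrCA.
Qed.

Lemma R_infty_stable (f : nat) : left_stable (@R_infty k f).
Proof.
move=> g F [p Fp].
pose h := val (g^-1)%g.
have hb x : mx_b (g^-1 * x)%g = h 0 0 * mx_b x + h 0 1 * mx_d x.
  by rewrite /mx_b /mx_d /= mxE !big_ord_recl big_ord0 addr0;
     congr (_ + _ * (val x) _ _); try congr (h _ _); apply: val_inj.
have hd x : mx_d (g^-1 * x)%g = h 1 0 * mx_b x + h 1 1 * mx_d x.
  by rewrite /mx_b /mx_d /= mxE !big_ord_recl big_ord0 addr0;
     congr (_ + _ * (val x) _ _); try congr (h _ _); apply: val_inj.
have gen (i : 'I_f.+1) : exists q : {mpoly k[f.+1]}, forall x,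
    mx_d (g^-1 * x)%g ^+ i * mx_b (g^-1 * x)%g ^+ (f - i)
    = q.@[fun j : 'I_f.+1 => mx_d x ^+ j * mx_b x ^+ (f - j)].
  have [e He] := @linear_forms_prod f
    (fun j : 'I_f => if (j < i)%N then h 1 0 else h 0 0)
    (fun j : 'I_f => if (j < i)%N then h 1 1 else h 0 1).
  exists (\sum_(j < f.+1) e j *: 'X_j) => x.
  rewrite raddf_sum /=.
  under eq_bigr => j _ do rewrite mevalZ mevalXU.
  rewrite -He hb hd.
  have lei : (i <= f)%N by rewrite -ltnS.
  pose G j := (if (j < i)%N then h 1 0 else h 0 0) * mx_b x
            + (if (j < i)%N then h 1 1 else h 0 1) * mx_d x.
  rewrite -(big_mkord xpredT G) (@big_cat_nat _ _ _ i) //=.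
  congr (_ * _).
    rewrite (eq_big_nat _ _ (F2 := fun=> h 1 0 * mx_b x + h 1 1 * mx_d x)).
      by rewrite prodr_const_nat subn0.
    by move=> j /andP [_ lt_ji]; rewrite /G lt_ji.
  rewrite (eq_big_nat _ _ (F2 := fun=> h 0 0 * mx_b x + h 0 1 * mx_d x)).
    by rewrite prodr_const_nat.
  by move=> j /andP [le_ij _]; rewrite /G ltnNge le_ij.
have [q Hq] : exists q : 'I_f.+1 -> {mpoly k[f.+1]},
    forall (i : 'I_f.+1) (x : SL2 k),
    mx_d (g^-1 * x)%g ^+ i * mx_b (g^-1 * x)%g ^+ (f - i)
    = (q i).@[fun j : 'I_f.+1 => mx_d x ^+ j * mx_b x ^+ (f - j)].
  exact: (fin_all_exists gen).
exists (p \mPo [tuple q i | i < f.+1]) => x.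
rewrite /left_regular Fp comp_mpoly_meval.
by apply: meval_eq => i; rewrite Hq tnth_map tnth_ord_tuple.
Qed.

End RInftyStable.

Inductive spherical_model : Type :=
  | ModSL2
  | ModT
  | ModNT
  | SpecRinfty of {f : nat | (0 < f)%N}.

Definition model_space (k : fieldType) (m : spherical_model) : SL2_space k :=
  match m with
  | ModSL2 => homogeneous_space (fun _ : SL2 k => True)
  | ModT => homogeneous_space (@torus k)
  | ModNT => homogeneous_space (normalizer (@torus k))
  | SpecRinfty f => space_of (Spec (@R_infty_stable k (sval f)))
  end.

(* Main.v *)
(** Let [x] have a dense orbit under the lower Borel subgroup.  Pulling back along
    [g |-> g x] identifies [k[X]] with a left-stable subalgebra [A] of
    [k[SL_2]], whose elements are determined by their restriction to the lower
    Borel subgroup.  The invariants of [k[SL_2]] under left translation by the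
    lower unipotent subgroup are the polynomials in the first row [(a, b)], so [A]
    contains, for each weight [n], at most one such invariant of the form
    [b^n P_n(a / b)] with [P_n] monic of degree [n]; in particular
    [P_n P_m = P_(n + m)].  These invariants generate [A] under left
    translation.  The Hessian of [b^n P_n(a / b)] is again such an invariant, of
    weight [2n - 4], hence a multiple of the one attached to [P_(2n - 4)].
    Comparing [P_n^(2n - 4)] with [P_(2n - 4)^n] at a root of multiplicity [m] of
    [P_n] forces [m = n] or [2m = n].  So after a right translation all these
    invariants are powers of [q = b] or of [q = a b], and normality says that the
    powers of [q] in [A] are exactly those of [q^f] for some [f]; when [q = a b],
    the Hessian forces [f | 2].  The cases are [A = k] (a point), [q = b] (the
    cone), and [q = a b] with [f = 1] (torus) or [f = 2] (normalizer).  The models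
    are told apart by the stabilizers of their points. *)

Require Import Defs.
From mathcomp Require Import all_boot all_order all_algebra.
From mathcomp Require Import mpoly ring zify cyclotomic separable.
From Stdlib Require Import FunctionalExtensionality PropExtensionality.
From Stdlib Require Import ProofIrrelevance ClassicalEpsilon.
(* Otherwise [coord] denotes the coordinates of a vector in a basis. *)
Import Defs.

Set Implicit Arguments.
Unset Strict Implicit.
Unset Printing Implicit Defensive.

Import GRing.Theory.
Local Open Scope ring_scope.

(** * Matrix entries and regular functions on SL_2 *)

Section SL2Entries.
Variable k : fieldType.
Implicit Types g h x y : SL2 k.

(** In characteristic 0 the Hessian of a binary form of degree n vanishes only for n-th powers of
    linear forms, and at a root of multiplicity m < n it has multiplicity exactly 2m - 2. As [A] has
    one vector per weight, a nonzero Hessian satisfies Q^n = P^(2n - 4) up to scaling Q, and n(2m -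
    2) = m(2n - 4) says n = 2m. In place of complete reducibility there is one device: if a
    translate depends polynomially on a parameter s, its coefficients in s lie in every
    left-translatable linear space that contains the function. This produces polarizations and shows
    that highest weight vectors generate. The cone is a spectrum, so equality of algebras settles
    it. The other models are coset spaces with quotient topology and sheaf; for them [X] must also
    be a single orbit with the right stabilizer, and invariant fractions must be rewritten with
    numerator and denominator in the algebra. For the torus and its normalizer this goes through u =
    ab, h = ad + bc, w = cd: the quadric h^2 - 4uw = 1 is SL_2/T, and its quotient by the sign is
    SL_2/N_T. *)

Definition sl2 (a b c d : k) : SL2 k :=
  insubd (1%g : SL2 k) (\matrix_(i, j)
    (if i == 0 then if j == 0 then a else b else if j == 0 then c else d)).

Lemma det_mx22 (M : 'M[k]_2) : \det M = M 0 0 * M 1 1 - M 0 1 * M 1 0.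
Proof.
rewrite (expand_det_row _ 0) !big_ord_recl big_ord0 addr0 /cofactor !det_mx11.
rewrite !mxE /= /bump /= expr0 expr1 mul1r mulN1r mulrN.
by congr (_ * M _ _ - M _ _ * M _ _); apply: val_inj.
Qed.

Lemma SL2_det g : mx_a g * mx_d g - mx_b g * mx_c g = 1.
Proof. by rewrite -det_mx22; apply/eqP/(valP g). Qed.

Lemma sl2_val a b c d : a * d - b * c = 1 ->
  val (sl2 a b c d) = \matrix_(i, j)
    (if i == 0 then if j == 0 then a else b else if j == 0 then c else d).
Proof. by move=> H; rewrite /sl2 insubdK // unfold_in det_mx22 !mxE /= H. Qed.

Lemma sl2E a b c d : a * d - b * c = 1 ->
  [/\ mx_a (sl2 a b c d) = a, mx_b (sl2 a b c d) = b,
      mx_c (sl2 a b c d) = c & mx_d (sl2 a b c d) = d].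
Proof. by move=> H; rewrite /mx_a /mx_b /mx_c /mx_d sl2_val // !mxE. Qed.

Lemma SL2_eq g h : mx_a g = mx_a h -> mx_b g = mx_b h -> mx_c g = mx_c h ->
  mx_d g = mx_d h -> g = h.
Proof.
move=> Ha Hb Hc Hd; apply/val_inj/matrixP => i j.
have I2 (l : 'I_2) : l = 0 \/ l = 1.
  by case: l => [[|[|?]]] // Hl; [left|right]; apply: val_inj.
by case: (I2 i) => ->; case: (I2 j) => ->.
Qed.

Lemma SL2_mulE g h :
  [/\ mx_a (g * h)%g = mx_a g * mx_a h + mx_b g * mx_c h,
      mx_b (g * h)%g = mx_a g * mx_b h + mx_b g * mx_d h,
      mx_c (g * h)%g = mx_c g * mx_a h + mx_d g * mx_c h
    & mx_d (g * h)%g = mx_c g * mx_b h + mx_d g * mx_d h].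
Proof.
rewrite /mx_a /mx_b /mx_c /mx_d /= !mxE !big_ord_recl !big_ord0 !addr0.
by split; congr (_ + val g _ _ * val h _ _); apply: val_inj.
Qed.

Lemma mx_aM g h : mx_a (g * h)%g = mx_a g * mx_a h + mx_b g * mx_c h.
Proof. by case: (SL2_mulE g h). Qed.
Lemma mx_bM g h : mx_b (g * h)%g = mx_a g * mx_b h + mx_b g * mx_d h.
Proof. by case: (SL2_mulE g h). Qed.
Lemma mx_cM g h : mx_c (g * h)%g = mx_c g * mx_a h + mx_d g * mx_c h.
Proof. by case: (SL2_mulE g h). Qed.
Lemma mx_dM g h : mx_d (g * h)%g = mx_c g * mx_b h + mx_d g * mx_d h.
Proof. by case: (SL2_mulE g h). Qed.
Definition mx_M := (mx_aM, mx_bM, mx_cM, mx_dM).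

Lemma SL2_1E : [/\ mx_a (1%g : SL2 k) = 1, mx_b (1%g : SL2 k) = 0,
  mx_c (1%g : SL2 k) = 0 & mx_d (1%g : SL2 k) = 1].
Proof. by rewrite /mx_a /mx_b /mx_c /mx_d /= !mxE. Qed.

Lemma SL2_invE g : g^-1%g = sl2 (mx_d g) (- mx_b g) (- mx_c g) (mx_a g).
Proof.
have H : mx_d g * mx_a g - - mx_b g * - mx_c g = 1 by rewrite -(SL2_det g); ring.
have [Ea Eb Ec Ed] := sl2E H; have [Ia Ib Ic Id] := SL2_1E.
have E : (g * sl2 (mx_d g) (- mx_b g) (- mx_c g) (mx_a g) = 1)%g.
  by apply: SL2_eq; rewrite mx_M ?Ea ?Eb ?Ec ?Ed ?Ia ?Ib ?Ic ?Id -?(SL2_det g); ring.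
by rewrite -[LHS]mulg1 -E mulKg.
Qed.

Lemma mx_aV g : mx_a g^-1%g = mx_d g.
Proof.
rewrite SL2_invE; have H : mx_d g * mx_a g - - mx_b g * - mx_c g = 1
  by rewrite -(SL2_det g); ring.
by case: (sl2E H).
Qed.
Lemma mx_bV g : mx_b g^-1%g = - mx_b g.
Proof.
rewrite SL2_invE; have H : mx_d g * mx_a g - - mx_b g * - mx_c g = 1
  by rewrite -(SL2_det g); ring.
by case: (sl2E H).
Qed.
Lemma mx_cV g : mx_c g^-1%g = - mx_c g.
Proof.
rewrite SL2_invE; have H : mx_d g * mx_a g - - mx_b g * - mx_c g = 1
  by rewrite -(SL2_det g); ring.
by case: (sl2E H).
Qed.
Lemma mx_dV g : mx_d g^-1%g = mx_a g.
Proof.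
rewrite SL2_invE; have H : mx_d g * mx_a g - - mx_b g * - mx_c g = 1
  by rewrite -(SL2_det g); ring.
by case: (sl2E H).
Qed.
Definition mx_V := (mx_aV, mx_bV, mx_cV, mx_dV).

Lemma mx_a1 : mx_a (1%g : SL2 k) = 1. Proof. by case: SL2_1E. Qed.
Lemma mx_b1 : mx_b (1%g : SL2 k) = 0. Proof. by case: SL2_1E. Qed.
Lemma mx_c1 : mx_c (1%g : SL2 k) = 0. Proof. by case: SL2_1E. Qed.
Lemma mx_d1 : mx_d (1%g : SL2 k) = 1. Proof. by case: SL2_1E. Qed.
Definition mx_1 := (mx_a1, mx_b1, mx_c1, mx_d1).

Lemma SL2_ab_neq0 g : mx_a g = 0 -> mx_b g = 0 -> False.
Proof.
move=> Ha Hb; have := SL2_det g; rewrite Ha Hb !mul0r subr0 => /esym/eqP.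
by rewrite oner_eq0.
Qed.

Definition ulo (z : k) : SL2 k := sl2 1 0 z 1.
Definition uup (s : k) : SL2 k := sl2 1 s 0 1.
(** The inverse of the parametrization used in [torus], so that left translation scales the first
    row by t. At t = 0 the determinant condition fails and the value is the identity. *)
Definition tor (t : k) : SL2 k := sl2 t 0 0 t^-1.
Definition weyl : SL2 k := sl2 0 1 (-1) 0.

Lemma uloE z : [/\ mx_a (ulo z) = 1, mx_b (ulo z) = 0, mx_c (ulo z) = z
  & mx_d (ulo z) = 1].
Proof. by apply: sl2E; rewrite mulr1 mul0r subr0. Qed.
Lemma uupE s : [/\ mx_a (uup s) = 1, mx_b (uup s) = s, mx_c (uup s) = 0
  & mx_d (uup s) = 1].
Proof. by apply: sl2E; rewrite mulr1 mulr0 subr0. Qed.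
Lemma torE t : t != 0 -> [/\ mx_a (tor t) = t, mx_b (tor t) = 0,
  mx_c (tor t) = 0 & mx_d (tor t) = t^-1].
Proof. by move=> t0; apply: sl2E; rewrite mulfV // mulr0 subr0. Qed.
Lemma weylE : [/\ mx_a weyl = 0, mx_b weyl = 1, mx_c weyl = -1 & mx_d weyl = 0].
Proof. by apply: sl2E; ring. Qed.

End SL2Entries.

(** * The coordinate ring of SL_2 and polynomial curves in SL_2 *)

Section CoordinateRing.
Variable k : fieldType.
Implicit Types (g h : SL2 k) (F G : SL2 k -> k).

Lemma SL2_coord_ind (Q : (SL2 k -> k) -> Prop) :
  (forall F G, F =1 G -> Q F -> Q G) ->
  (forall c, Q (fun=> c)) -> Q (@mx_a k) -> Q (@mx_b k) -> Q (@mx_c k) ->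
  Q (@mx_d k) -> (forall F G, Q F -> Q G -> Q (fun g => F g + G g)) ->
  (forall F G, Q F -> Q G -> Q (fun g => F g * G g)) ->
  forall F, SL2_coord F -> Q F.
Proof.
move=> Qe Qc Qx Qy Qz Qt Qa Qm F [p Hp].
apply: (Qe (fun g => p.@[tnth [tuple mx_a g; mx_b g; mx_c g; mx_d g]])).
  by move=> g; rewrite -Hp.
elim/mpolyind: p {Hp} => [|c m p _ _ IH].
  by apply: (Qe (fun=> 0)) => // g; rewrite meval0.
apply: (Qe (fun g => ('X_[m] * c%:MP).@[tnth [tuple mx_a g; mx_b g; mx_c g; mx_d g]]
   + p.@[tnth [tuple mx_a g; mx_b g; mx_c g; mx_d g]])).
  by move=> g; rewrite mevalD mevalM mevalZ mevalC mulrC.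
apply: Qa => //.
have QX n G : Q G -> Q (fun g => G g ^+ n).
  move=> QG; elim: n => [|n IHn]; first exact: (Qe (fun=> 1)).
  by apply: (Qe (fun g => G g * G g ^+ n)); [move=> g; rewrite exprS|apply: Qm].
apply: (Qe (fun g => (mx_a g ^+ m 0%R * (mx_b g ^+ m (inord 1)
     * (mx_c g ^+ m (inord 2) * mx_d g ^+ m (inord 3)))) * c)).
  move=> g; rewrite mevalM mevalC mevalX; congr (_ * _).
  rewrite !big_ord_recl big_ord0 mulr1.
  by do ?congr (_ * _); rewrite /= ?(tnth_nth 0) /=; congr (_ ^+ m _);
     apply: val_inj; rewrite /= ?inordK.
exact: (Qm _ _ (Qm _ _ (QX _ _ Qx) (Qm _ _ (QX _ _ Qy)
  (Qm _ _ (QX _ _ Qz) (QX _ _ Qt)))) (Qc c)).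
Qed.

Lemma SL2_coord_ext F G : F =1 G -> SL2_coord F -> SL2_coord G.
Proof. by move=> E [p Hp]; exists p => g; rewrite -E Hp. Qed.

Lemma SL2_coord_const c : SL2_coord (fun=> c : k).
Proof. by exists (c%:MP) => g; rewrite mevalC. Qed.

Lemma SL2_coordD F G : SL2_coord F -> SL2_coord G ->
  SL2_coord (fun g => F g + G g).
Proof. by case=> p Hp [q Hq]; exists (p + q) => g; rewrite mevalD Hp Hq. Qed.

Lemma SL2_coordM F G : SL2_coord F -> SL2_coord G ->
  SL2_coord (fun g => F g * G g).
Proof. by case=> p Hp [q Hq]; exists (p * q) => g; rewrite mevalM Hp Hq. Qed.

Lemma SL2_coord_a : SL2_coord (@mx_a k).
Proof. by exists 'X_0 => g; rewrite mevalXU (tnth_nth 0). Qed.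
Lemma SL2_coord_b : SL2_coord (@mx_b k).
Proof. by exists 'X_(inord 1) => g; rewrite mevalXU (tnth_nth 0) inordK. Qed.
Lemma SL2_coord_c : SL2_coord (@mx_c k).
Proof. by exists 'X_(inord 2) => g; rewrite mevalXU (tnth_nth 0) inordK. Qed.
Lemma SL2_coord_d : SL2_coord (@mx_d k).
Proof. by exists 'X_(inord 3) => g; rewrite mevalXU (tnth_nth 0) inordK. Qed.

Lemma SL2_coordX F n : SL2_coord F -> SL2_coord (fun g => F g ^+ n).
Proof.
move=> HF; elim: n => [|n IH]; first exact: (SL2_coord_const 1).
by apply: SL2_coord_ext (SL2_coordM HF IH) => g; rewrite exprS.
Qed.

(** A morphism from the affine line to SL_2. Restriction to such curves turns questions on regular
    functions into questions on polynomials in one variable. *)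
Definition poly_path (gam : k -> SL2 k) : Prop :=
  exists pa pb pc pd : {poly k}, forall s,
  [/\ mx_a (gam s) = pa.[s], mx_b (gam s) = pb.[s], mx_c (gam s) = pc.[s]
    & mx_d (gam s) = pd.[s]].

Lemma SL2_coord_path gam F : poly_path gam -> SL2_coord F ->
  exists P : {poly k}, forall s, F (gam s) = P.[s].
Proof.
case=> pa [pb [pc [pd H]]]; move: F.
apply: (@SL2_coord_ind (fun F => exists P : {poly k}, forall s, F (gam s) = P.[s])).
- by move=> F G E [P HP]; exists P => s; rewrite -E.
- by move=> c; exists c%:P => s; rewrite hornerC.
- by exists pa => s; case: (H s).
- by exists pb => s; case: (H s).
- by exists pc => s; case: (H s).
- by exists pd => s; case: (H s).
- by move=> F G [P HP] [Q HQ]; exists (P + Q) => s; rewrite hornerD HP HQ.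
- by move=> F G [P HP] [Q HQ]; exists (P * Q) => s; rewrite hornerM HP HQ.
Qed.

Lemma poly_path_const g : poly_path (fun=> g).
Proof.
exists (mx_a g)%:P, (mx_b g)%:P, (mx_c g)%:P, (mx_d g)%:P => s.
by rewrite !hornerC.
Qed.

Lemma poly_path_mul gam1 gam2 : poly_path gam1 -> poly_path gam2 ->
  poly_path (fun s => (gam1 s * gam2 s)%g).
Proof.
case=> pa [pb [pc [pd H1]]] [qa [qb [qc [qd H2]]]].
exists (pa * qa + pb * qc), (pa * qb + pb * qd), (pc * qa + pd * qc),
  (pc * qb + pd * qd) => s; rewrite !mx_M.
by case: (H1 s) => -> -> -> ->; case: (H2 s) => -> -> -> ->; rewrite !hornerE.
Qed.

Lemma poly_path_ulo c : poly_path (fun s => ulo (s * c)).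
Proof.
exists 1, 0, ('X * c%:P), 1 => s; case: (uloE (s * c)) => -> -> -> ->.
by rewrite !hornerE.
Qed.

Lemma poly_path_uup c : poly_path (fun s => uup (s * c)).
Proof.
exists 1, ('X * c%:P), 0, 1 => s; case: (uupE (s * c)) => -> -> -> ->.
by rewrite !hornerE.
Qed.

Lemma ulo0 : ulo (0 : k) = 1%g.
Proof. by case: (uloE (0:k)) => *; apply: SL2_eq; rewrite mx_1. Qed.
Lemma uup0 : uup (0 : k) = 1%g.
Proof. by case: (uupE (0:k)) => *; apply: SL2_eq; rewrite mx_1. Qed.

(** When c is nonzero, three unipotent factors suffice; otherwise a is nonzero and left
    multiplication by [ulo 1] first makes c nonzero. Scaling the four parameters by s then joins the
    identity to g by a polynomial curve. *)
Lemma SL2_unipotent_gen g : exists c1 c2 c3 c4 : k,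
  g = (ulo c1 * uup c2 * ulo c3 * uup c4)%g.
Proof.
have gen h : mx_c h != 0 ->
    exists c2 c3 c4 : k, h = (uup c2 * ulo c3 * uup c4)%g.
  move=> c0; exists ((mx_a h - 1) / mx_c h), (mx_c h), ((mx_d h - 1) / mx_c h).
  case: (uupE ((mx_a h - 1) / mx_c h)) => A1 B1 C1 D1.
  case: (uupE ((mx_d h - 1) / mx_c h)) => A2 B2 C2 D2.
  case: (uloE (mx_c h)) => A3 B3 C3 D3.
  apply: SL2_eq; rewrite !mx_M ?A1 ?B1 ?C1 ?D1 ?A2 ?B2 ?C2 ?D2 ?A3 ?B3 ?C3 ?D3; try by field.
  have -> : mx_b h = (mx_a h * mx_d h - 1) / mx_c h.
    by rewrite -(SL2_det h); field.
  by field.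
have [c0|] := eqVneq (mx_c g) 0; last first.
  move/gen => [c2 [c3 [c4 ->]]]; exists 0, c2, c3, c4.
  by rewrite ulo0 mul1g.
have : mx_c (ulo 1 * g)%g != 0.
  case: (uloE (1 : k)) => A B C D; rewrite mx_M C D c0 mul1r mulr0 addr0.
  apply/eqP => a0; have := SL2_det g; rewrite a0 c0 mul0r mulr0 subr0.
  by move/esym/eqP; rewrite oner_eq0.
move/gen => [c2 [c3 [c4 E]]]; exists (-1), c2, c3, c4.
rewrite -!mulgA; move: E; rewrite -!mulgA => <-; rewrite mulgA.
suff -> : (ulo (-1) * ulo 1 = 1 :> SL2 k)%g by rewrite mul1g.
case: (uloE (1 : k)) => A B C D; case: (uloE (-1 : k)) => A' B' C' D'.
by apply: SL2_eq; rewrite mx_M ?A ?B ?C ?D ?A' ?B' ?C' ?D' mx_1; ring.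
Qed.

End CoordinateRing.

(** * SL_2 is irreducible; extraction of coefficients *)

Section InfiniteField.
Variables (k : fieldType) (char0 : [pchar k] =i pred0).
Implicit Types (g h : SL2 k) (F G : SL2 k -> k).

Lemma natr_neq0 n : (0 < n)%N -> n%:R != 0 :> k.
Proof. by rewrite lt0n ((pcharf0P k).1 char0). Qed.

Lemma natr_inj : injective (fun n : nat => n%:R : k).
Proof.
move=> m n; wlog le : m n / (m <= n)%N.
  by move=> H; case: (leqP m n) => [/H//|/ltnW/H E /esym/E].
move/eqP; rewrite eq_sym -subr_eq0 -natrB // ((pcharf0P k).1 char0) subn_eq0.
by move=> le'; apply/eqP; rewrite eqn_leq le.
Qed.

Lemma poly_eq0_nonzero (P : {poly k}) : (forall t, t != 0 -> P.[t] = 0) -> P = 0.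
Proof.
move=> H; apply/eqP; apply: contraT => P0.
pose rs := [seq (i.+1)%:R : k | i <- iota 0 (size P)].
have : (size rs < size P)%N.
  apply: max_poly_roots => //.
    by apply/allP => _ /mapP [i _ ->]; rewrite /root H // natr_neq0.
  by rewrite map_inj_uniq ?iota_uniq // => i j /natr_inj [].
by rewrite size_map size_iota ltnn.
Qed.

Lemma poly_eq_nonzero (P Q : {poly k}) :
  (forall t, t != 0 -> P.[t] = Q.[t]) -> P = Q.
Proof.
move=> H; apply/eqP; rewrite -subr_eq0; apply/eqP/poly_eq0_nonzero => t t0.
by rewrite hornerD hornerN H // subrr.
Qed.

(** The polynomial curve [gam] passes through g1 at s = 0 and through g2 at s = 1, so [F] and [G]
    both restrict to nonzero polynomials on it, and their product is nonzero at some nonzero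
    parameter. *)
Lemma SL2_coord_domain F G g1 g2 : SL2_coord F -> SL2_coord G ->
  F g1 != 0 -> G g2 != 0 -> exists g, F g * G g != 0.
Proof.
move=> HF HG F1 G2.
have [c1 [c2 [c3 [c4 E]]]] := SL2_unipotent_gen (g1^-1 * g2)%g.
pose gam s := (g1 * (ulo (s * c1) * uup (s * c2) * ulo (s * c3)
                 * uup (s * c4)))%g.
have Hgam : poly_path gam.
  do ![apply: poly_path_mul|exact: poly_path_const|exact: poly_path_ulo
      |exact: poly_path_uup].
have [P HP] := SL2_coord_path Hgam HF; have [Q HQ] := SL2_coord_path Hgam HG.
have P0 : P != 0.
  apply: contraNneq F1 => P0; have := HP 0.
  by rewrite P0 horner0 /gam !mul0r ulo0 uup0 !mulg1 => ->.
have Q0 : Q != 0.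
  apply: contraNneq G2 => Q0; have := HQ 1.
  by rewrite Q0 horner0 /gam !mul1r -E mulVKg => ->.
case: (classic (exists g, F g * G g != 0)) => // H.
have : P * Q = 0.
  apply: poly_eq0_nonzero => t _; rewrite hornerM -HP -HQ; apply/eqP.
  by apply: contraT => Hne; case: H; exists (gam t).
by move/eqP; rewrite mulf_eq0 (negPf P0) (negPf Q0).
Qed.

Lemma SL2_coord_cancel F G H g0 : SL2_coord F -> SL2_coord G -> SL2_coord H ->
  H g0 != 0 -> (forall g, F g * H g = G g * H g) -> F =1 G.
Proof.
move=> HF HG HH H0 E g; apply/eqP; apply: contraT => ne.
have HD : SL2_coord (fun g => F g + (-1) * G g).
  by apply: SL2_coordD => //; apply: SL2_coordM => //; apply: SL2_coord_const.
have [|x] := @SL2_coord_domain _ _ g g0 HD HH _ H0.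
  by rewrite mulN1r subr_eq0.
by rewrite mulN1r mulrBl E subrr eqxx.
Qed.

Definition linear_space (T : Type) (R : (T -> k) -> Prop) : Prop :=
  [/\ forall F G : T -> k, F =1 G -> R F -> R G,
      forall F G : T -> k, R F -> R G -> R (fun x => F x + G x)
    & forall (c : k) (F : T -> k), R F -> R (fun x => c * F x)].

Lemma linear_space_sum (T I : Type) (R : (T -> k) -> Prop) (r : seq I)
    (C : I -> T -> k) (e : I -> k) : linear_space R -> R (fun=> 0) ->
  (forall i, R (C i)) -> R (fun x => \sum_(i <- r) e i * C i x).
Proof.
move=> [Re Ra Rz] R0 HC; elim: r => [|i r IH].
  by apply: Re R0 => x; rewrite big_nil.
by apply: Re (Ra _ _ (Rz (e i) _ (HC i)) IH) => x; rewrite big_cons.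
Qed.

(* Vandermonde: the values at 1, ..., n determine the coefficients linearly. *)
Lemma coef_extract (T : Type) (R : (T -> k) -> Prop) (n : nat)
    (Phi : k -> T -> k) (C : 'I_n -> T -> k) : linear_space R ->
  (forall s, s != 0 -> R (Phi s)) ->
  (forall s x, s != 0 -> Phi s x = \sum_(i < n) s ^+ i * C i x) ->
  forall i, R (C i).
Proof.
move=> lin RPhi E i; case: (lin) => Re Ra Rz.
pose v : 'rV[k]_n := \row_j (j.+1)%:R; pose V := Vandermonde n v.
have R0 : R (fun=> 0).
  by apply: Re (Rz 0 _ (RPhi 1 (oner_neq0 _))) => x; rewrite mul0r.
have HV : V \in unitmx.
  rewrite unitmxE det_Vandermonde unitfE prodf_seq_neq0; apply/allP => a _ /=.
  rewrite prodf_seq_neq0; apply/allP => b _ /=.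
  apply/implyP => lt_ab; rewrite !mxE subr_eq0; apply/eqP => /natr_inj [] eab.
  by move: lt_ab; rewrite eab ltnn.
apply: (Re (fun x => \sum_(j < n) invmx V j i * Phi (j.+1)%:R x)); last first.
  by apply: linear_space_sum => // j; apply/RPhi/natr_neq0.
move=> x; pose w : 'rV[k]_n := \row_l C l x.
have -> : C i x = (w *m (V *m invmx V)) 0 i by rewrite mulmxV // mulmx1 mxE.
rewrite mulmxA mxE; apply: eq_bigr => j _; rewrite mulrC; congr (_ * _).
rewrite E ?natr_neq0 // mxE; apply: eq_bigr => l _.
by rewrite !mxE mulrC.
Qed.

End InfiniteField.

(** * Highest weight vectors *)

Section SphericalAlgebra.
Variables (k : fieldType) (char0 : [pchar k] =i pred0).
Implicit Types (g h : SL2 k) (F G : SL2 k -> k) (x y z s t : k) (P Q : {poly k}).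

(** The same condition as [left_stable], with h for its inverse, which keeps inverses out of the
    computations. *)
Definition left_translatable (R : (SL2 k -> k) -> Prop) : Prop :=
  forall h F, R F -> R (fun g => F (h * g)%g).

(** What remains of [X] after the choice of a point: [sa_rat] records that the action is algebraic,
    [sa_inj] that the orbit of the lower Borel subgroup is dense. *)
Record spherical_algebra (A : (SL2 k -> k) -> Prop) : Prop := {
  sa_lin : linear_space A;
  sa_const : forall c, A (fun=> c);
  sa_mul : forall F G, A F -> A G -> A (fun g => F g * G g);
  sa_rat : forall F, A F ->
    exists (m : nat) (p : 'I_m -> SL2 k -> k) (q : 'I_m -> SL2 k -> k),
      [/\ forall i, SL2_coord (p i), forall i, A (q i)
        & forall h g, F (h * g)%g = \sum_(i < m) p i h * q i g];
  sa_inj : forall F, A F -> (forall b, lower_borel b -> F b = 0) ->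
    forall g, F g = 0 }.

Lemma coef_eq n (c d : 'I_n -> k) :
  (forall t, t != 0 -> \sum_(i < n) t ^+ i * c i = \sum_(i < n) t ^+ i * d i) ->
  forall i, c i = d i.
Proof.
(* The two coefficient families form one family of functions on [bool], and the functions with equal
   values at both points are a linear space. *)
move=> H; pose C (i : 'I_n) (b : bool) := if b then c i else d i.
refine (@coef_extract k char0 bool (fun f => f true = f false) n
  (fun s b => \sum_(i < n) s ^+ i * C i b) C _ _ _) => //.
split=> [F G E|F G -> ->|a F ->] //; by rewrite -!E.
Qed.

Lemma torM t s : t != 0 -> s != 0 -> (tor t * tor s = tor (t * s) :> SL2 k)%g.
Proof.
move=> t0 s0; have [a1 b1 c1 d1] := torE t0; have [a2 b2 c2 d2] := torE s0.
have [a3 b3 c3 d3] := torE (mulf_neq0 t0 s0).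
by apply: SL2_eq; rewrite mx_M ?a1 ?b1 ?c1 ?d1 ?a2 ?b2 ?c2 ?d2 ?a3 ?b3 ?c3 ?d3
  ?invfM; ring.
Qed.

Lemma tor1 : tor 1 = 1%g :> SL2 k.
Proof.
by have [a1 b1 c1 d1] := torE (oner_neq0 k); apply: SL2_eq; rewrite mx_1 //;
   rewrite d1 invr1.
Qed.

Lemma uloM y z : (ulo y * ulo z = ulo (y + z) :> SL2 k)%g.
Proof.
have [a1 b1 c1 d1] := uloE y; have [a2 b2 c2 d2] := uloE z.
have [a3 b3 c3 d3] := uloE (y + z).
by apply: SL2_eq; rewrite mx_M ?a1 ?b1 ?c1 ?d1 ?a2 ?b2 ?c2 ?d2 ?a3 ?b3 ?c3 ?d3;
   ring.
Qed.

Lemma ulo_tor s t : t != 0 -> (ulo s * tor t = tor t * ulo (s * t ^+ 2))%g.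
Proof.
move=> t0; have [a1 b1 c1 d1] := uloE s; have [a2 b2 c2 d2] := torE t0.
have [a3 b3 c3 d3] := uloE (s * t ^+ 2).
by apply: SL2_eq; rewrite !mx_M ?a1 ?b1 ?c1 ?d1 ?a2 ?b2 ?c2 ?d2 ?a3 ?b3 ?c3 ?d3;
   field.
Qed.

Lemma uup_tor s t : t != 0 -> (uup s * tor t = tor t * uup (s / t ^+ 2))%g.
Proof.
move=> t0; have [a1 b1 c1 d1] := uupE s; have [a2 b2 c2 d2] := torE t0.
have [a3 b3 c3 d3] := uupE (s / t ^+ 2).
by apply: SL2_eq; rewrite !mx_M ?a1 ?b1 ?c1 ?d1 ?a2 ?b2 ?c2 ?d2 ?a3 ?b3 ?c3 ?d3;
   field.
Qed.

Lemma lower_borelE (b : SL2 k) : lower_borel b ->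
  mx_a b != 0 /\ b = (tor (mx_a b) * ulo (mx_a b * mx_c b))%g.
Proof.
move=> b0; have a0 : mx_a b != 0.
  by apply/eqP => a0; apply: (SL2_ab_neq0 a0).
split=> //; have [a1 b1 c1 d1] := torE a0.
have [a2 b2 c2 d2] := uloE (mx_a b * mx_c b).
have := SL2_det b; rewrite b0 mul0r subr0 => D.
apply: SL2_eq; rewrite mx_M ?a1 ?b1 ?c1 ?d1 ?a2 ?b2 ?c2 ?d2 ?b0; try by field.
by apply: (mulfI a0); rewrite D; field.
Qed.

Lemma laurent_tor F : SL2_coord F -> exists (N : nat) (P : {poly k}),
  forall t, t != 0 -> t ^+ N * F (tor t) = P.[t].
Proof.
move: F; apply: (@SL2_coord_ind _ (fun F => exists (N : nat) (P : {poly k}),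
  forall t, t != 0 -> t ^+ N * F (tor t) = P.[t])).
- by move=> F G E [N [P H]]; exists N, P => t t0; rewrite -E H.
- by move=> c; exists 0, c%:P => t t0; rewrite mul1r hornerC.
- by exists 0, 'X => t t0; case: (torE t0) => -> *; rewrite mul1r hornerX.
- by exists 0, 0 => t t0; case: (torE t0) => _ -> *; rewrite mul1r hornerC.
- by exists 0, 0 => t t0; case: (torE t0) => _ _ -> *; rewrite mul1r hornerC.
- by exists 1, 1 => t t0; case: (torE t0) => _ _ _ ->; rewrite hornerC mulfV.
- move=> F G [N [P HP]] [M [Q HQ]]; exists (N + M), ('X^M * P + 'X^N * Q).
  by move=> t t0; rewrite !hornerE -HP // -HQ // exprD; ring.
- move=> F G [N [P HP]] [M [Q HQ]]; exists (N + M), (P * Q).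
  by move=> t t0; rewrite hornerM -HP // -HQ // exprD mulrACA.
Qed.

Lemma horner_coef_lt (P : {poly k}) n x : (size P <= n)%N ->
  P.[x] = \sum_(i < n) x ^+ i * P`_i.
Proof.
by move=> le; rewrite (horner_coef_wide x le); apply: eq_bigr => i _;
   rewrite mulrC.
Qed.

Variables (A : (SL2 k -> k) -> Prop) (HA : spherical_algebra A).

Let lin := sa_lin HA.

Lemma sa_ext F G : F =1 G -> A F -> A G.
Proof. by case: lin => H _ _; apply: H. Qed.
Lemma sa_add F G : A F -> A G -> A (fun g => F g + G g).
Proof. by case: lin => _ H _; apply: H. Qed.
Lemma sa_scale c F : A F -> A (fun g => c * F g).
Proof. by case: lin => _ _ H; apply: H. Qed.

(** Rationality at g = 1 writes F(h) as a combination of the regular functions [p i]. *)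
Lemma sa_coord F : A F -> SL2_coord F.
Proof.
case/(sa_rat HA) => m [p [q [Hp _ E]]].
apply: (SL2_coord_ext (F := fun h => \sum_(i < m) q i 1%g * p i h)).
  by move=> g; rewrite -[g in RHS]mulg1 E; apply: eq_bigr => i _; rewrite mulrC.
apply: linear_space_sum => //; last exact: SL2_coord_const.
split; first exact: SL2_coord_ext.
  exact: SL2_coordD.
by move=> c G HG; apply: SL2_coordM => //; apply: SL2_coord_const.
Qed.

Lemma sa_left : left_translatable A.
Proof.
move=> h F /(sa_rat HA) [m [p [q [_ Hq E]]]].
apply: (sa_ext (F := fun g => \sum_(i < m) p i h * q i g)) => //.
by apply: linear_space_sum => //; apply: sa_const.
Qed.

Lemma sa_expr F n : A F -> A (fun g => F g ^+ n).
Proof.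
move=> HF; elim: n => [|n IH]; first exact: (sa_const HA 1).
by apply: sa_ext (sa_mul HA HF IH) => g; rewrite exprS.
Qed.

Lemma sa_path F (gam : k -> SL2 k) : poly_path gam -> A F ->
  exists (n : nat) (C : 'I_n -> SL2 k -> k), (forall i, A (C i)) /\
    forall s g, F (gam s * g)%g = \sum_(i < n) s ^+ i * C i g.
Proof.
move=> Hgam /(sa_rat HA) [m [p [q [Hp Hq E]]]].
have /fin_all_exists [P HP] := fun i => SL2_coord_path Hgam (Hp i).
pose n := (\max_(i < m) size (P i))%N.
exists n, (fun l g => \sum_(i < m) (P i)`_l * q i g); split.
  by move=> l; apply: linear_space_sum => //; apply: sa_const.
move=> s g; rewrite E.
under [RHS]eq_bigr => i _ do rewrite mulr_sumr.
rewrite exchange_big; apply: eq_bigr => i _ /=.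
rewrite HP (@horner_coef_lt _ n) ?leq_bigmax // mulr_suml.
by apply: eq_bigr => l _; rewrite mulrA.
Qed.

(** [C i] has weight i - N; the shift by N clears the poles that the entry d = 1/t of [tor t]
    creates at t = 0. *)
Lemma sa_weights F : A F ->
  exists (N n : nat) (C : 'I_n -> SL2 k -> k), [/\ forall i, A (C i),
    forall i t g, t != 0 -> t ^+ N * C i (tor t * g)%g = t ^+ i * C i g
  & forall g, F g = \sum_(i < n) C i g].
Proof.
move=> /(sa_rat HA) [m [p [q [Hp Hq E]]]].
have /fin_all_exists [N /fin_all_exists [P HP]] := fun i => laurent_tor (Hp i).
pose M := (\sum_(i < m) N i)%N.
pose Q i := 'X^(M - N i) * P i.
have HQ i t : t != 0 -> t ^+ M * p i (tor t) = (Q i).[t].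
  move=> t0; rewrite !hornerE -HP // mulrA -exprD subnK //.
  by rewrite /M (bigD1 i) //= leq_addr.
pose n := (\max_(i < m) size (Q i))%N.
pose C (l : 'I_n) g := \sum_(i < m) (Q i)`_l * q i g.
have EC t g : t != 0 -> t ^+ M * F (tor t * g)%g = \sum_(l < n) t ^+ l * C l g.
  move=> t0; rewrite E /C mulr_sumr.
  under [RHS]eq_bigr => i _ do rewrite mulr_sumr.
  rewrite exchange_big; apply: eq_bigr => i _ /=.
  rewrite mulrA HQ // (@horner_coef_lt _ n) ?leq_bigmax // mulr_suml.
  by apply: eq_bigr => l _; rewrite mulrA.
exists M, n, C; split.
- by move=> l; apply: linear_space_sum => //; apply: sa_const.
(* The coefficients of t in the two expansions of F([tor t] [tor s] g) = F([tor (t * s)] g) are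
   compared. *)
- move=> l s g s0; move: l.
  apply: (coef_eq (c := fun l => s ^+ M * C l (tor s * g)%g)
                  (d := fun l => s ^+ l * C l g)) => t t0.
  transitivity (s ^+ M * (t ^+ M * F (tor t * (tor s * g))%g)).
    by rewrite EC // mulr_sumr; apply: eq_bigr => l _; ring.
  rewrite mulgA torM // mulrA -exprMn [s * t]mulrC EC ?mulf_neq0 //.
  by apply: eq_bigr => l _; rewrite exprMn; ring.
- move=> g; rewrite -[LHS]mul1r -[in LHS](expr1n _ M) -[g in LHS]mul1g -tor1.
  rewrite EC ?oner_neq0 //; by apply: eq_bigr => l _; rewrite expr1n mul1r.
Qed.

(** The lower Borel subgroup is the torus times the lower unipotent group, so a weight vector that
    vanishes on the latter vanishes on the former, and [sa_inj] applies. *)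
Lemma sa_weight_eq0 F N i : A F ->
  (forall t g, t != 0 -> t ^+ N * F (tor t * g)%g = t ^+ i * F g) ->
  (forall z, F (ulo z) = 0) -> forall g, F g = 0.
Proof.
move=> AF HF F0; apply: (sa_inj HA) => // b /lower_borelE [a0 ->].
have := HF _ (ulo (mx_a b * mx_c b)) a0; rewrite F0 mulr0 => /eqP.
by rewrite mulf_eq0 expf_eq0 (negPf a0) andbF => /eqP.
Qed.

Definition weight n F : Prop :=
  forall t g, t != 0 -> F (tor t * g)%g = t ^+ n * F g.

Lemma sa_weight_inj n F G : A F -> A G -> weight n F -> weight n G ->
  (forall z, F (ulo z) = G (ulo z)) -> F =1 G.
Proof.
move=> AF AG wF wG E g; apply/eqP; rewrite -subr_eq0 -mulN1r; apply/eqP.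
apply: (@sa_weight_eq0 (fun g => F g + (-1) * G g) 0 n) => //.
- by apply: sa_add => //; apply: sa_scale.
- by move=> t h t0; rewrite wF // wG //; ring.
- by move=> z; rewrite E mulN1r subrr.
Qed.

Lemma sa_ulo_poly F : A F -> exists P : {poly k}, forall z, F (ulo z) = P.[z].
Proof.
move=> /sa_coord HF; have [P HP] := SL2_coord_path (poly_path_ulo 1) HF.
by exists P => z; rewrite -HP mulr1.
Qed.

(** [G] is the coefficient of s^j, with j the degree of [phi], in F([ulo s] g). On [ulo z] this is
    the top coefficient of phi(s + z), which does not depend on z. Conjugation by [tor t] scales s
    by t^2, which raises the weight by 2j. *)
Lemma sa_top mu F (phi : {poly k}) : A F -> weight mu F ->
  (forall z, F (ulo z) = phi.[z]) -> phi != 0 ->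
  exists G, [/\ A G, weight (mu + (size phi).-1.*2) G
    & forall z, G (ulo z) = lead_coef phi].
Proof.
move=> AF wF Fphi phi0.
have [n [C [AC EC]]] := sa_path (poly_path_ulo 1) AF.
have {}EC s g : F (ulo s * g)%g = \sum_(i < n) s ^+ i * C i g.
  by rewrite -EC mulr1.
have wC (i : 'I_n) : weight (mu + i.*2) (C i).
  move=> t g t0; move: i.
  apply: (coef_eq (c := fun l => C l (tor t * g)%g)
                  (d := fun l => t ^+ (mu + l.*2) * C l g)) => s s0.
  rewrite -EC mulgA ulo_tor // -mulgA wF // EC mulr_sumr.
  by apply: eq_bigr => l _; rewrite exprMn -exprM -mul2n exprD; ring.
have Cphi z : \poly_(i < n) (if (insub i : option 'I_n) is Some l then C l (ulo z) else 0)
              = phi \Po ('X + z%:P).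
  apply: (poly_eq_nonzero char0) => s _.
  rewrite horner_comp !hornerE -Fphi -uloM EC horner_poly.
  by apply: eq_bigr => i _; rewrite valK mulrC.
have lc z : (phi \Po ('X + z%:P))`_(size phi).-1 = lead_coef phi.
  have sz : size (phi \Po ('X + z%:P)) = size phi.
    by rewrite size_comp_poly2 // -[z%:P]opprK -polyCN size_XsubC.
  rewrite -sz -/(lead_coef _) lead_coef_comp; last first.
    by rewrite -[z%:P]opprK -polyCN size_XsubC.
  by rewrite -[z%:P]opprK -polyCN lead_coefXsubC expr1n mulr1.
have jn : ((size phi).-1 < n)%N.
  rewrite ltnNge; apply/negP => le; have := lc 0.
  rewrite -Cphi coef_poly ltnNge le /= => /esym/eqP.
  by rewrite lead_coef_eq0 (negPf phi0).
exists (C (Ordinal jn)); split=> //; first exact: wC.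
by move=> z; rewrite -(lc z) -Cphi coef_poly jn insubT.
Qed.

(** The homogenization b^n P(a / b), written as a sum so that it makes sense at b = 0. *)
Definition hform n (P : {poly k}) g : k :=
  \sum_(i < n.+1) P`_i * (mx_a g ^+ i * mx_b g ^+ (n - i)).

Lemma hform_bn0 n P g : (size P <= n.+1)%N -> mx_b g != 0 ->
  hform n P g = mx_b g ^+ n * P.[mx_a g / mx_b g].
Proof.
move=> sP b0; rewrite (horner_coef_lt _ sP) mulr_sumr; apply: eq_bigr => i _.
have le : (i <= n)%N by rewrite -ltnS.
have -> : mx_b g ^+ n = mx_b g ^+ (n - i) * mx_b g ^+ i.
  by rewrite -exprD subnK.
rewrite expr_div_n; field.
by rewrite expf_eq0 (negPf b0) andbF.
Qed.

Lemma hform_b0 n P g : mx_b g = 0 -> hform n P g = P`_n * mx_a g ^+ n.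
Proof.
move=> b0; rewrite /hform big_ord_recr big1 /= ?add0r ?subnn ?mulr1 //.
by move=> i _; rewrite b0 expr0n subn_eq0 leqNgt ltn_ord /= !mulr0.
Qed.

(** A curve with first row (x, 1): restricting a form to it dehomogenizes the form. *)
Definition xpath (x : k) : SL2 k := sl2 x 1 (-1) 0.

Lemma xpathE x : [/\ mx_a (xpath x) = x, mx_b (xpath x) = 1,
  mx_c (xpath x) = -1 & mx_d (xpath x) = 0].
Proof. by apply: sl2E; ring. Qed.

Lemma poly_path_x : poly_path xpath.
Proof.
exists 'X, 1, (-1), 0 => x; case: (xpathE x) => -> -> -> ->.
by rewrite !hornerE.
Qed.

Lemma hform_x n P x : (size P <= n.+1)%N -> hform n P (xpath x) = P.[x].
Proof.
move=> sP; case: (xpathE x) => Ea Eb _ _.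
by rewrite hform_bn0 // Eb ?oner_neq0 // expr1n mul1r Ea divr1.
Qed.

Lemma hform_weight n P : weight n (hform n P).
Proof.
move=> t g t0; rewrite /hform mulr_sumr; apply: eq_bigr => i _.
have [a1 b1 _ _] := torE t0; rewrite mx_aM mx_bM a1 b1 !mul0r !addr0 !exprMn.
have le : (i <= n)%N by rewrite -ltnS.
have -> : t ^+ n = t ^+ (n - i) * t ^+ i by rewrite -exprD subnK.
by ring.
Qed.

Lemma hform_ulo n P z : hform n P (ulo z) = P`_n.
Proof.
by case: (uloE z) => Ea Eb _ _; rewrite hform_b0 // Ea expr1n mulr1.
Qed.

(** Highest weight vectors, normalized: being monic of degree n means taking the value 1 on the
    lower unipotent group. *)
Definition hw n (P : {poly k}) : Prop :=
  [/\ size P = n.+1, P \is monic & A (hform n P)].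

Lemma hw_coef n P : hw n P -> P`_n = 1.
Proof. by case=> sP /monicP; rewrite /lead_coef sP. Qed.

(** Multiplicity one: both forms have weight n and are 1 on the lower unipotent group, so they agree
    on the lower Borel subgroup and hence everywhere. *)
Lemma hw_uniq n P Q : hw n P -> hw n Q -> P = Q.
Proof.
move=> hP hQ; have [sP mP AP] := hP; have [sQ mQ AQ] := hQ.
apply: (poly_eq_nonzero char0) => x _.
rewrite -(@hform_x n P) ?sP // -(@hform_x n Q) ?sQ //.
apply: (sa_weight_inj AP AQ (@hform_weight _ _) (@hform_weight _ _)) => z.
by rewrite !hform_ulo (hw_coef hP) (hw_coef hQ).
Qed.

Lemma hform_mul n m P Q g : (size P <= n.+1)%N -> (size Q <= m.+1)%N ->
  hform (n + m) (P * Q) g = hform n P g * hform m Q g.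
Proof.
move=> sP sQ; have sPQ : (size (P * Q)%R <= (n + m).+1)%N.
  apply: leq_trans (size_polyMleq _ _) _.
  by case: (size P) sP => [|p] sP; case: (size Q) sQ => [|q] sQ; lia.
have [b0|b0] := eqVneq (mx_b g) 0; last first.
  by rewrite !hform_bn0 // hornerM exprD; ring.
rewrite !hform_b0 // exprD mulrACA; congr (_ * _).
rewrite coefM; have ltn : (n < (n + m).+1)%N by lia.
rewrite (bigD1 (Ordinal ltn)) //= addKn big1 ?addr0 // => i /eqP ne.
have : (n < i)%N \/ (m < n + m - i)%N.
  have ne' : i <> n :> nat by move=> e; apply: ne; apply: val_inj.
  by have := ltn_ord i; lia.
case=> lt.
  by rewrite [P`_i]nth_default ?mul0r //; apply: leq_trans lt.
by rewrite [Q`__]nth_default ?mulr0 //; apply: leq_trans lt.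
Qed.

Lemma hw_mul n m P Q : hw n P -> hw m Q -> hw (n + m) (P * Q).
Proof.
move=> [sP mP AP] [sQ mQ AQ]; split.
- by rewrite size_monicM // ?monic_neq0 // sP sQ addSn addnS.
- by rewrite monicMr.
- apply: sa_ext (sa_mul HA AP AQ) => g; rewrite hform_mul ?sP ?sQ //.
Qed.

Lemma hw0 : hw 0 1.
Proof.
split; rewrite ?size_poly1 ?monic1 //; apply: sa_ext (sa_const HA 1) => g.
by rewrite /hform big_ord_recl big_ord0 coef1 !mulr1 addr0.
Qed.

Lemma hw_exp n P m : hw n P -> hw (n * m) (P ^+ m).
Proof.
move=> hP; elim: m => [|m IH]; first by rewrite muln0; apply: hw0.
by rewrite mulnS exprS; apply: hw_mul.
Qed.

Lemma hw_pow_eq n m P Q : hw n P -> hw m Q -> P ^+ m = Q ^+ n.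
Proof.
move=> hP hQ; have h1 := hw_exp m hP; have h2 := hw_exp n hQ.
by rewrite mulnC in h2; apply: hw_uniq h1 h2.
Qed.

(* A lower unipotent invariant of weight [n] is a form of degree [n] in the
   first row, because [g] lies in [U^- tor(b) xpath(a / b)] when [b != 0] and in
   [U^- tor(a) uup(b / a)] when [a != 0]. *)
Lemma hw_of_invariant n G : A G -> weight n G -> (forall z, G (ulo z) = 1) ->
  exists2 P, hw n P & G =1 hform n P.
Proof.
move=> AG wG G1.
have GB b : lower_borel b -> G b = mx_a b ^+ n.
  by move=> /lower_borelE [a0 {1}->]; rewrite wG // G1 mulr1.
(* On the lower Borel subgroup [G] is the character a^n, hence invariant there; [sa_inj] extends the
   invariance to SL_2. *)
have inv s g : G (ulo s * g)%g = G g.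
  apply/eqP; rewrite -subr_eq0 -mulN1r; apply/eqP.
  apply: (sa_inj HA (F := fun g => G (ulo s * g)%g + (-1) * G g)).
    by apply: sa_add; [apply: sa_left|apply: sa_scale].
  move=> b Hb; have [a1 b1 c1 d1] := uloE s.
  have Hsb : lower_borel (ulo s * b)%g.
    by rewrite /lower_borel mx_M a1 b1 Hb; ring.
  by rewrite !GB // mx_M a1 b1 mul1r mul0r addr0 mulN1r subrr.
have [P HP] := SL2_coord_path poly_path_x (sa_coord AG).
have [Q HQ] := SL2_coord_path (poly_path_uup 1) (sa_coord AG).
have {}HQ s : G (uup s) = Q.[s] by rewrite -HQ mulr1.
have Q0 : Q`_0 = 1 by rewrite -horner_coef0 -HQ uup0 -ulo0 G1.
have Gb g : mx_b g != 0 -> G g = mx_b g ^+ n * P.[mx_a g / mx_b g].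
  move=> b0; rewrite -HP -wG // -[RHS](inv (mx_d g / mx_b g)) mulgA.
  congr (G _); have [a1 b1 c1 d1] := uloE (mx_d g / mx_b g).
  have [a2 b2 c2 d2] := torE b0.
  have [a3 b3 c3 d3] := xpathE (mx_a g / mx_b g).
  apply: SL2_eq; rewrite !mx_M ?a1 ?b1 ?c1 ?d1 ?a2 ?b2 ?c2 ?d2 ?a3 ?b3 ?c3 ?d3;
    try by field.
  apply: (mulfI b0).
  have -> : mx_b g * mx_c g = mx_a g * mx_d g - 1 by rewrite -(SL2_det g); ring.
  by field.
have Ga g : mx_a g != 0 -> G g = mx_a g ^+ n * Q.[mx_b g / mx_a g].
  move=> a0; rewrite -HQ -wG // -[RHS](inv (mx_c g / mx_a g)) mulgA.
  congr (G _); have [a1 b1 c1 d1] := uloE (mx_c g / mx_a g).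
  have [a2 b2 c2 d2] := torE a0.
  have [a3 b3 c3 d3] := uupE (mx_b g / mx_a g).
  apply: SL2_eq; rewrite !mx_M ?a1 ?b1 ?c1 ?d1 ?a2 ?b2 ?c2 ?d2 ?a3 ?b3 ?c3 ?d3;
    try by field.
  apply: (mulfI a0).
  have -> : mx_a g * mx_d g = mx_b g * mx_c g + 1 by rewrite -(SL2_det g); ring.
  by field.
have Qn0 : Q != 0 by apply: contra_eq_neq Q0 => ->; rewrite coef0 eq_sym oner_eq0.
pose e := (size Q).-1.
have sQ : size Q = e.+1 by rewrite prednK // size_poly_gt0.
(* The reversal of [Q]. Where a and b are both nonzero, the two descriptions of [G] give x^e P = x^n
   rQ. As rQ(0) is the leading coefficient of [Q], it is nonzero, so e <= n and [P] is the reversal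
   of [Q] in degree n. *)
pose rQ := \sum_(i < e.+1) Q`_i *: 'X^(e - i).
have PQ : 'X^e * P = 'X^n * rQ.
  apply: (poly_eq_nonzero char0) => x x0; rewrite !hornerE -HP.
  case: (xpathE x) => Ea Eb _ _; rewrite Ga Ea // Eb.
  rewrite (@horner_coef_lt _ e.+1) ?sQ // mulrCA; congr (_ * _).
  rewrite /rQ horner_sum mulr_sumr; apply: eq_bigr => i _; rewrite !hornerE.
  have le : (i <= e)%N by rewrite -ltnS.
  have -> : x ^+ e = x ^+ (e - i) * x ^+ i by rewrite -exprD subnK.
  by rewrite ?mul1r exprVn /=; field; rewrite expf_eq0 (negPf x0) andbF.
have rQ0 : rQ.[0] != 0.
  rewrite /rQ horner_sum big_ord_recr /= subnn hornerZ hornerXn mulr1 big1.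
    by rewrite add0r -[Q`_e]/(lead_coef Q) lead_coef_eq0.
  by move=> i _; rewrite !hornerE expr0n subn_eq0 leqNgt ltn_ord mulr0.
have en : (e <= n)%N.
  rewrite leqNgt; apply/negP => lt; move: PQ rQ0.
  rewrite -(subnK (ltnW lt)) exprD [_ * 'X^n]mulrC -mulrA.
  move/(mulfI _) <-; last by rewrite monic_neq0 ?monicXn.
  by rewrite !hornerE expr0n subn_eq0 leqNgt lt mul0r eqxx.
have EP : P = \sum_(i < e.+1) Q`_i *: 'X^(n - i).
  have xe : 'X^e != 0 :> {poly k} by rewrite monic_neq0 ?monicXn.
  apply: (mulfI xe); rewrite PQ /rQ !mulr_sumr; apply: eq_bigr => i _.
  rewrite -!scalerAr -!exprD; congr (_ *: 'X^_).
  by have := ltn_ord i; lia.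
have Pn : P`_n = 1.
  rewrite EP coef_sum big_ord_recl /= coefZ coefXn subn0 eqxx mulr1 Q0.
  rewrite big1 ?addr0 // => i _; rewrite coefZ coefXn.
  rewrite (_ : (n == n - _)%N = false) ?mulr0 //.
  by apply/negbTE/eqP; rewrite /bump /=; have := ltn_ord i; lia.
have sP : size P = n.+1.
  apply/eqP; rewrite eqn_leq; apply/andP; split; last first.
    by rewrite ltnNge; apply/negP => le; move/eqP: Pn;
       rewrite nth_default // eq_sym oner_eq0.
  rewrite EP; apply: leq_trans (size_sum _ _ _) _; apply/bigmax_leqP => i _.
  by apply: leq_trans (size_scale_leq _ _) _; rewrite size_polyXn ltnS leq_subr.
have GP : G =1 hform n P.
  move=> g; have [b0|b0] := eqVneq (mx_b g) 0.
    by rewrite GB // hform_b0 // Pn mul1r.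
  by rewrite Gb // hform_bn0 // sP.
exists P => //; split=> //; last exact: sa_ext AG.
by rewrite monicE /lead_coef sP Pn.
Qed.

End SphericalAlgebra.

(** * Generation by highest weight vectors, and the Hessian *)

Section Generation.
Variables (k : fieldType) (char0 : [pchar k] =i pred0).
Implicit Types (g h : SL2 k) (F G : SL2 k -> k) (x y z s t : k).
Implicit Types (P Q : {poly k}).

Lemma coef_1DZX z i r : ((1 + z *: 'X) ^+ i)`_r = 'C(i, r)%:R * z ^+ r.
Proof.
have -> : (1 + z *: 'X) ^+ i = \poly_(j < i.+1) ('C(i, j)%:R * z ^+ j).
  rewrite exprDn poly_def; apply: eq_bigr => j _.
  by rewrite expr1n mul1r exprZn -scaler_nat scalerA.
by rewrite coef_poly ltnS; case: leqP => // lt; rewrite bin_small // mul0r.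
Qed.

(* The coefficient of [s ^ l] in [hform n P (uup s * ulo z)], a polynomial in
   [z]. *)
Definition polar n P l : {poly k} :=
  \sum_(i < n.+1) (if (l < n - i)%N then 0
    else (P`_i * 'C(i, l - (n - i))%:R) *: 'X^(l - (n - i))).

Lemma size_polar n P l : (size (polar n P l) <= l.+1)%N.
Proof.
apply: leq_trans (size_sum _ _ _) _; apply/bigmax_leqP => i _.
case: ifP => _; first by rewrite size_poly0.
by apply: leq_trans (size_scale_leq _ _) _; rewrite size_polyXn ltnS leq_subr.
Qed.

Lemma coef_polar n P l : (polar n P l)`_l = P`_n * 'C(n, l)%:R.
Proof.
rewrite coef_sum big_ord_recr /= subnn ltn0 subn0 coefZ coefXn eqxx mulr1.
rewrite big1 ?add0r // => i _; case: ifP => [_|H]; first by rewrite coef0.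
rewrite coefZ coefXn (_ : (l == _) = false) ?mulr0 //.
by apply/negbTE/eqP; have := ltn_ord i; move: H; lia.
Qed.

Lemma hform_uup_ulo n P s z : hform n P (uup s * ulo z)%g =
  (\sum_(i < n.+1) (P`_i *: (1 + z *: 'X) ^+ i * 'X^(n - i))).[s].
Proof.
have [a1 b1 c1 d1] := uupE s; have [a2 b2 c2 d2] := uloE z.
rewrite /hform horner_sum; apply: eq_bigr => i _.
by rewrite !mx_M a1 b1 c2 d2 a2 b2 !hornerE /= [s * z]mulrC.
Qed.

Lemma coef_hform_uup_ulo n P l z :
  (\sum_(i < n.+1) (P`_i *: (1 + z *: 'X) ^+ i * 'X^(n - i)))`_l =
  (polar n P l).[z].
Proof.
rewrite coef_sum horner_sum; apply: eq_bigr => i _.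
rewrite coefMXn; case: ifP => _; first by rewrite horner0.
by rewrite coefZ coef_1DZX !hornerE.
Qed.

Variables (A : (SL2 k -> k) -> Prop) (HA : spherical_algebra A).

(** [E l] is the coefficient of s^l in the translate by [uup s], that is, a divided power of a root
    vector applied to the form; its weight is n - 2l. The last clause is stated for arbitrary [R]
    because the generation argument applies it to spaces other than [A]. *)
Lemma sa_polarize n P : hw A n P -> exists E : nat -> SL2 k -> k,
  [/\ forall l, A (E l),
      forall l t g, t != 0 -> t ^+ l.*2 * E l (tor t * g)%g = t ^+ n * E l g,
      forall l z, E l (ulo z) = (polar n P l).[z],
      forall x, [/\ E 0 (xpath x) = P.[x], E 1 (xpath x) = - P^`().[x]
        & 2%:R * E 2 (xpath x) = P^`()^`().[x]]
    & forall R, linear_space R -> left_translatable R -> R (hform n P) ->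
        forall l, R (E l)].
Proof.
case=> sP mP AP.
have [N [C [AC]]] := sa_path HA (poly_path_uup 1) AP.
move=> EC0; have {EC0}EC s g : hform n P (uup s * g)%g = \sum_(i < N) s ^+ i * C i g.
  by rewrite -EC0 mulr1.
pose E l g := if (insub l : option 'I_N) is Some i then C i g else 0.
have EE (i : 'I_N) g : E i g = C i g by rewrite /E valK.
have Epoly g l (T : {poly k}) :
    (forall s, hform n P (uup s * g)%g = T.[s]) -> E l g = T`_l.
  move=> HT; have <- : \poly_(i < N) E i g = T.
    apply: (poly_eq_nonzero char0) => s _; rewrite -HT EC horner_poly.
    by apply: eq_bigr => i _; rewrite EE mulrC.
  by rewrite coef_poly /E; case: insubP => [i -> //|/negbTE ->].
exists E; split.
- move=> l; case lt: (l < N)%N; last first.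
    apply: (sa_ext HA _ (sa_const HA 0)) => g.
    by rewrite /E; case: insubP => //; rewrite lt.
  by apply: (sa_ext HA _ (AC (Ordinal lt))) => g; rewrite -EE.
- move=> l t g t0; rewrite /E; case: insubP => [i _ <-|_]; last by rewrite !mulr0.
  move: i; apply: (coef_eq char0 (c := fun i => t ^+ i.*2 * C i (tor t * g)%g)
    (d := fun i => t ^+ n * C i g)) => s s0.
  transitivity (hform n P (uup (s * t ^+ 2) * (tor t * g))%g).
    rewrite EC; apply: eq_bigr => i _.
    by rewrite exprMn -exprM mul2n; ring.
  rewrite mulgA uup_tor // -mulgA hform_weight // mulfK ?expf_neq0 // EC mulr_sumr.
  by apply: eq_bigr => i _; ring.
- move=> l z; rewrite -coef_hform_uup_ulo; apply: Epoly => s.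
  exact: hform_uup_ulo.
(* [uup s] times [xpath x] is [xpath (x - s)], so the values of [E l] along this curve are the
   signed Taylor coefficients of [P] at x. *)
- move=> x; pose T := \poly_(i < size P) ((-1) ^+ i * P^`N(i).[x]).
  have HT s : hform n P (uup s * xpath x)%g = T.[s].
    have [a1 b1 c1 d1] := uupE s; have [a2 b2 c2 d2] := xpathE x.
    have -> : (uup s * xpath x = sl2 (x - s) 1 (-1) 0)%g.
      have H : (x - s) * 0 - 1 * -1 = 1 by ring.
      have [a3 b3 c3 d3] := sl2E H.
      by apply: SL2_eq; rewrite !mx_M ?a1 ?b1 ?c1 ?d1 ?a2 ?b2 ?c2 ?d2 ?a3 ?b3
        ?c3 ?d3; ring.
    rewrite -/(xpath (x - s)) hform_x ?sP // nderiv_taylor; last exact: mulrC.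
    rewrite horner_poly; apply: eq_bigr => i _.
    by rewrite [(- s) ^+ i]exprNn mulrCA mulrA.
  have coT l : E l (xpath x) = (-1) ^+ l * P^`N(l).[x].
    rewrite (Epoly _ _ _ HT) coef_poly; case: ltnP => // le.
    by rewrite nderivn_poly0 // horner0 mulr0.
  rewrite !coT poly.nderivn0 poly.nderivn1 expr0 expr1 mul1r mulN1r sqrrN expr1n mul1r.
  split=> //; have := nderivn_def 2 P => /(congr1 (fun p => p.[x])).
  by rewrite derivnS derivn1 hornerMn -mulr_natl => ->.
- move=> R linR leftR RP l; case: (linR) => Re Ra Rz.
  case lt: (l < N)%N; last first.
    apply: (Re (fun g => 0 * hform n P g)); last exact: Rz.
    by move=> g; rewrite mul0r /E; case: insubP => //; rewrite lt.
  apply: (Re (C (Ordinal lt))); first by move=> g; rewrite -EE.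
  apply: (coef_extract char0 (Phi := fun s g => hform n P (uup s * g)%g) linR).
    by move=> s _; apply: leftR.
  by move=> s g _; apply: EC.
Qed.

(* Descent on the degree in [z] of [F (ulo z)]: the leading coefficient of
   [F (ulo s * g)] in [s] is a highest weight vector, and one of its polarizations
   cancels the leading term of [F (ulo z)]. *)
Lemma sa_weight_generated R mu F : linear_space R -> left_translatable R ->
  (forall n P, hw A n P -> R (hform n P)) -> A F -> weight mu F -> R F.
Proof.
move=> linR leftR HR AF wF; case: (linR) => Re Ra Rz.
have [phi Hphi] := sa_ulo_poly HA AF.
have [d le_d] : exists d, (size phi <= d)%N by exists (size phi).
elim: d => [|d IH] in F AF wF phi Hphi le_d *.
  have F0 : forall g, F g = 0.
    apply: (sa_weight_eq0 HA (N := 0) (i := mu)) => //.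
      by move=> t g t0; rewrite mul1r wF.
    move=> z; rewrite Hphi; move: le_d.
    by rewrite leqn0 size_poly_eq0 => /eqP ->; rewrite horner0.
  apply: (Re (fun g => 0 * hform 0 1 g)); first by move=> g; rewrite F0 mul0r.
  by apply/Rz/HR/(hw0 HA).
have [phi0|phi0] := eqVneq phi 0.
  by apply: (IH _ AF wF phi) => //; rewrite phi0 size_poly0.
have [G [AG wG Gz]] := sa_top char0 HA AF wF Hphi phi0.
pose j := (size phi).-1; pose n := (mu + j.*2)%N; pose c := lead_coef phi.
have c0 : c != 0 by rewrite lead_coef_eq0.
have [||z|P hP _] := @hw_of_invariant k char0 A HA n (fun g => c^-1 * G g).
- exact: (sa_scale HA).
- by move=> t g t0; rewrite wG //; ring.
- by rewrite Gz mulVf.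
have [E [AE wE Ez _ RE]] := sa_polarize hP.
(* Here j <= n because n = mu + 2j. The binomial is the leading coefficient of [polar n P j], and
   dividing by it makes the leading terms cancel. *)
have bin0 : 'C(n, j)%:R != 0 :> k.
  by rewrite natr_neq0 // bin_gt0 /n; lia.
pose a := c / 'C(n, j)%:R.
have RE' : R (fun g => a * E j g) := Rz a _ (RE R linR leftR (HR _ _ hP) j).
have AE' : A (fun g => a * E j g) by apply: (sa_scale HA).
pose F' g := F g + (-1) * (a * E j g).
suff RF' : R F'.
  apply: (Re (fun g => F' g + a * E j g)); last exact: Ra.
  by move=> g; rewrite /F'; ring.
apply: (IH F' _ _ (phi - a *: polar n P j)).
- by apply: (sa_add HA) => //; apply: (sa_scale HA).
- move=> t g t0; rewrite /F' wF // mulrDr; congr (_ + _).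
  have := wE j t g t0; rewrite /n exprD [t ^+ mu * _]mulrC -mulrA.
  by move/(mulfI (expf_neq0 _ t0)) ->; ring.
- by move=> z; rewrite /F' Hphi Ez hornerD hornerN hornerZ; ring.
- have sphi : size phi = j.+1 by rewrite prednK // size_poly_gt0.
  have le : (size (phi - a *: polar n P j)%R <= j.+1)%N.
    apply: leq_trans (size_polyD _ _) _; rewrite geq_max sphi leqnn size_polyN.
    by apply: leq_trans (size_scale_leq _ _) _; apply: size_polar.
  suff lt : (size (phi - a *: polar n P j)%R < j.+1)%N.
    by move: lt le_d; rewrite sphi; lia.
  rewrite ltn_neqAle le andbT; apply/eqP => e.
  have : lead_coef (phi - a *: polar n P j) != 0.
    by rewrite lead_coef_eq0 -size_poly_eq0 e.
  rewrite /lead_coef e /= coefB coefZ coef_polar (hw_coef hP) mul1r.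
  by rewrite /a divfK // /c /lead_coef sphi /= subrr eqxx.
Qed.

(** The descent needs a nonnegative weight. A component of negative weight is moved by the Weyl
    element, which inverts the torus, and moved back by left translation inside [R]. *)
Lemma sa_generated R F : linear_space R -> left_translatable R ->
  (forall n P, hw A n P -> R (hform n P)) -> A F -> R F.
Proof.
move=> linR leftR HR AF; case: (linR) => Re Ra Rz.
have [N [n [C [AC wC EC]]]] := sa_weights char0 HA AF.
have R0 : R (fun=> 0).
  apply: (Re (fun g => 0 * hform 0 1 g)); first by move=> g; rewrite mul0r.
  by apply/Rz/HR/(hw0 HA).
apply: (Re (fun g => \sum_(i < n) 1 * C i g)).
  by move=> g; rewrite EC; apply: eq_bigr => i _; rewrite mul1r.
apply: linear_space_sum => // i; have [le|lt] := leqP N i.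
  apply: (@sa_weight_generated R (i - N)) => // t g t0.
  have := wC i t g t0.
  have -> : t ^+ i = t ^+ N * t ^+ (i - N) by rewrite -exprD subnKC.
  rewrite -mulrA.
  by move/(mulfI (expf_neq0 _ t0)).
pose C' g := C i (weyl k * g)%g.
have RC' : R C'.
  apply: (@sa_weight_generated R (N - i)) => //; first exact: (sa_left HA).
  move=> t g t0; rewrite /C'.
  have -> : (weyl k * (tor t * g) = tor t^-1 * (weyl k * g))%g.
    rewrite !mulgA; congr (_ * _)%g; have ti : t^-1 != 0 by rewrite invr_eq0.
    have [a1 b1 c1 d1] := torE t0; have [a2 b2 c2 d2] := torE ti.
    have [a3 b3 c3 d3] := weylE k.
    by apply: SL2_eq; rewrite !mx_M ?a1 ?b1 ?c1 ?d1 ?a2 ?b2 ?c2 ?d2 ?a3 ?b3 ?c3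
      ?d3 ?invrK; ring.
  have ti : t^-1 != 0 by rewrite invr_eq0.
  have := wC i t^-1 (weyl k * g)%g ti.
  have -> : t^-1 ^+ N = t^-1 ^+ i * t^-1 ^+ (N - i) by rewrite -exprD subnKC // ltnW.
  rewrite -mulrA => /(mulfI (expf_neq0 _ ti)) <-.
  by rewrite exprVn mulrA mulfV ?mul1r // expf_neq0.
apply: (Re (fun g => C' ((weyl k)^-1 * g)%g)); last exact: leftR.
by move=> g; rewrite /C' mulVKg.
Qed.

(* On [ulo z] the Hessian [2n E_0 E_2 - (n - 1) E_1^2] of [hform n P] does not
   depend on [z], so it is zero or a multiple of a highest weight vector; on
   [xpath x] it is [n P P'' - (n - 1) P'^2]. *)
Lemma sa_hessian n P : (1 < n)%N -> hw A n P -> exists (kap : k) (Q : {poly k}),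
  n%:R *: (P * P^`()^`()) - n.-1%:R *: P^`() ^+ 2 = kap *: Q /\
  (kap != 0 -> hw A (n.*2 - 4) Q).
Proof.
move=> n1 hP; have [E [AE wE Ez Ex _]] := sa_polarize hP.
pose G g := n%:R * (E 0 g * (2%:R * E 2 g)) + (- n.-1%:R) * (E 1 g * E 1 g).
have AG : A G.
  apply: (sa_add HA); apply: (sa_scale HA); apply: (sa_mul HA) => //.
  exact: (sa_scale HA).
have wG : weight (n.*2 - 4) G.
  (* [E 1] and [E 2] have weights n - 2 and n - 4, the second possibly negative; the factor t^4
     keeps all exponents natural. *)
  move=> t g t0; apply: (mulfI (expf_neq0 4 t0)).
  rewrite mulrA -exprD subnKC; last by rewrite -muln2; lia.
  have := wE 0 t g t0; have := wE 1 t g t0; have := wE 2 t g t0.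
  rewrite /= mul1r => e2 e1 e0; rewrite /G e0 mulrDr -mul2n mulnC exprM.
  transitivity (n%:R * (t ^+ n * E 0 g * (2%:R * (t ^+ 4 * E 2 (tor t * g)%g)))
    + - n.-1%:R * (t ^+ 2 * E 1 (tor t * g)%g * (t ^+ 2 * E 1 (tor t * g)%g))).
    by ring.
  by rewrite e1 e2; ring.
(* The value of [G] at [ulo 0], where [E 0], [E 1], [E 2] are the top three coefficients of [P]. The
   coefficients n and n - 1 of the Hessian are what makes the terms in z and z^2 cancel. *)
pose kap := n%:R * (2%:R * P`_(n - 2)) - n.-1%:R * P`_n.-1 ^+ 2.
have Gz z : G (ulo z) = kap.
  case: n n1 hP @G @kap {AG wG wE Ex} Ez => [|[|n]] // _ hP G kap Ez.
  have Pn := hw_coef hP.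
  have p0 : (polar n.+2 P 0).[z] = 1.
    rewrite /polar big_ord_recr /= subnn bin0 Pn !mulr1 scale1r.
    rewrite big1 ?add0r ?hornerC // => i _.
    by rewrite ifT // subn_gt0.
  have p1 : (polar n.+2 P 1).[z] = n.+2%:R * z + P`_n.+1.
    rewrite /polar 2!big_ord_recr /= subnn subSnn /= bin0 bin1 Pn mul1r !mulr1.
    rewrite big1 ?add0r ?hornerE //; first by rewrite addrC.
    by move=> i _; rewrite ifT //; have := ltn_ord i; lia.
  have p2 : (polar n.+2 P 2).[z] =
      'C(n.+2, 2)%:R * z ^+ 2 + n.+1%:R * z * P`_n.+1 + P`_n.
    have e2 : (n.+2 - n = 2)%N by lia.
    rewrite /polar 3!big_ord_recr /= subnn subSnn e2 /= bin0 bin1.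
    rewrite Pn mul1r !mulr1 big1 ?add0r ?hornerE //; first by ring.
    by move=> i _; rewrite ifT //; have := ltn_ord i; lia.
  rewrite /G /kap !Ez p0 p1 p2 /= subSS subSS subn0.
  have H2 : 2%:R * 'C(n.+2, 2)%:R = n.+2%:R * n.+1%:R :> k.
    by rewrite -!natrM; congr (_%:R); rewrite bin2 mul2n -[RHS]odd_double_half
      oddM /=; case: (odd n).
  transitivity (n.+2%:R * (2%:R * 'C(n.+2, 2)%:R * z ^+ 2
      + 2%:R * (n.+1%:R * z * P`_n.+1 + P`_n))
    - n.+1%:R * (n.+2%:R * z + P`_n.+1) ^+ 2); first by ring.
  by rewrite H2; ring.
have Gx x : G (xpath x) =
    (n%:R *: (P * P^`()^`()) - n.-1%:R *: P^`() ^+ 2).[x].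
  by rewrite /G; case: (Ex x) => -> -> ->; rewrite !hornerE /=; ring.
have [kap0|kap0] := eqVneq kap 0.
  exists 0, 0; split; last by rewrite eqxx.
  rewrite scaler0; apply: (poly_eq0_nonzero char0) => x _; rewrite -Gx.
  apply: (sa_weight_eq0 HA (N := 0) (i := n.*2 - 4)) => //.
    by move=> t g t0; rewrite mul1r wG.
  by move=> z; rewrite Gz.
have [||z|Q hQ GQ] := @hw_of_invariant k char0 A HA (n.*2 - 4) (fun g => kap^-1 * G g).
- exact: (sa_scale HA).
- by move=> t g t0; rewrite wG //; ring.
- by rewrite Gz mulVf.
exists kap, Q; split=> // ; apply: (poly_eq_nonzero char0) => x _.
case: (hQ) => sQ _ _.
by rewrite -Gx hornerZ -(@hform_x _ (n.*2 - 4) Q) ?sQ // -GQ mulVKf.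
Qed.

End Generation.

(** * Classification of the spherical subalgebras *)

Section Multiplicity.
Variables (k : fieldType) (char0 : [pchar k] =i pred0).
Implicit Types (r s : k) (P Q u v : {poly k}).

Lemma polyXsubC_neq0 r : 'X - r%:P != 0 :> {poly k}.
Proof. by rewrite polyXsubC_eq0. Qed.

Lemma XsubC_exp_eq r i j u v : ~~ root u r -> ~~ root v r ->
  ('X - r%:P) ^+ i * u = ('X - r%:P) ^+ j * v -> i = j.
Proof.
wlog le : i j u v / (i <= j)%N => [H|] Hu Hv E.
  case: (leqP i j) => [le|/ltnW le]; first exact: (H _ _ _ _ le Hu Hv E).
  by rewrite (H _ _ _ _ le Hv Hu (esym E)).
move: E; rewrite -(subnKC le) exprD -mulrA; set d := (j - i)%N.
move/(mulfI (expf_neq0 i (polyXsubC_neq0 r))).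
case: d => [|d] E; first by rewrite addn0.
by move: Hu; rewrite /root E exprS !hornerE subrr !mul0r eqxx.
Qed.

(** The extra factor X - r keeps the exponent at m, so that no truncated m - 1 appears. *)
Lemma XsubC_deriv_mul r m v :
  ('X - r%:P) * (('X - r%:P) ^+ m * v)^`() =
  ('X - r%:P) ^+ m * (m%:R *: v + ('X - r%:P) * v^`()).
Proof.
rewrite derivM deriv_exp derivXsubC mul1r -mulr_natl scaler_nat -mulr_natl.
by case: m => [|m] /=; rewrite ?exprS; ring.
Qed.

(** With L = X - r, L^2 times the Hessian is L^(2m) V, where V(r) = u(r)^2 m (m - n) is nonzero for
    m < n. So the Hessian does not vanish, and comparing exponents of L in the n-th powers gives 2n
    + m(2n - 4) = 2mn, that is, n = 2m. *)
Lemma hessian_multiplicity n m r P u Q (kap : k) :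
  (1 < n)%N -> (0 < m)%N -> (m <= n)%N ->
  P = ('X - r%:P) ^+ m * u -> ~~ root u r ->
  n%:R *: (P * P^`()^`()) - n.-1%:R *: P^`() ^+ 2 = kap *: Q ->
  (kap != 0 -> Q ^+ n = P ^+ (n.*2 - 4)) -> m = n \/ (kap != 0 /\ n = m.*2).
Proof.
move=> n1 m0 mn EP ur EH EQ; have [->|ne] := eqVneq m n; first by left.
right; set L := 'X - r%:P in EP *.
have Lr : L.[r] = 0 by rewrite !hornerE subrr.
pose u1 := m%:R *: u + L * u^`().
pose u2 := m%:R *: u1 + L * u1^`() - u1.
have E1 : L * P^`() = L ^+ m * u1 by rewrite EP XsubC_deriv_mul.
have E2 : L ^+ 2 * P^`()^`() = L ^+ m * u2.
  have := congr1 (fun p => L * p^`()) E1; rewrite XsubC_deriv_mul derivM.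
  rewrite derivXsubC mul1r mulrDr E1 => E.
  by rewrite /u2 mulrBr -E; ring.
pose V := n%:R *: (u * u2) - n.-1%:R *: u1 ^+ 2.
have EV : L ^+ 2 * (kap *: Q) = L ^+ m.*2 * V.
  rewrite -EH mulrBr -!scalerAr.
  have -> : L ^+ 2 * (P * P^`()^`()) = L ^+ m.*2 * (u * u2).
    by rewrite mulrCA E2 EP -addnn exprD; ring.
  have -> : L ^+ 2 * P^`() ^+ 2 = L ^+ m.*2 * u1 ^+ 2.
    by rewrite -exprMn E1 -addnn exprD; ring.
  by rewrite /V [RHS]mulrBr -!scalerAr.
have Vr : V.[r] = u.[r] ^+ 2 * (m%:R * (m%:R - n%:R)).
  rewrite /V /u2 /u1 !(hornerE, hornerZ, horner_exp, Lr) /=.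
  have -> : n%:R = n.-1%:R + 1 :> k by rewrite natr1 prednK // ltnW.
  by ring.
have Vr0 : ~~ root V r.
  rewrite /root Vr !mulf_neq0 ?expf_neq0 ?(natr_neq0 char0) //.
  by rewrite subr_eq0; apply/eqP => /(natr_inj char0)/eqP; rewrite (negPf ne).
have L0 i : L ^+ i != 0 by rewrite expf_neq0 // polyXsubC_eq0.
have kap0 : kap != 0.
  apply: contraNneq Vr0 => kap0; move: EV.
  rewrite kap0 scale0r mulr0 => /esym/eqP.
  by rewrite mulf_eq0 (negPf (L0 _)) => /eqP ->; rewrite root0.
split=> //; have := congr1 (fun p => p ^+ n) EV.
rewrite !exprMn -!exprM exprZn EQ // EP exprMn -exprM.
rewrite -exprD scalerAr mulrA -exprD => H.
suff : (n + n + m * (n.*2 - 4) = m.*2 * n)%N.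
  have [p ->] : exists p, n = p.+2 by exists (n - 2)%N; lia.
  have -> : (p.+2.*2 - 4 = p.*2)%N by lia.
  by rewrite -!muln2; nia.
apply: XsubC_exp_eq H; rewrite /root ?hornerZ ?horner_exp ?mulf_neq0 ?expf_neq0 //.
Qed.

End Multiplicity.

Section Classification.
Variables (k : fieldType) (char0 : [pchar k] =i pred0).
Hypothesis kcl : forall p : {poly k}, size p != 1 -> exists x, root p x.
Implicit Types (g h : SL2 k) (F G : SL2 k -> k) (r s : k) (P Q v : {poly k}).
Variables (A : (SL2 k -> k) -> Prop) (HA : spherical_algebra A).

Lemma monic_XsubC_cofactor m r P v : P \is monic -> P = v * ('X - r%:P) ^+ m ->
  v \is monic /\ size P = (size v + m)%N.
Proof.
move=> mP EP; have mv : v \is monic.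
  by move: mP; rewrite EP monicMr // monic_exp ?monicXsubC.
split=> //; rewrite EP size_Mmonic ?monic_neq0 // ?monic_exp ?monicXsubC //.
by rewrite size_exp_XsubC addnS.
Qed.

Lemma poly_multiplicity P r : P != 0 ->
  exists m v, ~~ root v r /\ P = v * ('X - r%:P) ^+ m.
Proof.
move=> P0; case: (multiplicity_XsubC P r) => m [v]; rewrite P0 /= => vr EP.
by exists m, v.
Qed.

Lemma root_pow n P x : (0 < n)%N -> root (P ^+ n) x = root P x.
Proof. by move=> n_gt0; rewrite /root horner_exp expf_eq0 n_gt0. Qed.

Lemma size1_monic P : P \is monic -> size P = 1%N -> P = 1.
Proof.
move=> mP sP; have /eqP/size_poly1P [c c0 EP] := sP.
by move: mP; rewrite EP monicE lead_coefC => /eqP ->.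
Qed.

(** Every root has multiplicity n or n/2, so there is one root, or there are two of multiplicity
    n/2. In the second case the Hessian is nonzero, and the vector [Q] it gives is kept to bound f
    later. *)
Lemma hw_structure n P : (0 < n)%N -> hw A n P ->
  (exists r, P = ('X - r%:P) ^+ n) \/
  (exists r s m, [/\ r != s, n = m.*2, P = (('X - r%:P) * ('X - s%:P)) ^+ m
    & exists Q, hw A (n.*2 - 4) Q]).
Proof.
move=> n0 hP; have [sP mP AP] := hP; have Pn0 := monic_neq0 mP.
have [n1|n1] := leqP n 1.
  have {n0 n1}en : n = 1%N by lia.
  rewrite en in sP *; left; have : size P != 1 by rewrite sP.
  case/kcl => r; case: (poly_multiplicity r Pn0) => m [v [vr EP]] rP.
  have [mv sv] := monic_XsubC_cofactor mP EP; exists r.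
  have m0 : (0 < m)%N.
    by case: m EP {sv} => // EP; move: vr rP; rewrite EP mulr1 => /negPf ->.
  have sv0 : (0 < size v)%N by rewrite size_poly_gt0 monic_neq0.
  rewrite EP (size1_monic mv); last by move: sv; rewrite sP; lia.
  by rewrite mul1r; congr (_ ^+ _); move: sv; rewrite sP; lia.
have [kap [Q [EH hQ]]] := sa_hessian char0 HA n1 hP.
have EQ : kap != 0 -> Q ^+ n = P ^+ (n.*2 - 4).
  by move=> /hQ hQ'; rewrite (hw_pow_eq char0 HA hP hQ').
have mult r m v : P = v * ('X - r%:P) ^+ m -> root P r -> ~~ root v r ->
    [/\ v \is monic, size v = (n - m).+1, (0 < m)%N
      & m = n \/ (kap != 0 /\ n = m.*2)].
  move=> EP rP vr; have [mv sv] := monic_XsubC_cofactor mP EP.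
  have sv0 : (0 < size v)%N by rewrite size_poly_gt0 monic_neq0.
  have m0 : (0 < m)%N.
    by case: m EP {sv} => // EP; move: vr rP; rewrite EP mulr1 => /negPf ->.
  split=> //; first by move: sv; rewrite sP; lia.
  apply: (hessian_multiplicity char0 n1 m0 _ _ vr EH EQ).
    by move: sv; rewrite sP; lia.
  by rewrite mulrC.
have : size P != 1 by rewrite sP; apply/eqP; lia.
case/kcl => r; case: (poly_multiplicity r Pn0) => m [v [vr EP]] rP.
have [mv sv m0 [emn|[kap0 enm]]] := mult r m v EP rP vr.
  left; exists r; rewrite EP (size1_monic mv) ?mul1r ?emn //.
  by rewrite sv emn subnn.
right; have : size v != 1 by rewrite sv; apply/eqP; lia.
case/kcl => s; case: (poly_multiplicity s (monic_neq0 mv)) => l [w [ws Ev]] rv.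
have nrs : r != s by apply: contraNneq vr => ->.
have EP' : P = (w * ('X - r%:P) ^+ m) * ('X - s%:P) ^+ l by rewrite EP Ev; ring.
have rPs : root P s by rewrite EP rootM rv.
have ws' : ~~ root (w * ('X - r%:P) ^+ m) s.
  rewrite rootM negb_or ws /= /root horner_exp expf_neq0 // !hornerE subr_eq0.
  by rewrite eq_sym.
have [mw' sw' l0 Hl] := mult s l _ EP' rPs ws'.
have [mw sw] := monic_XsubC_cofactor mv Ev.
have sw0 : (0 < size w)%N by rewrite size_poly_gt0 monic_neq0.
have el : l = m.
  case: Hl => [eln|[_ eln]]; move: sw sw0; rewrite sv; clear -m0 enm eln; lia.
exists r, s, m; split=> //; last by exists Q; apply: hQ.
rewrite EP' el (size1_monic mw) ?mul1r ?exprMn //.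
by move: sw sw0; rewrite sv el; clear -m0 enm; lia.
Qed.

(** By [hw_pow_eq] all forms of positive weight have the same roots, so r, or r and s, can be read
    off from any one of them. *)
Lemma hw_classification :
  [\/ forall n P, hw A n P -> n = 0%N,
      exists r, (exists n P, (0 < n)%N /\ hw A n P) /\
        forall n P, hw A n P -> P = ('X - r%:P) ^+ n
    | exists r s, [/\ r != s, (exists n P, (0 < n)%N /\ hw A n P)
      & forall n P, hw A n P -> exists m, [/\ n = m.*2,
          P = (('X - r%:P) * ('X - s%:P)) ^+ m
        & (0 < n)%N -> exists Q, hw A (n.*2 - 4) Q]]].
Proof.
have hw_0 P : hw A 0 P -> P = 1 by case=> sP mP _; apply: size1_monic.
case: (classic (exists n P, (0 < n)%N /\ hw A n P)) => [[n0 [P0 [n0_gt0 hP0]]]|H];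
  last first.
  apply: Or31 => n P hP; case: n hP => // n hP; case: H.
  by exists n.+1, P.
have ex : exists n P, (0 < n)%N /\ hw A n P by exists n0, P0.
have rt n P : (0 < n)%N -> hw A n P -> forall x, root P x -> root P0 x.
  move=> n_gt0 hP x rx; have /(congr1 (fun p => root p x)) := hw_pow_eq char0 HA hP hP0.
  by rewrite !root_pow // rx => <-.
have rp r n x : (0 < n)%N -> root (('X - r%:P) ^+ n) x = (x == r).
  by move=> n_gt0; rewrite root_pow // root_XsubC.
have rp2 r s n x : (0 < n)%N -> root ((('X - r%:P) * ('X - s%:P)) ^+ n) x
    = (x == r) || (x == s).
  by move=> n_gt0; rewrite root_pow // rootM !root_XsubC.
have rt' n P : (0 < n)%N -> hw A n P -> forall x, root P0 x -> root P x.
  move=> n_gt0 hP x rx; have /(congr1 (fun p => root p x)) := hw_pow_eq char0 HA hP hP0.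
  by rewrite !root_pow // rx => ->.
have [[r EP0]|[r [s [m0 [nrs em0 EP0 _]]]]] := hw_structure n0_gt0 hP0.
  apply: Or32; exists r; split=> // n P hP.
  have [n_eq0|n_gt0] := posnP n.
    by rewrite n_eq0 expr0; apply: hw_0; rewrite -n_eq0.
  have := rt n P n_gt0 hP; rewrite EP0.
  case: (hw_structure n_gt0 hP) => [[r' ->]|[r' [s' [m [ne em -> _]]]]] H.
    have /eqP -> // : r' == r by rewrite -(rp r n0) // H // rp.
  have m_gt0 : (0 < m)%N by lia.
  have := H r'; have := H s'; rewrite !rp2 ?rp // !eqxx orbT /=.
  by move=> /(_ isT)/eqP es /(_ isT)/eqP er; rewrite es er eqxx in ne.
apply: Or33; exists r, s; split=> // n P hP.
have [n_eq0|n_gt0] := posnP n.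
  exists 0%N; rewrite n_eq0; split=> //.
  by rewrite expr0; apply: hw_0; rewrite -n_eq0.
have m0_gt0 : (0 < m0)%N by lia.
have := rt' n P n_gt0 hP; have := rt n P n_gt0 hP; rewrite EP0.
case: (hw_structure n_gt0 hP) => [[r' ->]|[r' [s' [m [ne em -> exQ]]]]] H H'.
  have := H' r; have := H' s; rewrite !rp2 ?rp // !eqxx orbT /=.
  by move=> /(_ isT)/eqP es /(_ isT)/eqP er; rewrite es er eqxx in nrs.
have m_gt0 : (0 < m)%N by lia.
exists m; split=> //.
have := H r'; have := H s'; rewrite !rp2 // !eqxx orbT /=.
move=> /(_ isT)/orP es /(_ isT)/orP er; congr (_ ^+ _).
case: er es ne => /eqP -> [] /eqP ->; rewrite ?eqxx // => _.
by rewrite mulrC.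
Qed.

End Classification.

(** * Normality, and the reduction to powers of b or of ab *)

Section Normal.
Variables (k : fieldType) (char0 : [pchar k] =i pred0).
Hypothesis kcl : forall p : {poly k}, size p != 1 -> exists x, root p x.
Implicit Types (g h : SL2 k) (F G : SL2 k -> k) (r s : k) (P Q v : {poly k}).

Definition normal_algebra (A : (SL2 k -> k) -> Prop) : Prop :=
  forall (p q : SL2 k -> k) (m : nat) (c : 'I_m -> SL2 k -> k),
    A p -> A q -> (forall i, A (c i)) -> (exists x, q x != 0) ->
    (forall x, p x ^+ m + \sum_(i < m) c i x * p x ^+ i * q x ^+ (m - i) = 0) ->
    exists2 r, A r & forall x, p x = r x * q x.

(** The effect on the pulled-back algebra of moving the base point from x to y x. *)
Definition right_translate (A : (SL2 k -> k) -> Prop) (y : SL2 k) F : Prop :=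
  A (fun g => F (g * y^-1)%g).

(** The last clause says that [A] lies in the linear span of the left translates of the powers of
    q^f. The function [q] itself lies in [A] only when f = 1. *)
Definition monomial_algebra (A : (SL2 k -> k) -> Prop) (q : SL2 k -> k) f : Prop :=
  [/\ (0 < f)%N, forall i, A (fun g => q g ^+ i) <-> (f %| i)%N
    & forall R, linear_space R -> left_translatable R ->
        (forall i, R (fun g => q g ^+ (f * i))) -> forall F, A F -> R F].

(** Euclidean division by the least positive element of [M]. *)
Lemma sub_closed_multiples (M : nat -> Prop) n0 : (0 < n0)%N -> M n0 ->
  (forall i j, M i -> M j -> M (i + j)%N) ->
  (forall i j, (j <= i)%N -> M i -> M j -> M (i - j)%N) ->
  exists2 f, (0 < f)%N & forall i, M i <-> (f %| i)%N.
Proof.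
move=> n0_gt0 Mn0 Madd Msub.
have [f [f_gt0 Mf fmin]] : exists f, [/\ (0 < f)%N, M f
    & forall i, (0 < i)%N -> M i -> (f <= i)%N].
  have [n le] : exists n, (n0 <= n)%N by exists n0.
  elim: n => [|n IH] in n0 n0_gt0 Mn0 le *; first by lia.
  case: (classic (exists i, [/\ (0 < i)%N, (i < n0)%N & M i])).
    by case=> i [i_gt0 lt Mi]; apply: (IH i) => //; lia.
  move=> H; exists n0; split=> // i i_gt0 Mi; rewrite leqNgt; apply/negP => lt.
  by case: H; exists i.
have Mmul j : M (f * j)%N.
  elim: j => [|j IH]; last by rewrite mulnS; apply: Madd.
  by rewrite muln0 -(subnn n0); apply: Msub.
exists f => // i; split=> [Mi|/dvdnP [j ->]]; last by rewrite mulnC.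
rewrite /dvdn; case: posnP => // gt.
have : (f <= i %% f)%N.
  apply: fmin => //; have -> : (i %% f = i - f * (i %/ f))%N.
    by rewrite {2}(divn_eq i f) mulnC addKn.
  by apply: Msub => //; rewrite mulnC leq_divM.
by rewrite leqNgt ltn_mod f_gt0.
Qed.

Variables (A : (SL2 k -> k) -> Prop) (HA : spherical_algebra A).
Hypothesis (nA : normal_algebra A).

(* [q ^ i / q ^ j] is integral over [A]: its [i]-th power is [(q ^ i) ^ (i - j)]. *)
Lemma normal_power_sub q g0 i j : SL2_coord q -> q g0 != 0 -> (j <= i)%N ->
  A (fun g => q g ^+ i) -> A (fun g => q g ^+ j) -> A (fun g => q g ^+ (i - j)).
Proof.
move=> cq q0 le Ai Aj.
have [/eqP i0|i_gt0] := posnP i.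
  by move: Ai; have -> : (i - j = i)%N by lia.
have Aij : A (fun g => (-1) * (q g ^+ i) ^+ (i - j)).
  by apply: (sa_scale HA); apply: (sa_expr HA).
have [||g|r Ar Er] := @nA (fun g => q g ^+ i) (fun g => q g ^+ j) i
  (fun (l : 'I_i) g => if l == 0%N :> nat then -1 * (q g ^+ i) ^+ (i - j) else 0)
  Ai Aj.
- by move=> l; case: eqP => // _; apply: (sa_const HA).
- by exists g0; rewrite expf_neq0.
- case: i i_gt0 le {Ai Aij} => // i _ le.
  rewrite big_ord_recl /= big1; last by move=> l _; rewrite !mul0r.
  rewrite addr0 expr0 mulr1 subn0 mulN1r mulNr -!exprM -exprD.
  by rewrite (_ : (i.+1 * (i.+1 - j) + j * i.+1 = i.+1 * i.+1)%N) ?subrr //;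
     nia.
apply: (sa_ext HA _ Ar).
(* r q^j = q^i = q^(i - j) q^j, and q^j cancels because k[SL_2] is a domain. *)
have q0j : (fun g => q g ^+ j) g0 != 0 by rewrite expf_neq0.
apply: (SL2_coord_cancel char0 (sa_coord HA Ar) _ (sa_coord HA Aj) q0j).
  exact: SL2_coordX.
by move=> g; rewrite -Er -exprD subnK.
Qed.

Lemma normal_power_multiples q g0 n : SL2_coord q -> q g0 != 0 ->
  (0 < n)%N -> A (fun g => q g ^+ n) ->
  exists2 f, (0 < f)%N & forall i, A (fun g => q g ^+ i) <-> (f %| i)%N.
Proof.
move=> cq q0 n_gt0 An.
apply: (sub_closed_multiples n_gt0 An) => [i j Ai Aj|i j le Ai Aj].
  by apply: (sa_ext HA _ (sa_mul HA Ai Aj)) => g; rewrite exprD.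
exact: normal_power_sub q0 le Ai Aj.
Qed.

Lemma hform_exp d (T : {poly k}) m g : (size T <= d.+1)%N ->
  hform (d * m) (T ^+ m) g = hform d T g ^+ m.
Proof.
move=> sT; elim: m => [|m IH].
  by rewrite muln0 expr0 /hform big_ord_recr big_ord0 coef1 /= !mulr1 add0r.
rewrite mulnS !exprS hform_mul // ?IH //.
elim: m {IH} => [|m IH]; first by rewrite muln0 size_poly1.
rewrite exprS; apply: leq_trans (size_polyMleq _ _) _.
by case: (size T) sT => [|t] sT; move: IH; rewrite mulnS; lia.
Qed.

Lemma monomial_of_hw d (T : {poly k}) n0 P0 : (0 < d)%N -> size T = d.+1 -> T \is monic ->
  (0 < n0)%N -> hw A n0 P0 ->
  (forall n P, hw A n P -> exists2 m, n = (d * m)%N & P = T ^+ m) ->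
  exists f, monomial_algebra A (hform d T) f.
Proof.
move=> d_gt0 sT mT n0_gt0 hP0 H.
have hT P m g : P = T ^+ m -> hform (d * m) P g = hform d T g ^+ m.
  by move=> ->; rewrite hform_exp ?sT.
have [m0 em0 Em0] := H _ _ hP0.
have T1 : hform d T (ulo 0) != 0.
  rewrite hform_ulo; have := monicP mT; rewrite /lead_coef sT => ->.
  exact: oner_neq0.
have cq : SL2_coord (hform d T).
  apply: linear_space_sum; first split.
  - exact: SL2_coord_ext.
  - exact: SL2_coordD.
  - by move=> c F HF; apply: SL2_coordM => //; apply: SL2_coord_const.
  - exact: SL2_coord_const.
  - move=> i; apply: SL2_coordM; apply: SL2_coordX; first exact: SL2_coord_a.
    exact: SL2_coord_b.
have [||f f_gt0 Hf] := @normal_power_multiples (hform d T) (ulo 0) m0 cq T1.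
- by lia.
- case: hP0 => _ _; rewrite em0 => AP; apply: (sa_ext HA _ AP) => g.
  exact: hT.
exists f; split=> // R linR leftR RT F; case: (linR) => Re _ _.
apply: (sa_generated char0 HA) => // n P hP.
have [m en EP] := H _ _ hP; have : (f %| m)%N.
  apply/Hf; case: hP => _ _; rewrite en => AP; apply: (sa_ext HA _ AP) => g.
  exact: hT.
case/dvdnP => j Ej; apply: (Re _ _ _ (RT j)) => g.
by rewrite en hT // Ej mulnC.
Qed.

Lemma monomial_translate q q' z c f : c != 0 ->
  (forall g, q' (g * z)%g = c * q g) ->
  monomial_algebra A q f -> monomial_algebra (right_translate A z^-1%g) q' f.
Proof.
move=> c0 E [f_gt0 Hf HR]; split=> // [i|R linR leftR RT F].
  rewrite -Hf /right_translate invgK; split=> Ai.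
    apply: (sa_ext HA _ (sa_scale HA (c ^- i) Ai)) => g.
    by rewrite E exprMn mulKf // expf_neq0.
  apply: (sa_ext HA _ (sa_scale HA (c ^+ i) Ai)) => g.
  by rewrite E exprMn.
case: (linR) => Re Ra Rz.
rewrite /right_translate invgK => AF.
(* Generation of [A] is applied to a right translate of [R], which is again left-translatable
   because left and right translations commute. *)
have : R (fun g => F (g * z^-1 * z)%g).
  apply: (HR (fun F => R (fun g => F (g * z^-1)%g)) _ _ _ _ AF).
  - split=> [F' G' EF|F' G'|a F'].
    + by apply: Re => g; apply: EF.
    + exact: Ra.
    + exact: Rz.
  - by move=> h F' RF'; apply: (Re _ _ _ (leftR h _ RF')) => g; rewrite mulgA.
  - move=> i; apply: (Re _ _ _ (Rz (c ^- (f * i)) _ (RT i))) => g /=.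
    have -> : q' g = c * q (g * z^-1)%g by rewrite -E mulgVK.
    by rewrite exprMn mulKf // expf_neq0.
by apply: Re => g; rewrite mulgVK.
Qed.

Lemma sa_classification :
  [\/ forall F, A F -> exists c, forall g, F g = c,
      exists y f, monomial_algebra (right_translate A y) (@mx_b k) f
    | exists y f, (f = 1%N \/ f = 2%N) /\
        monomial_algebra (right_translate A y) (fun g => mx_a g * mx_b g) f].
Proof.
have det_z a b c d : a * d - b * c = 1 -> exists z : SL2 k,
    forall g, mx_a (g * z)%g = mx_a g * a + mx_b g * c /\
              mx_b (g * z)%g = mx_a g * b + mx_b g * d.
  by move=> H; exists (sl2 a b c d) => g; rewrite !mx_M; case: (sl2E H) => -> -> -> ->.
case: (hw_classification char0 kcl HA) => [H|[r [[n0 [P0 [n0_gt0 hP0]]] H]]|].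
- apply: Or31 => F AF.
  apply: (sa_generated char0 HA (R := fun F => exists c, forall g, F g = c)
    _ _ _ AF).
  + split=> [F' G E [c Hc]|F' G [c Hc] [c' Hc']|a F' [c Hc]].
    * by exists c => g; rewrite -E.
    * by exists (c + c') => g; rewrite Hc Hc'.
    * by exists (a * c) => g; rewrite Hc.
  + by move=> h F' [c Hc]; exists c => g.
  + move=> n P hP; rewrite (H _ _ hP); exists P`_0 => g.
    by rewrite /hform big_ord_recr big_ord0 /= add0r !mulr1.
- apply: Or32.
  have [||||f Hf] := @monomial_of_hw 1 ('X - r%:P) n0 P0 _ _ _ n0_gt0 hP0 _ => //.
  + by rewrite size_XsubC.
  + exact: monicXsubC.
  + by move=> n P /H; exists n; rewrite ?mul1n.
  (* Right translation by this z turns b into a - r b. *)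
  have [|z Hz] := @det_z 0 1 (-1) (-r); first by ring.
  exists z^-1%g, f; apply: monomial_translate (oner_neq0 _) _ Hf => g.
  case: (Hz g) => _ ->; rewrite /hform 2!big_ord_recr big_ord0 /=.
  by rewrite !coefB !coefX !coefC /= !expr1 !expr0; ring.
case=> r [s [nrs [n0 [P0 [n0_gt0 hP0]]] H]]; apply: Or33.
pose T : {poly k} := ('X - r%:P) * ('X - s%:P).
have sT : size T = 3%N.
  by rewrite size_Mmonic ?monic_neq0 ?monicXsubC // !size_XsubC.
have mT : T \is monic by rewrite monicMr monicXsubC.
have [||f Hf] := @monomial_of_hw 2 T n0 P0 _ sT mT n0_gt0 hP0 _ => //.
  by move=> n P /H [m [-> -> _]]; exists m; rewrite ?mul2n.
have ET : T = 'X^2 - (r + s) *: 'X + (r * s)%:P.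
  by rewrite /T polyCM -mul_polyC polyCD; ring.
have rs0 : r - s != 0 by rewrite subr_eq0.
(* Right translation by this z turns ab into (a - r b)(a - s b) / (r - s); the division makes the
   determinant 1. *)
have [|z Hz] := @det_z (r - s)^-1 1 (- r / (r - s)) (- s); first by field.
exists z^-1%g, f; split; last first.
  apply: (@monomial_translate _ _ _ (r - s)^-1 _ _ _ Hf); first by rewrite invr_eq0.
  move=> g; case: (Hz g) => -> ->; rewrite /hform 3!big_ord_recr big_ord0 /=.
  rewrite ET !coefD !coefN !coefZ !coefXn !coefX !coefC /= !expr1 !expr0.
  by field.
have [f_gt0 Hi _] := Hf.
(* The Hessian of q^f gives a vector of weight 4f - 4, that is, the power 2(f - 1) of q. So f
   divides 2(f - 1), hence 2. *)
have hf : hw A (2 * f) (T ^+ f).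
  split.
  - have := size_exp T f; rewrite sT /= => <-.
    by rewrite prednK // size_poly_gt0 monic_neq0 // monic_exp.
  - exact: monic_exp.
  - apply: (sa_ext HA _ ((Hi f).2 (dvdnn f))) => g.
    by rewrite hform_exp ?sT.
have [m [em _ exQ]] := H _ _ hf; have [|Q hQ] := exQ; first by lia.
have [m' [em' EQ _]] := H _ _ hQ.
have : (f %| m')%N.
  apply/Hi; case: hQ => _ _ AQ; apply: (sa_ext HA _ AQ) => g.
  by rewrite em' EQ -mul2n hform_exp ?sT.
have -> : (m' = 2 * (f - 1))%N by move: em'; rewrite -!muln2; lia.
move=> dv; have : (f %| 2)%N.
  rewrite -(dvdn_addl _ dv) (_ : (2 + 2 * (f - 1) = f * 2)%N) ?dvdn_mulr //.
  by clear -f_gt0; lia.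
move/(@dvdn_leq f 2 isT); clear -f_gt0.
by case: f f_gt0 => [|[|[|f]]] // _ _; [left|right].
Qed.

End Normal.

(** * Isomorphisms of spaces *)

Lemma sig_inj (T : Type) (P : T -> Prop) (u v : {x | P x}) :
  sval u = sval v -> u = v.
Proof.
by case: u v => x Px [y Py] /= E; subst y; congr exist; apply: proof_irrelevance.
Qed.

Section Cosets.
Variables (k : fieldType) (H : SL2 k -> Prop).
Implicit Types g h : SL2 k.

Definition subgroup : Prop := H 1%g /\ forall g h, H g -> H h -> H (g^-1 * h)%g.

Lemma coset_proj_eqP g h : subgroup ->
  coset_proj H g = coset_proj H h <-> H (g^-1 * h)%g.
Proof.
case=> H1 HV; split=> [/(congr1 (fun C => sval C h)) /= E|Hgh].
  have : coset_of H h h by exists 1%g; rewrite ?mulg1.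
  by rewrite -E => -[t Ht Et]; rewrite [X in (_ * X)%g]Et mulKg.
have Hinv a : H a -> H a^-1%g by move=> Ha; rewrite -[X in H X]mulg1; apply: HV.
have HM a b : H a -> H b -> H (a * b)%g.
  by move=> /Hinv Ha Hb; rewrite -[a]invgK; apply: HV.
apply: sig_inj => /=; apply: functional_extensionality => z.
apply: propositional_extensionality; split=> -[t Ht ->].
  exists ((g^-1 * h)^-1 * t)%g; first exact: HV.
  by rewrite invgM invgK !mulgA mulgV mul1g.
by exists (g^-1 * h * t)%g; [apply: HM|rewrite !mulgA mulgV mul1g].
Qed.

Lemma coset_act_proj g h : coset_act g (coset_proj H h) = coset_proj H (g * h)%g.
Proof.
apply: sig_inj => /=; apply: functional_extensionality => z.
apply: propositional_extensionality; split=> -[t Ht E]; exists t => //.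
  by rewrite -mulgA -E mulVKg.
by rewrite E -mulgA mulKg.
Qed.

Lemma coset_rep (C : cosets H) : exists g, C = coset_proj H g.
Proof. by case: C => C [g EC]; exists g; apply: sig_inj. Qed.

Lemma coset_act_fixed g h : subgroup ->
  coset_act g (coset_proj H h) = coset_proj H h <-> H (h^-1 * g * h)%g.
Proof.
move=> sH; rewrite coset_act_proj; split=> [/esym|E]; last apply/esym;
  by rewrite coset_proj_eqP // ?mulgA // => E'; rewrite mulgA.
Qed.

End Cosets.

Section ZariskiOpen.
Variables (k : fieldType) (X : affine_SL2 k).
Hypothesis coordM : forall f h : X -> k, coord f -> coord h ->
  coord (fun x => f x * h x).

Lemma zariski_open_distinguished (h : X -> k) : coord h ->
  zariski_open (fun x => h x != 0).
Proof.
move=> ch; exists (fun f => f = h); split=> [f ->//|x].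
by split=> [hx|[f [->]]//]; exists h.
Qed.

Lemma zariski_open_and (U : X -> Prop) (h : X -> k) : zariski_open U ->
  coord h -> zariski_open (fun x => U x /\ h x != 0).
Proof.
case=> S [cS HS] ch.
exists (fun f => exists2 f', S f' & f = (fun x => f' x * h x)); split.
  by move=> f [f' Sf' ->]; apply: coordM => //; apply: cS.
move=> x; split.
  case=> /HS [f [Sf fx]] hx; exists (fun x => f x * h x).
  by split; [exists f|rewrite mulf_neq0].
case=> _ [[f Sf ->]]; rewrite mulf_eq0 negb_or => /andP [fx hx].
by split=> //; apply/HS; exists f.
Qed.

End ZariskiOpen.

Lemma zariski_open_comp (k : fieldType) (X Y : affine_SL2 k) (phi : X -> Y) U :
  (forall f, coord f -> coord (fun x => f (phi x))) -> zariski_open U ->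
  zariski_open (fun x => U (phi x)).
Proof.
move=> Hphi [S [cS HS]].
exists (fun f => exists2 f', S f' & f = (fun x => f' (phi x))); split.
  by move=> f [f' Sf' ->]; apply/Hphi/cS.
move=> x; rewrite HS; split=> [[f [Sf fx]]|[_ [[f Sf ->]] fx]].
  by exists (fun x => f (phi x)); split=> //; exists f.
by exists f.
Qed.

Lemma regular_on_comp (k : fieldType) (X Y : affine_SL2 k) (phi : X -> Y) U f :
  (forall f, coord f -> coord (fun x => f (phi x))) ->
  regular_on U f -> regular_on (fun x => U (phi x)) (fun x => f (phi x)).
Proof.
move=> Hphi Hf x Ux; have [V [p [q [oV Vx VU [cp cq] E]]]] := Hf _ Ux.
exists (fun x => V (phi x)), (fun x => p (phi x)), (fun x => q (phi x)); split.
- exact: zariski_open_comp.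
- by [].
- by move=> y /VU.
- by split; apply: Hphi.
- by move=> y /E.
Qed.

Lemma zariski_open_ext (k : fieldType) (X : affine_SL2 k) (U V : X -> Prop) :
  (forall x, U x <-> V x) -> zariski_open U -> zariski_open V.
Proof. by move=> E [S [cS HS]]; exists S; split=> // x; rewrite -E. Qed.

Lemma regular_on_ext (k : fieldType) (X : affine_SL2 k) (U V : X -> Prop) f h :
  (forall x, U x <-> V x) -> f =1 h -> regular_on U f -> regular_on V h.
Proof.
move=> EU Ef Hf x /EU /Hf [W [p [q [oW Wx WU cpq E]]]]; exists W, p, q; split=> //.
  by move=> y /WU /EU.
by move=> y /E [? <-]; rewrite Ef.
Qed.

Lemma affine_isomorphic (k : fieldType) (X Y : affine_SL2 k)
    (phi : X -> Y) (psi : Y -> X) :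
  cancel phi psi -> cancel psi phi ->
  (forall g x, phi (aact g x) = aact g (phi x)) ->
  (forall f, coord f -> coord (fun x => f (phi x))) ->
  (forall f, coord f -> coord (fun y => f (psi y))) ->
  SL2_isomorphic (space_of X) (space_of Y).
Proof.
move=> phiK psiK Hact Hphi Hpsi; exists phi, psi; split=> //.
  move=> U; split=> /= oU; first exact: zariski_open_comp.
  apply: zariski_open_ext (zariski_open_comp Hpsi oU) => y.
  by rewrite psiK.
move=> U f oU; split=> /= Hf; first exact: regular_on_comp.
apply: regular_on_ext (regular_on_comp Hpsi Hf) => y; by rewrite psiK.
Qed.

(** * From the variety to the algebra of an orbit map, and back *)

Section SphericalVariety.
Variables (k : fieldType) (char0 : [pchar k] =i pred0).
Variables (X : affine_SL2 k) (hX : affine_spherical X).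
Implicit Types (f : X -> k) (g h : SL2 k) (x y : X) (F : SL2 k -> k).

Let Xvar := let: And4 H _ _ _ := hX in H.
Let Xact := let: And4 _ H _ _ := hX in H.
Let Xnor := let: And4 _ _ H _ := hX in H.
Let Xemb := proj1 Xvar.

Lemma coord_ext f f' : f =1 f' -> coord f -> coord f'.
Proof.
case: Xemb => n [s [I [_ _ Hc]]] E /Hc [p Hp]; apply/Hc.
by exists p => x; rewrite -E.
Qed.

Lemma coord_const (c : k) : coord (fun _ : X => c).
Proof.
by case: Xemb => n [s [I [_ _ Hc]]]; apply/Hc; exists c%:MP => x; rewrite mevalC.
Qed.

Lemma coord_add f f' : coord f -> coord f' -> coord (fun x => f x + f' x).
Proof.
case: Xemb => n [s [I [_ _ Hc]]] /Hc [p Hp] /Hc [q Hq]; apply/Hc.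
by exists (p + q) => x; rewrite mevalD Hp Hq.
Qed.

Lemma coord_mul f f' : coord f -> coord f' -> coord (fun x => f x * f' x).
Proof.
case: Xemb => n [s [I [_ _ Hc]]] /Hc [p Hp] /Hc [q Hq]; apply/Hc.
by exists (p * q) => x; rewrite mevalM Hp Hq.
Qed.

Lemma coord_scale (c : k) f : coord f -> coord (fun x => c * f x).
Proof. by move=> cf; apply: coord_mul => //; apply: coord_const. Qed.

Lemma coord_linear : linear_space (@coord k X).
Proof. by split; [apply: coord_ext|apply: coord_add|apply: coord_scale]. Qed.

Lemma coord_sep x y : (forall f, coord f -> f x = f y) -> x = y.
Proof.
case: Xemb => n [s [I [sinj _ Hc]]] H; apply: sinj => i.
by apply: (H (fun x => s x i)); apply/Hc; exists 'X_i => z; rewrite mevalXU.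
Qed.

(** The values of [phi] on the ambient coordinates satisfy all equations in [I], so they are the
    coordinates of a point. Additivity and multiplicativity are asked on regular functions only, so
    that a homomorphism may be extended by a default value. *)
Lemma coord_hom (phi : (X -> k) -> k) :
  (forall f f', coord f -> f =1 f' -> phi f = phi f') ->
  (forall c, phi (fun=> c) = c) ->
  (forall f f', coord f -> coord f' -> phi (fun x => f x + f' x) = phi f + phi f') ->
  (forall f f', coord f -> coord f' -> phi (fun x => f x * f' x) = phi f * phi f') ->
  exists x, forall f, coord f -> f x = phi f.
Proof.
move=> He Hk Ha Hm; case: Xemb => n [s [I [_ Hz Hc]]].
have cp (p : {mpoly k[n]}) : coord (fun x => p.@[s x]) by apply/Hc; exists p.
pose v i := phi (fun x => s x i).
have ev (p : {mpoly k[n]}) : phi (fun x => p.@[s x]) = p.@[v].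
  elim/mpolyind: p => [|c m p _ _ IH].
    by rewrite meval0 -[RHS]Hk; apply: He => // x; rewrite meval0.
  rewrite mevalD -IH mevalZ.
  have -> : phi (fun x => (c *: 'X_[m] + p).@[s x]) =
      phi (fun x => c * ('X_[m] : {mpoly k[n]}).@[s x]) + phi (fun x => p.@[s x]).
    rewrite -Ha //; last by apply: coord_scale.
    by apply: He => // x; rewrite mevalD mevalZ.
  rewrite Hm ?Hk //; last exact: coord_const.
  congr (_ * _ + _); rewrite mevalX.
  have csi i : coord (fun x => s x i).
    by apply: coord_ext (cp 'X_i) => x; rewrite mevalXU.
  have cX i e : coord (fun x => s x i ^+ e).
    by apply: coord_ext (cp ('X_i ^+ e)) => x; rewrite rmorphXn /= mevalXU.
  have phiX i e : phi (fun x => s x i ^+ e) = v i ^+ e.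
    elim: e => [|e IHe]; first exact: (Hk 1).
    by rewrite exprS -IHe -Hm //; apply: He => // x; rewrite exprS.
  transitivity (phi (fun x => \prod_(i < n) s x i ^+ m i)).
    by apply: He => // x; rewrite mevalX.
  suff: forall r : seq 'I_n, coord (fun x => \prod_(i <- r) s x i ^+ m i) /\
      phi (fun x => \prod_(i <- r) s x i ^+ m i) = \prod_(i <- r) v i ^+ m i.
    by move=> /(_ (index_enum _)) [].
  elim=> [|i r [c1 IHr]].
    split; first by apply: coord_ext (coord_const 1) => x; rewrite big_nil.
    rewrite big_nil -[RHS]Hk; apply/esym/He => [|x]; first exact: coord_const.
    by rewrite big_nil.
  have c2 := coord_mul (cX i (m i)) c1.
  split; first by apply: coord_ext c2 => x; rewrite big_cons.
  rewrite big_cons -phiX -IHr -Hm //; apply/esym/He => // x.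
  by rewrite big_cons.
have /Hz [x Hx] : forall p, I p -> p.@[v] = 0.
  move=> p Ip; rewrite -ev -[RHS]Hk; apply: He => // x.
  by apply: (Hz (s x)).1 => //; exists x.
exists x => f /Hc [p Hp]; rewrite Hp (meval_eq _ Hx) -ev; apply: He => // y.
Qed.

Lemma act1 x : aact 1%g x = x.
Proof. by case: Xact. Qed.

Lemma actM g h x : aact (g * h)%g x = aact g (aact h x).
Proof. by case: Xact. Qed.

Lemma coord_act f : coord f -> exists m (p : 'I_m -> SL2 k -> k) (q : 'I_m -> X -> k),
  [/\ forall i, SL2_coord (p i), forall i, coord (q i)
    & forall g x, f (aact g x) = \sum_(i < m) p i g * q i x].
Proof. by case: Xact => _ _; apply. Qed.

Lemma coord_act_fixed f g : coord f -> coord (fun x => f (aact g x)).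
Proof.
case/coord_act => m [p [q [_ cq E]]].
apply: (coord_ext (f := fun x => \sum_(i < m) p i g * q i x)) => //.
by apply: linear_space_sum => //; [apply: coord_linear|apply: coord_const].
Qed.

Definition pull x F : Prop := exists2 f, coord f & forall g, F g = f (aact g x).

Lemma pull_coord x F : pull x F -> SL2_coord F.
Proof.
case=> f /coord_act [m [p [q [cp _ E]]]] EF.
apply: (SL2_coord_ext (F := fun g => \sum_(i < m) q i x * p i g)).
  by move=> g; rewrite EF E; apply: eq_bigr => i _; rewrite mulrC.
apply: linear_space_sum => //; last exact: SL2_coord_const.
split; first exact: SL2_coord_ext.
  exact: SL2_coordD.
by move=> c G HG; apply: SL2_coordM => //; apply: SL2_coord_const.
Qed.

Lemma pull_linear x : linear_space (pull x).
Proof.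
split=> [F G E [f cf Ef]|F G [f cf Ef] [f' cf' Ef']|c F [f cf Ef]].
- by exists f => // g; rewrite -E.
- by exists (fun y => f y + f' y); [apply: coord_add|move=> g; rewrite Ef Ef'].
- by exists (fun y => c * f y); [apply: coord_scale|move=> g; rewrite Ef].
Qed.

Lemma pull_mul x F G : pull x F -> pull x G -> pull x (fun g => F g * G g).
Proof.
move=> [f cf Ef] [f' cf' Ef'].
by exists (fun y => f y * f' y); [apply: coord_mul|move=> g; rewrite Ef Ef'].
Qed.

Lemma pull_const x c : pull x (fun=> c).
Proof. by exists (fun=> c) => //; apply: coord_const. Qed.

Lemma pull_left x : left_translatable (pull x).
Proof.
move=> h F [f cf Ef]; exists (fun y => f (aact h y)).
  exact: coord_act_fixed.
by move=> g; rewrite Ef actM.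
Qed.

Lemma pull_act x (y : SL2 k) F : pull (aact y x) F <-> right_translate (pull x) y F.
Proof.
split=> [] [f cf Ef]; exists f => // g.
  by rewrite Ef -actM mulgVK.
by rewrite -actM -Ef mulgK.
Qed.

(** Density of the orbit, stated as injectivity of the pullback to SL_2. *)
Definition generic x := forall f, coord f -> (forall g, f (aact g x) = 0) ->
  forall y, f y = 0.

Lemma generic_act x (y : SL2 k) : generic x -> generic (aact y x).
Proof.
move=> gx f cf H; apply: gx => // g.
by rewrite -(H (g * y^-1)%g) -actM mulgVK.
Qed.

Lemma generic_eq x f f' : generic x -> coord f -> coord f' ->
  (forall g, f (aact g x) = f' (aact g x)) -> f =1 f'.
Proof.
move=> gx cf cf' E y; apply/eqP; rewrite -subr_eq0 -mulN1r; apply/eqP.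
apply: (gx (fun y => f y + (-1) * f' y)).
  by apply: coord_add => //; apply: coord_scale.
by move=> g; rewrite E mulN1r subrr.
Qed.

Lemma exists_spherical_point : exists x, [/\ generic x, spherical_algebra (pull x)
  & normal_algebra (pull x)].
Proof.
case: hX => _ _ _ [x Hx].
have inj f : coord f -> (forall b, lower_borel b -> f (aact b x) = 0) ->
    forall y, f y = 0.
  move=> cf Hf y; apply/eqP; apply: contraT => fy.
  have [|b [Hb]] := Hx _ (zariski_open_distinguished cf); first by exists y.
  by rewrite Hf // eqxx.
have gx : generic x by move=> f cf H; apply: inj.
exists x; split=> //; first split.
- exact: pull_linear.
- exact: pull_const.
- exact: pull_mul.
- move=> F [f /coord_act [m [p [q [cp cq E]]]] Ef].
  exists m, p, (fun i g => q i (aact g x)); split=> // [i|h g].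
    by exists (q i).
  by rewrite Ef actM E.
- by move=> F [f cf Ef] H g; rewrite Ef; apply: inj => // b Hb; rewrite -Ef H.
move=> p q m c [p' cp Ep] [q' cq Eq] Hc [g0 q0] E.
have /fin_all_exists2 [c' cc Ec] := Hc.
have [|y|r cr Er] := Xnor cp cq cc.
- by exists (aact g0 x); rewrite -Eq.
(* The integral equation is known along the orbit only. Its left side is a regular function on [X],
   so density extends it to all of [X], where normality applies. *)
- move: y; apply: gx.
    apply: coord_add.
      move: {Ep E} p' cp => p' cp; elim: m {c Hc c' cc Ec} => [|m IH].
        exact: (coord_const 1).
      by apply: coord_ext (coord_mul cp IH) => y; rewrite exprS.
    have cX f n : coord f -> coord (fun y => f y ^+ n).
      move=> cf; elim: n => [|n IH]; first exact: (coord_const 1).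
      by apply: coord_ext (coord_mul cf IH) => y; rewrite exprS.
    apply: (coord_ext (f := fun y => \sum_(i < m) 1 * (c' i y * p' y ^+ i * q' y ^+ (m - i)))).
      by move=> y; apply: eq_bigr => i _; rewrite mul1r.
    apply: linear_space_sum; [exact: coord_linear|exact: coord_const|move=> i].
    by apply: coord_mul; [apply: coord_mul|]; try apply: cX.
  move=> g; rewrite -Ep -Eq -[RHS](E g); congr (_ + _); apply: eq_bigr => i _.
  by rewrite Ec.
exists (fun g => r (aact g x)); first by exists r.
by move=> g; rewrite Ep Eq Er.
Qed.

Section Stabilizer.
Variables (x1 : X) (H : SL2 k -> Prop).
Hypothesis transitive : forall x, exists g, x = aact g x1.
Hypothesis stabilizer : forall g, aact g x1 = x1 <-> H g.
(* Regular right-invariant fractions are locally fractions of elements of the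
   coordinate ring. *)
Hypothesis invariant_fractions : forall (p q : SL2 k -> k) (y : SL2 k),
  SL2_coord p -> SL2_coord q -> q y != 0 ->
  exists p' q' : SL2 k -> k, [/\ pull x1 p', pull x1 q', q' y != 0
    & forall (W : SL2 k -> Prop) F,
        (forall g t, H t -> W g -> W (g * t)%g) ->
        (forall g t, H t -> W g -> F (g * t)%g = F g) ->
        (forall g, W g -> F g * q g = p g) -> forall g, W g -> F g * q' g = p' g].

Lemma stabilizer_subgroup : subgroup H.
Proof.
split=> [|g h /stabilizer Eg /stabilizer Eh]; apply/stabilizer; rewrite ?(act1) //.
by rewrite actM Eh -[in LHS]Eg -actM mulVg act1.
Qed.

Lemma coset_proj_stabilizer g h :
  coset_proj H g = coset_proj H h <-> aact g x1 = aact h x1.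
Proof.
rewrite (coset_proj_eqP _ _ stabilizer_subgroup) -stabilizer actM; split=> [E|<-].
  by rewrite -[in LHS]E -!actM mulgV mul1g.
by rewrite -actM mulVg act1.
Qed.

(** The orbit map gives the bijection. Topology and sheaf both come from [invariant_fractions]: the
    fraction 0 / h yields distinguished neighbourhoods, and p / q yields local expressions of
    functions. *)
Lemma homogeneous_isomorphic : SL2_isomorphic (space_of X) (homogeneous_space H).
Proof.
have /choice [rho Erho] := transitive.
have /choice [tau Etau] := @coset_rep k H.
pose phi x := coset_proj H (rho x); pose psi C := aact (tau C) x1.
have phiE g : phi (aact g x1) = coset_proj H g.
  by apply/coset_proj_stabilizer; rewrite -Erho.
have projH g t : H t -> coset_proj H (g * t)%g = coset_proj H g.
  by move=> /stabilizer Ht; apply/coset_proj_stabilizer; rewrite actM Ht.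
have pullX (f : X -> k) : coord f -> coord (a := SL2_affine k) (fun g => f (aact g x1)).
  by move=> cf; apply: (@pull_coord x1); exists f.
have open_eq (U : cosets H -> Prop) :
    sopen (s := homogeneous_space H) U <-> sopen (s := space_of X) (fun x => U (phi x)).
  split=> /= oU; last first.
    apply: zariski_open_ext (zariski_open_comp (X := SL2_affine k) pullX oU) => g.
    by rewrite phiE.
  exists (fun f => coord f /\ forall x, f x != 0 -> U (phi x)).
  split=> [f []//|x]; split=> [Ux|[f [[cf Hf] fx]]]; last exact: Hf.
  have [y Ey] := transitive x; case: oU => S [cS HS].
  have [h [Sh hy]] : exists q, S q /\ q y != 0 by apply/HS; rewrite -phiE -Ey.
  have [p' [h' [_ [f cf Ef] h'y HW]]] :=
    invariant_fractions (SL2_coord_const 0) (cS _ Sh) hy.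
  exists f; split; last by rewrite Ey -Ef.
  split=> // z fz; apply: NNPP => nU; have [g Eg] := transitive z.
  (* Off [U] the denominator h vanishes, so the constants 0 and 1 both solve F h = 0 there. Hence p'
     = 0 and h' = p' off [U]: the nonvanishing locus of h' lies in [U]. *)
  pose W g := ~ U (coset_proj H g).
  have Wt a t : H t -> W a -> W (a * t)%g by move=> Ht; rewrite /W projH.
  have hW a : W a -> h a = 0.
    by move=> Wa; apply/eqP; apply: contraT => ha; case: Wa; apply/HS; exists h.
  have Wg : W g by rewrite /W -phiE -Eg.
  have p0 : p' g = 0.
    by rewrite -(HW W (fun=> 0) Wt) ?mul0r // => a _; rewrite mul0r.
  have := HW W (fun=> 1) Wt _ _ g Wg; rewrite mul1r p0 Ef -Eg => f0.
  by rewrite f0 ?eqxx // in fz => a Wa; rewrite mul1r hW.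
exists phi, psi; split=> //.
- by move=> x; rewrite /psi [RHS]Erho; apply/coset_proj_stabilizer; rewrite -Etau.
- by move=> C; rewrite /psi phiE -Etau.
- move=> g x /=; rewrite {1}(Erho x) -actM phiE -coset_act_proj.
  by rewrite -phiE -Erho.
move=> U f oU; have oX := (open_eq U).1 oU; split=> /= Hf; last first.
  apply: regular_on_ext (regular_on_comp (X := SL2_affine k)
    (phi := fun g => aact g x1) pullX Hf) => g; by rewrite phiE.
move=> x Ux; have [y Ey] := transitive x.
have [|V [p [q [[S [cS HS]] Vy VU [cp cq] E]]]] := Hf y.
  by rewrite -phiE -Ey.
have [h0 [Sh0 h0y]] := (HS y).1 Vy; have [qy Fy] := E y Vy.
(* The factor [h0] vanishes off [V], so F q h0 = p h0 holds on the whole preimage of [U]. That set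
   is right [H]-stable, while [V] need not be. *)
have [|p' [h' [[p'' cp' Ep] [h'' ch Eh] h'y HW]]] := invariant_fractions
  (SL2_coordM cp (cS _ Sh0)) (SL2_coordM cq (cS _ Sh0)) (y := y).
  by rewrite mulf_neq0.
have {}HW g : U (coset_proj H g) -> f (coset_proj H g) * h' g = p' g.
  apply: (HW (fun g => U (coset_proj H g)) (fun g => f (coset_proj H g))).
  - by move=> a t Ht; rewrite projH.
  - by move=> a t Ht _; rewrite projH.
  - move=> a _; have [ha|ha] := eqVneq (h0 a) 0; first by rewrite ha !mulr0.
    have [|qa ->] := E a; first by apply/HS; exists h0.
    by rewrite mulrA divfK.
exists (fun x => U (phi x) /\ h'' x != 0), p'', h''; split=> //.
- by apply: zariski_open_and => //; apply: coord_mul.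
- by split=> //; rewrite Ey -Eh.
- by move=> z [].
- move=> z [Uz hz]; split=> //; have [g Eg] := transitive z.
  rewrite -[LHS](mulfK hz); congr (_ / _).
  by move: Uz; rewrite Eg phiE -Eh -Ep => /HW.
Qed.

End Stabilizer.

Section SpecIsomorphism.
Variables (x1 : X) (gx1 : generic x1).
Variables (R : (SL2 k -> k) -> Prop) (Rst : left_stable R).
Hypothesis pullR : forall F, pull x1 F <-> R F.

(** An element of [R] lifts uniquely to k[X] because x1 is generic. A point of [X] goes to
    evaluation of the lifts there; [coord_hom] provides the inverse. *)
Lemma spec_isomorphic : SL2_isomorphic (space_of X) (space_of (Spec Rst)).
Proof.
have lift (u : {F | R F}) : exists f, coord f /\ forall g, sval u g = f (aact g x1).
  by case: u => F RF; have /pullR [f cf Ef] := RF; exists f.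
have /choice [ell Hell] := lift.
have ell_eq u f : coord f -> (forall g, sval u g = f (aact g x1)) -> ell u =1 f.
  move=> cf Ef; have [cl El] := Hell u; apply: (generic_eq gx1) => // g.
  by rewrite -El Ef.
have hom x : is_kalg_hom (fun u => ell u x).
  split.
  - by move=> c u Hu; apply: (ell_eq u (fun=> c)) => //; apply: coord_const.
  - move=> u v w E; have [cu Eu] := Hell u; have [cv Ev] := Hell v.
    apply: (ell_eq w (fun x => ell u x + ell v x)); first exact: coord_add.
    by move=> g; rewrite E Eu Ev.
  - move=> u v w E; have [cu Eu] := Hell u; have [cv Ev] := Hell v.
    apply: (ell_eq w (fun x => ell u x * ell v x)); first exact: coord_mul.
    by move=> g; rewrite E Eu Ev.
pose phi x : Spec Rst := exist _ _ (hom x).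
pose res f (cf : coord f) : {F | R F} :=
  exist _ (fun g => f (aact g x1)) ((pullR _).1 (ex_intro2 _ _ f cf (fun g => erefl))).
have sub_eq (u v : {F | R F}) : sval u =1 sval v -> u = v.
  by move=> E; apply: sig_inj; apply: functional_extensionality.
have pt (z : Spec Rst) : exists x, forall f (cf : coord f), f x = sval z (res f cf).
  case: z => z [h1 h2 h3] /=.
  pose ev f := if excluded_middle_informative (coord f) is left cf
    then z (res f cf) else 0.
  have evE f (cf : coord f) : ev f = z (res f cf).
    rewrite /ev; case: excluded_middle_informative => // cf'.
    by congr z; apply: sub_eq.
  have [||||x Hx] := @coord_hom ev; last by exists x => f cf; rewrite Hx.
  - move=> f f' cf E; rewrite (evE f cf) (evE f' (coord_ext E cf)).
    by congr z; apply: sub_eq => g /=.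
  - by move=> c; rewrite (evE _ (coord_const c)); apply: h1.
  - move=> f f' cf cf'.
    by rewrite (evE _ cf) (evE _ cf') (evE _ (coord_add cf cf')); apply: h2.
  - move=> f f' cf cf'.
    by rewrite (evE _ cf) (evE _ cf') (evE _ (coord_mul cf cf')); apply: h3.
have /choice [psi Hpsi] := pt.
apply: (@affine_isomorphic _ X (Spec Rst) phi psi).
- move=> x; apply: coord_sep => f cf; rewrite (Hpsi _ _ cf) /=.
  exact: ell_eq.
- move=> z; apply: sig_inj; apply: functional_extensionality => u /=.
  have [cu Eu] := Hell u; rewrite (Hpsi _ _ cu); congr (sval z _).
  by apply: sub_eq => g /=; rewrite Eu.
- move=> g x; apply: sig_inj; apply: functional_extensionality => u /=.
  have [cu Eu] := Hell u; symmetry.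
  apply: (ell_eq _ (fun x => ell u (aact g x))); first exact: coord_act_fixed.
  by move=> h /=; rewrite /left_regular invgK Eu actM.
- move=> f [u Hu]; have [cu Eu] := Hell u.
  by apply: coord_ext cu => x; rewrite Hu.
- by move=> f cf; exists (res f cf) => z; apply: Hpsi.
Qed.

End SpecIsomorphism.

End SphericalVariety.

(** * Invariants of the torus and of its normalizer *)

Section GeneratedAlgebra.
Variables (k : fieldType) (char0 : [pchar k] =i pred0).
Implicit Types (g h : SL2 k) (F G : SL2 k -> k).

Inductive gen_alg (V : (SL2 k -> k) -> Prop) : (SL2 k -> k) -> Prop :=
  | gen_const c : gen_alg V (fun=> c)
  | gen_base F : V F -> gen_alg V F
  | gen_add F G : gen_alg V F -> gen_alg V G -> gen_alg V (fun g => F g + G g)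
  | gen_mul F G : gen_alg V F -> gen_alg V G -> gen_alg V (fun g => F g * G g).

Lemma gen_ext V F G : F =1 G -> gen_alg V F -> gen_alg V G.
Proof. by move/functional_extensionality => ->. Qed.

Lemma gen_linear V : linear_space (gen_alg V).
Proof.
split=> [F G|F G|c F HF]; [exact: gen_ext|exact: gen_add|].
by apply: gen_mul => //; apply: gen_const.
Qed.

Lemma gen_exp V F n : gen_alg V F -> gen_alg V (fun g => F g ^+ n).
Proof.
move=> HF; elim: n => [|n IH]; first exact: (gen_const V 1).
by apply: gen_ext (gen_mul HF IH) => g; rewrite exprS.
Qed.

Lemma gen_left V : (forall h F, V F -> gen_alg V (fun g => F (h * g)%g)) ->
  left_translatable (gen_alg V).
Proof.
move=> HV h F; elim=> {F} [c|F|F G _ HF _ HG|F G _ HF _ HG].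
- exact: gen_const.
- exact: HV.
- exact: gen_add.
- exact: gen_mul.
Qed.

Lemma gen_invariant V t : (forall F, V F -> forall g, F (g * t)%g = F g) ->
  forall F, gen_alg V F -> forall g, F (g * t)%g = F g.
Proof. by move=> HV F; elim=> {F} [|F /HV|F G _ HF _ HG|F G _ HF _ HG] // g;
  rewrite HF HG.
Qed.

Lemma gen_sub V (A : (SL2 k -> k) -> Prop) :
  (forall c, A (fun=> c)) -> (forall F G, A F -> A G -> A (fun g => F g + G g)) ->
  (forall F G, A F -> A G -> A (fun g => F g * G g)) -> (forall F, V F -> A F) ->
  forall F, gen_alg V F -> A F.
Proof. by move=> Ac Aa Am AV F; elim=> {F}; auto. Qed.

(** Up to factors 2 and -2, [quad_u], [quad_h], [quad_w] are entries of g diag(1, -1) g^-1. They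
    span the adjoint representation, and [quad_rel] is the determinant of this matrix. *)
Definition quad_u g := mx_a g * mx_b g.
Definition quad_h g := mx_a g * mx_d g + mx_b g * mx_c g.
Definition quad_w g := mx_c g * mx_d g.

Lemma quad_rel g : quad_h g ^+ 2 - 4%:R * (quad_u g * quad_w g) = 1.
Proof.
transitivity ((mx_a g * mx_d g - mx_b g * mx_c g) ^+ 2).
  by rewrite /quad_h /quad_u /quad_w; ring.
by rewrite SL2_det expr1n.
Qed.

Lemma quad_uM h g : quad_u (h * g)%g = mx_a h ^+ 2 * quad_u g
  + mx_a h * mx_b h * quad_h g + mx_b h ^+ 2 * quad_w g.
Proof. rewrite /quad_u /quad_h /quad_w !mx_M; ring. Qed.

Lemma quad_hM h g : quad_h (h * g)%g = 2%:R * (mx_a h * mx_c h) * quad_u g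
  + (mx_a h * mx_d h + mx_b h * mx_c h) * quad_h g
  + 2%:R * (mx_b h * mx_d h) * quad_w g.
Proof. rewrite /quad_u /quad_h /quad_w !mx_M; ring. Qed.

Lemma quad_wM h g : quad_w (h * g)%g = mx_c h ^+ 2 * quad_u g
  + mx_c h * mx_d h * quad_h g + mx_d h ^+ 2 * quad_w g.
Proof. rewrite /quad_u /quad_h /quad_w !mx_M; ring. Qed.

Definition quad F : Prop := [\/ F = quad_u, F = quad_h | F = quad_w].

(** Right translation by the Weyl element negates each [quad], so these products are invariant under
    the normalizer. *)
Definition quad2 F : Prop :=
  exists F1 F2, [/\ quad F1, quad F2 & F = fun g => F1 g * F2 g].

Lemma quad_left h F : quad F -> exists c1 c2 c3 : k, forall g,
  F (h * g)%g = c1 * quad_u g + c2 * quad_h g + c3 * quad_w g.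
Proof.
by case=> ->; do 3!eexists; move=> g; rewrite ?quad_uM ?quad_hM ?quad_wM;
  reflexivity.
Qed.

Lemma gen_quad_left : left_translatable (gen_alg quad).
Proof.
apply: gen_left => h F /(quad_left h) [c1 [c2 [c3 E]]].
apply: (gen_ext (fun g => esym (E g))).
by do !apply: gen_add; apply: gen_mul; try apply: gen_const; apply: gen_base;
  [apply: Or31|apply: Or32|apply: Or33].
Qed.

Lemma gen_quad2_left : left_translatable (gen_alg quad2).
Proof.
apply: gen_left => h _ [F1 [F2 [q1 q2 ->]]].
have [c1 [c2 [c3 E1]]] := quad_left h q1.
have [d1 [d2 [d3 E2]]] := quad_left h q2.
have q2q F G : quad F -> quad G -> gen_alg quad2 (fun g => F g * G g).
  by move=> qF qG; apply: gen_base; exists F, G.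
have [qu qh qw] : [/\ quad quad_u, quad quad_h & quad quad_w].
  by split; [apply: Or31|apply: Or32|apply: Or33].
have [_ Ga Gz] := gen_linear quad2.
apply: (gen_ext (F := fun g =>
    c1 * d1 * (quad_u g * quad_u g) + (c1 * d2 + c2 * d1) * (quad_u g * quad_h g)
  + (c1 * d3 + c3 * d1) * (quad_u g * quad_w g) + c2 * d2 * (quad_h g * quad_h g)
  + (c2 * d3 + c3 * d2) * (quad_h g * quad_w g) + c3 * d3 * (quad_w g * quad_w g))).
  by move=> g; rewrite E1 E2; ring.
exact: (Ga _ _ (Ga _ _ (Ga _ _ (Ga _ _ (Ga _ _ (Gz _ _ (q2q _ _ qu qu))
  (Gz _ _ (q2q _ _ qu qh))) (Gz _ _ (q2q _ _ qu qw))) (Gz _ _ (q2q _ _ qh qh)))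
  (Gz _ _ (q2q _ _ qh qw))) (Gz _ _ (q2q _ _ qw qw))).
Qed.

Lemma two_neq0 : 2%:R != 0 :> k.
Proof. exact: natr_neq0. Qed.

Lemma four_neq0 : 4%:R != 0 :> k.
Proof. exact: natr_neq0. Qed.

(** On SL_2 one has h + 1 = 2ad. If this is nonzero, take a = 1 and d = (h + 1) / 2; if h = -1, take
    b = -1 and c = 1. *)
Lemma quad_point (u h w : k) : h ^+ 2 - 4%:R * (u * w) = 1 ->
  exists g, [/\ quad_u g = u, quad_h g = h & quad_w g = w].
Proof.
move=> E; have t0 := two_neq0; have f0 := four_neq0.
have Euw : u * w = (h ^+ 2 - 1) / 4%:R.
  transitivity ((h ^+ 2 - (h ^+ 2 - 4%:R * (u * w))) / 4%:R); first by field.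
  by rewrite E.
have [h1|h1] := eqVneq (h + 1) 0.
  have eh : h = -1 by apply/eqP; rewrite -addr_eq0 h1.
  have uw0 : u * w = 0 by rewrite Euw eh; field.
  have D : (- u) * w - (-1) * 1 = 1.
    by transitivity (1 - u * w); [ring|rewrite uw0 subr0].
  exists (sl2 (- u) (-1) 1 w); rewrite /quad_u /quad_h /quad_w.
  case: (sl2E D) => -> -> -> ->; split; try ring.
  by rewrite eh; transitivity (- (u * w) - 1); [ring|rewrite uw0 oppr0 add0r].
pose v := (h + 1) / 2%:R; have v0 : v != 0 by rewrite mulf_neq0 ?invr_eq0.
have Ev : u * w = v * (v - 1).
  rewrite Euw /v; field; by rewrite t0 f0.
have D : 1 * v - u * (w / v) = 1 by rewrite mulrA Ev; field.
exists (sl2 1 u (w / v) v); rewrite /quad_u /quad_h /quad_w.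
case: (sl2E D) => -> -> -> ->; split; first by ring.
  by rewrite mulrA Ev /v; field; rewrite t0 -/v /=.
by field.
Qed.

Lemma torusE g : torus g <-> exists2 t, t != 0 & g = tor t.
Proof.
split=> [[t t0 [Ea Eb Ec Ed]]|[t t0 ->]].
  exists t^-1; first by rewrite invr_eq0.
  have ti : t^-1 != 0 by rewrite invr_eq0.
  case: (torE ti) => Ea' Eb' Ec' Ed'.
  by apply: SL2_eq; rewrite ?Ea ?Eb ?Ec ?Ed ?Ea' ?Eb' ?Ec' ?Ed' ?invrK.
exists t^-1; first by rewrite invr_eq0.
by case: (torE t0) => Ea' Eb' Ec' Ed'; rewrite Ea' Eb' Ec' Ed' invrK.
Qed.

Lemma torus_quad g : torus g <-> [/\ quad_u g = 0, quad_h g = 1 & quad_w g = 0].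
Proof.
split=> [[t t0 [Ea Eb Ec Ed]]|[u0 h1 w0]].
  by rewrite /quad_u /quad_h /quad_w Ea Eb Ec Ed; split; field.
have D := SL2_det g.
have bc : mx_b g * mx_c g = 0.
  apply: (mulfI two_neq0); rewrite mulr0.
  transitivity (quad_h g - (mx_a g * mx_d g - mx_b g * mx_c g)).
    by rewrite /quad_h; ring.
  by rewrite D h1 subrr.
have ad : mx_a g * mx_d g = 1 by rewrite -D bc subr0.
have a0 : mx_a g != 0 by apply: contra_eq_neq ad => ->; rewrite mul0r eq_sym oner_eq0.
have d0 : mx_d g != 0 by apply: contra_eq_neq ad => ->; rewrite mulr0 eq_sym oner_eq0.
have b0 : mx_b g = 0 by apply: (mulfI a0); rewrite mulr0.
have c0 : mx_c g = 0 by apply: (mulIf d0); rewrite mul0r.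
exists (mx_d g) => //; split=> //.
by apply: (mulIf d0); rewrite ad mulVf.
Qed.

Definition monomial (m : nat * nat * nat * nat) g : k :=
  mx_a g ^+ m.1.1.1 * mx_b g ^+ m.1.1.2 * mx_c g ^+ m.1.2 * mx_d g ^+ m.2.

(** Such a monomial is a product of pairs ab, ad, bc, cd, and ad = (h + 1) / 2, bc = (h - 1) / 2. *)
Lemma gen_quad_monomial i j l n : (i + l = j + n)%N ->
  gen_alg quad (monomial (i, j, l, n)).
Proof.
have [Gu Gh Gw] : [/\ gen_alg quad quad_u, gen_alg quad quad_h
    & gen_alg quad quad_w].
  by split; apply: gen_base; [apply: Or31|apply: Or32|apply: Or33].
have [Gad Gbc] : gen_alg quad (fun g => mx_a g * mx_d g) /\
    gen_alg quad (fun g => mx_b g * mx_c g).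
  split.
    apply: (gen_ext (F := fun g => 2%:R^-1 * (quad_h g + 1))).
      move=> g; rewrite -[X in _ + X](SL2_det g) /quad_h; field; exact: two_neq0.
    by apply: gen_mul; [|apply: gen_add]; try exact: gen_const.
  apply: (gen_ext (F := fun g => 2%:R^-1 * (quad_h g + (-1)))).
    move=> g; rewrite -[X in _ + - X](SL2_det g) /quad_h; field; exact: two_neq0.
  by apply: gen_mul; [|apply: gen_add]; try exact: gen_const.
elim: i j l n => [|i IHi].
  elim=> [|j IHj] l n.
    elim: l n => [|l IHl] [|n] // E.
      by apply: gen_ext (gen_const _ 1) => g; rewrite /monomial /= !mulr1.
    apply: gen_ext (gen_mul Gw (IHl n _)) => [g|]; last by lia.
    by rewrite /monomial /quad_w /= !exprS; ring.
  case: l => [|l] E; first by lia.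
  apply: gen_ext (gen_mul Gbc (IHj l n _)) => [g|]; last by lia.
  by rewrite /monomial /= !exprS; ring.
move=> [|j] l [|n] E; first by lia.
- apply: gen_ext (gen_mul Gad (IHi 0%N l n _)) => [g|]; last by lia.
  by rewrite /monomial /= !exprS; ring.
- apply: gen_ext (gen_mul Gu (IHi j l 0%N _)) => [g|]; last by lia.
  by rewrite /monomial /quad_u /= !exprS; ring.
- apply: gen_ext (gen_mul Gu (IHi j l n.+1 _)) => [g|]; last by lia.
  by rewrite /monomial /quad_u /= !exprS; ring.
Qed.

Lemma SL2_coord_monomials F : SL2_coord F ->
  exists (r : seq (nat * nat * nat * nat)) (e : nat * nat * nat * nat -> k),
    forall g, F g = \sum_(m <- r) e m * monomial m g.
Proof.
case=> p Hp.
pose mm (m : 'X_{1..4}) := (m 0, m (inord 1), m (inord 2), m (inord 3)).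
pose mi (m : nat * nat * nat * nat) : 'X_{1..4} :=
  [multinom tnth [tuple m.1.1.1; m.1.1.2; m.1.2; m.2] i | i < 4].
have mmK m : mi (mm m) = m.
  apply/mnmP => i; rewrite mnmE (tnth_nth 0%N).
  by case: i => [[|[|[|[|?]]]]] //= Hi; congr (m _); apply: val_inj;
    rewrite /= ?inordK.
exists [seq mm m | m <- msupp p], (fun m => p@_(mi m)) => g.
rewrite big_map Hp mevalE; apply: eq_bigr => m _; rewrite mmK; congr (_ * _).
rewrite !big_ord_recl big_ord0 mulr1 /monomial /= !mulrA.
by do ?congr (_ * _); rewrite ?(tnth_nth 0) /=; congr (_ ^+ m _);
   apply: val_inj; rewrite /= ?inordK.
Qed.

(* The components of [F] and [G] for right translation by the torus, which
   scales [a], [c] by [t] and [b], [d] by [t^-1]. *)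
Lemma right_weights F G : SL2_coord F -> SL2_coord G ->
  exists (N n : nat) (C D : 'I_n -> SL2 k -> k), [/\
    forall t g, t != 0 -> t ^+ N * F (g * tor t)%g = \sum_(i < n) t ^+ i * C i g,
    forall t g, t != 0 -> t ^+ N * G (g * tor t)%g = \sum_(i < n) t ^+ i * D i g
  & forall (i : 'I_n) (R : (SL2 k -> k) -> Prop), linear_space R -> R (fun=> 0) ->
      (forall p q r s, (p + r + N = q + s + i)%N -> R (monomial (p, q, r, s))) ->
      R (C i) /\ R (D i)].
Proof.
move=> /SL2_coord_monomials [rF [eF EF]] /SL2_coord_monomials [rG [eG EG]].
pose hi (m : nat * nat * nat * nat) := (m.1.1.1 + m.1.2)%N.
pose lo (m : nat * nat * nat * nat) := (m.1.1.2 + m.2)%N.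
(* Shifting by the largest negative contribution makes the weight N + hi - lo of every monomial a
   natural number. *)
pose N := (\max_(m <- rF ++ rG) lo m)%N.
pose M := (\max_(m <- rF ++ rG) hi m)%N.
pose n := (N + M).+1.
pose comp r (e : nat * nat * nat * nat -> k) (i : 'I_n) g :=
  \sum_(m <- r) (if (N + hi m - lo m)%N == i then e m else 0) * monomial m g.
have compE r e t g : {subset r <= rF ++ rG} -> t != 0 ->
    t ^+ N * \sum_(m <- r) e m * monomial m (g * tor t)%g =
    \sum_(i < n) t ^+ i * comp r e i g.
  move=> sub t0; rewrite mulr_sumr.
  under [RHS]eq_bigr => i _ do rewrite mulr_sumr.
  rewrite exchange_big; apply: eq_big_seq => m mr /=.
  have leN : (lo m <= N)%N by apply: leq_bigmax_seq => //; apply: sub.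
  have leM : (hi m <= M)%N by apply: leq_bigmax_seq => //; apply: sub.
  have lt : (N + hi m - lo m < n)%N by rewrite /n; lia.
  rewrite (bigD1 (Ordinal lt)) //= eqxx big1 ?addr0; last first.
    move=> i; rewrite -val_eqE /= eq_sym => /negPf ->.
    by rewrite mul0r mulr0.
  have Em : monomial m (g * tor t)%g * t ^+ lo m = t ^+ hi m * monomial m g.
    case: (torE t0) => Ea Eb Ec Ed; rewrite /monomial /hi /lo !mx_M Ea Eb Ec Ed.
    rewrite !mulr0 !add0r !addr0 !exprMn !exprVn !exprD; field.
    by rewrite !expf_neq0.
  apply: (mulIf (expf_neq0 (lo m) t0)).
  rewrite -mulrA -[e m * _ * _]mulrA Em.
  rewrite [RHS]mulrAC -exprD (_ : N + hi m - lo m + lo m = N + hi m)%N; last by lia.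
  by rewrite exprD; ring.
have compR r e (i : 'I_n) (R : (SL2 k -> k) -> Prop) : {subset r <= rF ++ rG} -> linear_space R -> R (fun=> 0) ->
    (forall p q r s, (p + r + N = q + s + i)%N -> R (monomial (p, q, r, s))) ->
    R (comp r e i).
  move=> sub [Re Ra Rz] R0 HR; rewrite /comp; elim: r sub => [|m r IH] sub.
    by apply: Re R0 => g; rewrite big_nil.
  have leN : (lo m <= N)%N.
    by apply: leq_bigmax_seq => //; apply: sub; rewrite mem_head.
  apply: (Re (fun g => (if (N + hi m - lo m)%N == i then e m else 0) * monomial m g +
     \sum_(m <- r) (if (N + hi m - lo m)%N == i then e m else 0) * monomial m g)).
    by move=> g; rewrite big_cons.
  apply: Ra; last by apply: IH => x xr; apply: sub; rewrite inE xr orbT.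
  case: eqP => [Ei|_]; last by apply: Re R0 => g; rewrite mul0r.
  apply: Rz; case: m leN Ei {sub} => [[[p q] l] s] /= leN Ei; apply: HR.
  by move: leN Ei; rewrite /hi /lo /=; lia.
have subF : {subset rF <= rF ++ rG} by move=> m mr; rewrite mem_cat mr.
have subG : {subset rG <= rF ++ rG} by move=> m mr; rewrite mem_cat mr orbT.
exists N, n, (comp rF eF), (comp rG eG); split.
- by move=> t g t0; rewrite EF; apply: compE.
- by move=> t g t0; rewrite EG; apply: compE.
- by move=> i R linR R0 HR; split; apply: compR.
Qed.

(* A weight component of [q] that does not vanish at [y], times a monomial of
   opposite weight, is torus-invariant. *)
Lemma torus_fractions (p q : SL2 k -> k) (y : SL2 k) : SL2_coord p ->
  SL2_coord q -> q y != 0 -> exists p' q' : SL2 k -> k,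
  [/\ gen_alg quad p', gen_alg quad q', q' y != 0
    & forall (W : SL2 k -> Prop) F,
        (forall g t, torus t -> W g -> W (g * t)%g) ->
        (forall g t, torus t -> W g -> F (g * t)%g = F g) ->
        (forall g, W g -> F g * q g = p g) -> forall g, W g -> F g * q' g = p' g].
Proof.
move=> cp cq qy; have [N [n [C [D [EC ED HR]]]]] := right_weights cp cq.
have [i Di] : exists i, D i y != 0.
  apply: NNPP => H; move/eqP: qy; apply.
  have := ED 1 y (oner_neq0 _); rewrite expr1n mul1r tor1 mulg1 => ->.
  apply: big1 => i _; have [->|Di] := eqVneq (D i y) 0; first by rewrite mulr0.
  by case: H; exists i.
(* As [F] is torus-invariant, F q = p splits into its weight components. *)
have FCD (W : SL2 k -> Prop) F :
    (forall g t, torus t -> W g -> W (g * t)%g) ->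
    (forall g t, torus t -> W g -> F (g * t)%g = F g) ->
    (forall g, W g -> F g * q g = p g) -> forall g, W g -> F g * D i g = C i g.
  move=> Wt Ft H g Wg; move: i {Di}.
  apply: (coef_eq char0 (c := fun i => F g * D i g) (d := fun i => C i g)) => t t0.
  have Tt : torus (tor t) by apply/torusE; exists t.
  rewrite -EC // -H; last exact: Wt.
  rewrite Ft // mulrCA ED // mulr_sumr.
  by apply: eq_bigr => l _; rewrite mulrCA.
have [r ry [RC RD]] : exists2 r : SL2 k -> k, r y != 0 &
    gen_alg quad (fun g => r g * C i g) /\ gen_alg quad (fun g => r g * D i g).
  suff [m my Hm] : exists2 m : nat * nat * nat * nat, monomial m y != 0 &
      (m.1.1.1 + m.1.2 + i = m.1.1.2 + m.2 + N)%N.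
    exists (monomial m) => //.
    apply: (HR i (fun F => gen_alg quad (fun g => monomial m g * F g))).
    - split=> [F G E|F G HF HG|c F HF].
      + by apply: gen_ext => g; rewrite E.
      + by apply: gen_ext (gen_add HF HG) => g; rewrite mulrDr.
      + by apply: gen_ext (gen_mul (gen_const _ c) HF) => g; rewrite mulrCA.
    - by apply: gen_ext (gen_const _ 0) => g; rewrite mulr0.
    - move=> a b c d E; case: m {my} Hm => [[[a' b'] c'] d'] /= Hm.
      apply: gen_ext (@gen_quad_monomial (a' + a) (b' + b) (c' + c) (d' + d) _).
        by move=> g; rewrite /monomial /= !exprD; ring.
      by move: E Hm; clear; lia.
  have D0 := SL2_det y.
  (* The weight i - N is compensated by a power of b or d when nonnegative, of a or c otherwise; no
     column of an invertible matrix vanishes, so one of the two entries is nonzero at y. *)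
  have [le|lt] := leqP N i.
    have [b0|b0] := eqVneq (mx_b y) 0; last first.
      exists (0, i - N, 0, 0)%N; last by rewrite /=; lia.
      by rewrite /monomial /= !mulr1 mul1r expf_neq0.
    have d0 : mx_d y != 0.
      by apply: contra_eq_neq D0 => ->; rewrite b0 mulr0 mul0r subr0 eq_sym oner_eq0.
    exists (0, 0, 0, i - N)%N; last by rewrite /=; lia.
    by rewrite /monomial /= !mul1r expf_neq0.
  have [a0|a0] := eqVneq (mx_a y) 0; last first.
    exists (N - i, 0, 0, 0)%N; last by rewrite /=; lia.
    by rewrite /monomial /= !mulr1 expf_neq0.
  have c0 : mx_c y != 0.
    by apply: contra_eq_neq D0 => ->; rewrite a0 mulr0 mul0r subr0 eq_sym oner_eq0.
  exists (0, 0, N - i, 0)%N; last by rewrite /=; lia.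
  by rewrite /monomial /= !mulr1 !mul1r expf_neq0.
exists (fun g => r g * C i g), (fun g => r g * D i g); split=> //.
  by rewrite mulf_neq0.
by move=> W F Wt Ft H g Wg; rewrite mulrCA (FCD W F).
Qed.

End GeneratedAlgebra.

(** * Recovering the adjoint functions from ab or from its square *)

Section Polarization.
Variables (k : fieldType) (char0 : [pchar k] =i pred0).
Implicit Types (g h : SL2 k) (F G : SL2 k -> k).
Variables (R : (SL2 k -> k) -> Prop) (linR : linear_space R).
Variable leftR : left_translatable R.

Lemma quad_polarize : R (@quad_u k) -> forall F, quad F -> R F.
Proof.
move=> Ru; pose C (i : 'I_3) g := nth 0 [:: quad_u g; quad_h g; quad_w g] i.
have RC i : R (C i).
  apply: (coef_extract char0 (Phi := fun s g => quad_u (uup s * g)%g) linR).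
    by move=> s _; apply: leftR.
  move=> s g _; case: (uupE s) => Ea Eb _ _.
  by rewrite quad_uM Ea Eb /C !big_ord_recl big_ord0 /=; ring.
case: linR => Re _ _ F [] ->.
- by apply: Re (RC (inord 0)) => g; rewrite /C inordK.
- by apply: Re (RC (inord 1)) => g; rewrite /C inordK.
- by apply: Re (RC (inord 2)) => g; rewrite /C inordK.
Qed.

(** Translates of u^2 span only the five-dimensional part of the symmetric square, where h^2 and uw
    occur as h^2 + 2uw. Constants separate them: by [quad_rel], h^2 + 2uw - 1 = 6uw. *)
Lemma quad2_polarize : (forall c, R (fun=> c)) ->
  R (fun g => quad_u g ^+ 2) -> forall F, quad2 F -> R F.
Proof.
move=> Rc Ruu; case: (linR) => Re Ra Rz.
pose C (i : 'I_5) g := nth 0 [:: quad_u g ^+ 2; 2%:R * (quad_u g * quad_h g);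
  quad_h g ^+ 2 + 2%:R * (quad_u g * quad_w g); 2%:R * (quad_h g * quad_w g);
  quad_w g ^+ 2] i.
have RC i : R (C i).
  apply: (coef_extract char0 (Phi := fun s g => quad_u (uup s * g)%g ^+ 2) linR).
    by move=> s _; exact: (leftR (uup s) Ruu).
  move=> s g _; case: (uupE s) => Ea Eb _ _.
  by rewrite quad_uM Ea Eb /C !big_ord_recl big_ord0 /=; ring.
have t0 := two_neq0 char0.
have six0 : 6%:R != 0 :> k by apply: natr_neq0.
have Ruh : R (fun g => quad_u g * quad_h g).
  apply: Re (Rz 2%:R^-1 _ (RC (inord 1))) => g; rewrite /C inordK //=.
  by rewrite mulKf.
have Rhw : R (fun g => quad_h g * quad_w g).
  apply: Re (Rz 2%:R^-1 _ (RC (inord 3))) => g; rewrite /C inordK //=.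
  by rewrite mulKf.
have Rww : R (fun g => quad_w g * quad_w g).
  by apply: Re (RC (inord 4)) => g; rewrite /C inordK //= expr2.
have Ruw : R (fun g => quad_u g * quad_w g).
  apply: Re (Rz 6%:R^-1 _ (Ra _ _ (RC (inord 2)) (Rc (-1)))) => g.
  rewrite /C inordK //= -[RHS](mulKf six0); congr (_ * _).
  by rewrite -[X in _ - X](quad_rel g); ring.
have Rhh : R (fun g => quad_h g * quad_h g).
  apply: Re (Ra _ _ (RC (inord 2)) (Rz (- 2%:R) _ Ruw)) => g.
  by rewrite /C inordK //=; ring.
have Ruu' : R (fun g => quad_u g * quad_u g).
  by apply: Re Ruu => g; rewrite expr2.
move=> F [F1 [F2 [q1 q2 ->]]].
have sym F3 F4 : R (fun g => F3 g * F4 g) -> R (fun g => F4 g * F3 g).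
  by apply: Re => g; rewrite mulrC.
by case: q1 => ->; case: q2 => -> //; apply: sym.
Qed.

End Polarization.

(** * The isomorphism with a model in each case *)

Section Cases.
Variables (k : fieldType) (char0 : [pchar k] =i pred0).
Hypothesis kcl : forall p : {poly k}, size p != 1 -> exists x, root p x.
Variables (X : affine_SL2 k) (hX : affine_spherical X).
Variables (x1 : X) (gx1 : generic x1).
Implicit Types (f : X -> k) (g h : SL2 k) (x : X) (F G : SL2 k -> k).

Lemma sqrt_exists (c : k) : exists s, s ^+ 2 = c.
Proof.
have [|s] := kcl (p := 'X^2 - c%:P); first by rewrite size_XnsubC.
by rewrite /root !hornerE subr_eq0 => /eqP; exists s.
Qed.

(** Evaluations at x and at g x1 are algebra homomorphisms, so agreement on the generators [V]
    suffices; genericity makes the function on [X] behind each generator unique. *)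
Lemma gen_alg_point V x g : (forall F, pull x1 F -> gen_alg V F) ->
  (forall F, V F -> pull x1 F) ->
  (forall F f, V F -> coord f -> (forall h, F h = f (aact h x1)) -> f x = F g) ->
  x = aact g x1.
Proof.
move=> HV VP Hx; apply: (coord_sep hX) => f cf.
have PF : pull x1 (fun h => f (aact h x1)) by exists f.
have GP F : gen_alg V F -> pull x1 F.
  apply: gen_sub => // [c|F1 F2|F1 F2].
  - exact: pull_const.
  - by case: (pull_linear hX x1) => _ + _; apply.
  - exact: pull_mul.
suff H F : gen_alg V F ->
    forall f, coord f -> (forall h, F h = f (aact h x1)) -> f x = F g.
  by rewrite (H _ (HV _ PF) f cf).
elim=> {F f cf PF} [c|F VF|F G gF HF gG HG|F G gF HF gG HG] f cf Ef.
- by rewrite -(@generic_eq _ _ hX x1 (fun=> c) f gx1) //; apply: coord_const.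
- exact: Hx.
- have [fF cF EF] := GP _ gF; have [fG cG EG] := GP _ gG.
  rewrite -(HF _ cF EF) -(HG _ cG EG).
  apply: (generic_eq hX gx1 cf (coord_add hX cF cG)) => h.
  by rewrite -Ef EF EG.
- have [fF cF EF] := GP _ gF; have [fG cG EG] := GP _ gG.
  rewrite -(HF _ cF EF) -(HG _ cG EG).
  apply: (generic_eq hX gx1 cf (coord_mul hX cF cG)) => h.
  by rewrite -Ef EF EG.
Qed.

Lemma gen_alg_fixed V t : (forall F, pull x1 F -> gen_alg V F) ->
  (forall F, V F -> pull x1 F) -> (forall F, V F -> F t = F 1%g) ->
  aact t x1 = x1.
Proof.
move=> HV VP Ht; rewrite -[RHS](act1 hX x1); apply: (gen_alg_point HV VP).
by move=> F f VF cf Ef; rewrite -Ef Ht.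
Qed.

Lemma pull_fixed t F g : aact t x1 = x1 -> pull x1 F -> F (g * t)%g = F g.
Proof. by move=> Et [f cf Ef]; rewrite !Ef (actM hX) Et. Qed.

Lemma isomorphic_point : (forall F, pull x1 F -> exists c, forall g, F g = c) ->
  SL2_isomorphic (space_of X) (homogeneous_space (fun _ : SL2 k => True)).
Proof.
move=> Hc; have pt x y : x = y.
  apply: (coord_sep hX) => f cf; have [|c Ec] := Hc (fun g => f (aact g x1)).
    by exists f.
  have E := generic_eq hX gx1 cf (coord_const hX c) Ec.
  by rewrite (E x) (E y).
apply: (homogeneous_isomorphic hX (x1 := x1)) => [x|g|p q y cp cq qy].
- by exists 1%g.
- by split.
exists (fun=> p y), (fun=> q y); split=> //; try exact: pull_const.
move=> W F Wt Ft H g Wg.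
have Eg : y = (g * (g^-1 * y))%g by rewrite mulVKg.
have Wy : W y by rewrite Eg; apply: Wt.
by rewrite -(H _ Wy); congr (_ * _); rewrite [in RHS]Eg Ft.
Qed.

(** The functions u, h, w identify [X] with the quadric h^2 - 4uw = 1: the relation extends from the
    dense orbit to every point, [quad_point] lifts the point to SL_2, and the fibre over (0, 1, 0)
    is the torus. *)
Lemma isomorphic_torus : monomial_algebra (pull x1) (@quad_u k) 1 ->
  SL2_isomorphic (space_of X) (homogeneous_space (@torus k)).
Proof.
case=> _ Hi HR.
have linA := pull_linear hX x1; have leftA := pull_left hX (x := x1).
have Aq F : quad F -> pull x1 F.
  apply: (quad_polarize char0 linA leftA).
  by case: linA => Re _ _; apply: Re ((Hi 1%N).2 (dvdn1 1)) => g; rewrite expr1.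
have Ag F : pull x1 F -> gen_alg (@quad k) F.
  apply: HR; [exact: gen_linear|exact: gen_quad_left|move=> i].
  by apply: gen_exp; apply: gen_base; apply: Or31.
have gA F : gen_alg (@quad k) F -> pull x1 F.
  apply: gen_sub => // [c|F1 F2|F1 F2].
  - exact: pull_const.
  - by case: linA => _ + _; apply.
  - exact: pull_mul.
apply: (homogeneous_isomorphic hX (x1 := x1)) => [x|g|p q y cp cq qy].
- have [fu cu Eu] : pull x1 (@quad_u k) by apply: Aq; apply: Or31.
  have [fh ch Eh] : pull x1 (@quad_h k) by apply: Aq; apply: Or32.
  have [fw cw Ew] : pull x1 (@quad_w k) by apply: Aq; apply: Or33.
  have [g [gu gh gw]] : exists g, [/\ quad_u g = fu x, quad_h g = fh x
      & quad_w g = fw x].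
    apply: (quad_point char0); rewrite -[RHS]/((fun=> 1) x).
    have -> : fh x ^+ 2 - 4%:R * (fu x * fw x) =
       (fun x => fh x * fh x + (- 4%:R) * (fu x * fw x)) x by rewrite /=; ring.
    move: x; apply: (generic_eq hX gx1).
    + apply: (coord_add hX); first exact: coord_mul.
      by apply: (coord_scale hX); apply: coord_mul.
    + exact: coord_const.
    + by move=> g; rewrite -Eu -Eh -Ew -[RHS](quad_rel g); ring.
  exists g; apply: (gen_alg_point Ag Aq) => F f qF cf Ef.
  case: qF => EF; rewrite EF in Ef *.
  + rewrite gu; apply: (generic_eq hX gx1 cf cu) => h; by rewrite -Ef Eu.
  + rewrite gh; apply: (generic_eq hX gx1 cf ch) => h; by rewrite -Ef Eh.
  + rewrite gw; apply: (generic_eq hX gx1 cf cw) => h; by rewrite -Ef Ew.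
- have [u1 h1 w1] : [/\ quad_u (1%g : SL2 k) = 0, quad_h (1%g : SL2 k) = 1
      & quad_w (1%g : SL2 k) = 0].
    by rewrite /quad_u /quad_h /quad_w !mx_1; split; ring.
  split=> [Eg|/(torus_quad char0) [gu gh gw]].
    have E F : quad F -> F g = F 1%g.
      by move=> /Aq AF; rewrite -[g]mul1g (pull_fixed 1%g Eg AF).
    apply/(torus_quad char0); split.
    + by rewrite E ?u1 //; apply: Or31.
    + by rewrite E ?h1 //; apply: Or32.
    + by rewrite E ?w1 //; apply: Or33.
  apply: (gen_alg_fixed Ag Aq) => F [] ->; rewrite ?u1 ?h1 ?w1 //.
have [p' [q' [gp gq q'y H]]] := torus_fractions char0 cp cq qy.
by exists p', q'; split=> //; apply: gA.
Qed.

Definition monomial_matrix g : Prop :=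
  (mx_b g = 0 /\ mx_c g = 0) \/ (mx_a g = 0 /\ mx_d g = 0).

Lemma monomial_matrixP g : quad_u g = 0 -> quad_w g = 0 -> monomial_matrix g.
Proof.
have D := SL2_det g; have o := oner_neq0 k.
rewrite /quad_u /quad_w => /eqP; rewrite mulf_eq0 => /orP [] /eqP E.
  move=> /eqP; rewrite mulf_eq0 => /orP [] /eqP E'; last by right.
  by move: D o; rewrite E E' !(mul0r, mulr0) subr0 => ->; rewrite eqxx.
move=> /eqP; rewrite mulf_eq0 => /orP [] /eqP E'; first by left.
by move: D o; rewrite E E' !(mul0r, mulr0) subr0 => ->; rewrite eqxx.
Qed.

Lemma monomial_matrix_quad t : monomial_matrix t -> exists e : k, e * e = 1 /\
  forall F, quad F -> forall g, F (g * t)%g = e * F g.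
Proof.
have D := SL2_det t; case=> [[b0 c0]|[a0 d0]].
  exists 1; split; first by ring.
  have {}D : mx_a t * mx_d t = 1 by rewrite -D b0; ring.
  move=> F [] -> g; rewrite /quad_u /quad_h /quad_w !mx_M b0 c0 -D; ring.
exists (-1); split; first by ring.
have {}D : mx_b t * mx_c t = -1 by rewrite -D a0; ring.
by move=> F [] -> g; rewrite /quad_u /quad_h /quad_w !mx_M a0 d0 -D; ring.
Qed.

Lemma normalizer_torusE g : normalizer (@torus k) g <-> monomial_matrix g.
Proof.
split=> [N|].
  (* One regular element is enough: the off-diagonal entries of its conjugate by g are -(3/2) ab and
     (3/2) cd, where 3/2 = 2 - 1/2. *)
  have t0 := two_neq0 char0; have T2 : torus (tor (2%:R : k)) by apply/torusE; exists 2%:R.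
  have [t _ [_ Eb Ec _]] := (N _).1 T2.
  have three0 : 3%:R != 0 :> k by apply: natr_neq0.
  have [a2 b2 c2 d2] := torE t0.
  have m0 : - (3%:R / 2%:R) != 0 :> k by rewrite oppr_eq0 mulf_neq0 ?invr_eq0.
  apply: monomial_matrixP.
    apply: (mulfI m0); rewrite mulr0 -[RHS]Eb !mx_M !mx_V a2 b2 c2 d2 /quad_u.
    by field.
  have m0' : 3%:R / 2%:R != 0 :> k by rewrite -oppr_eq0.
  apply: (mulfI m0'); rewrite mulr0 -[RHS]Ec !mx_M !mx_V a2 b2 c2 d2 /quad_w.
  by field.
have conj g' h : monomial_matrix g' -> torus h -> torus (g' * h * g'^-1)%g.
  move=> Mg Th; have D := SL2_det g'; case: (Th) => t t0 [Ea Eb Ec Ed].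
  case: Mg => -[E1 E2]; [exists t|exists t^-1; first by rewrite invr_eq0];
    rewrite // !mx_M !mx_V Ea Eb Ec Ed E1 E2; rewrite E1 E2 in D.
    have {}D : mx_a g' * mx_d g' = 1 by rewrite -D; ring.
    split; try ring.
      by transitivity (mx_a g' * mx_d g' * t^-1); [ring|rewrite D mul1r].
    by transitivity (mx_a g' * mx_d g' * t); [ring|rewrite D mul1r].
  have {}D : mx_b g' * mx_c g' = -1 by rewrite -D; ring.
  rewrite invrK; split; try ring.
    by transitivity (- (mx_b g' * mx_c g') * t); [ring|rewrite D opprK mul1r].
  by transitivity (- (mx_b g' * mx_c g') * t^-1); [ring|rewrite D opprK mul1r].
move=> Mg h; split; first exact: conj.
have Mg' : monomial_matrix g^-1%g.
  by case: Mg => -[E1 E2]; [left|right]; rewrite !mx_V E1 E2 ?oppr0.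
move/(conj _ _ Mg'); rewrite invgK.
by rewrite -!mulgA mulVg mulg1 mulKg.
Qed.

(** Even and odd parts with respect to degree in u, h, w: the product of two odd parts is even
    because [A] contains all products of two generators. *)
Lemma gen_quad_split (A : (SL2 k -> k) -> Prop) F : linear_space A ->
  (forall c, A (fun=> c)) -> (forall F G, A F -> A G -> A (fun g => F g * G g)) ->
  (forall F, quad2 F -> A F) -> gen_alg (@quad k) F ->
  exists E C1 C2 C3, [/\ A E, A C1, A C2 & A C3] /\ forall g,
    F g = E g + (quad_u g * C1 g + quad_h g * C2 g + quad_w g * C3 g).
Proof.
move=> [Ae Aa Az] Ac Am Aq; have A2 F1 F2 : quad F1 -> quad F2 ->
    A (fun g => F1 g * F2 g) by move=> q1 q2; apply: Aq; exists F1, F2.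
have [qu qh qw] : [/\ quad (@quad_u k), quad (@quad_h k) & quad (@quad_w k)].
  by split; [apply: Or31|apply: Or32|apply: Or33].
elim=> {F} [c|F|F G _ [E [C1 [C2 [C3 [[AE A1 A2' A3] EF]]]]]
    _ [E' [D1 [D2 [D3 [[AE' B1 B2 B3] EG]]]]]
   |F G _ [E [C1 [C2 [C3 [[AE A1 A2' A3] EF]]]]]
    _ [E' [D1 [D2 [D3 [[AE' B1 B2 B3] EG]]]]]].
- exists (fun=> c), (fun=> 0), (fun=> 0), (fun=> 0); split=> // g; ring.
- case=> ->; exists (fun=> 0).
  + exists (fun=> 1), (fun=> 0), (fun=> 0); split=> // g; ring.
  + exists (fun=> 0), (fun=> 1), (fun=> 0); split=> // g; ring.
  + exists (fun=> 0), (fun=> 0), (fun=> 1); split=> // g; ring.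
- exists (fun g => E g + E' g), (fun g => C1 g + D1 g), (fun g => C2 g + D2 g),
    (fun g => C3 g + D3 g); split; first by split; apply: Aa.
  by move=> g; rewrite EF EG; ring.
exists (fun g => E g * E' g + (quad_u g * quad_u g * (C1 g * D1 g)
   + quad_h g * quad_h g * (C2 g * D2 g) + quad_w g * quad_w g * (C3 g * D3 g)
   + quad_u g * quad_h g * (C1 g * D2 g + C2 g * D1 g)
   + quad_u g * quad_w g * (C1 g * D3 g + C3 g * D1 g)
   + quad_h g * quad_w g * (C2 g * D3 g + C3 g * D2 g))),
  (fun g => E g * D1 g + E' g * C1 g), (fun g => E g * D2 g + E' g * C2 g),
  (fun g => E g * D3 g + E' g * C3 g).
have Amm F1 F2 G1 G2 : A F1 -> A F2 -> A G1 -> A G2 ->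
    A (fun g => F1 g * F2 g + G1 g * G2 g) by move=> *; apply: Aa; apply: Am.
split; last by move=> g; rewrite EF EG; ring.
split; try exact: Amm.
have Q1 F1 F2 G1 G2 : quad F1 -> quad F2 -> A G1 -> A G2 ->
    A (fun g => F1 g * F2 g * (G1 g * G2 g)).
  by move=> *; apply: (Am (fun g => F1 g * F2 g)); [apply: A2|apply: Am].
have Q2 F1 F2 G1 G2 G3 G4 : quad F1 -> quad F2 -> A G1 -> A G2 -> A G3 -> A G4 ->
    A (fun g => F1 g * F2 g * (G1 g * G2 g + G3 g * G4 g)).
  by move=> *; apply: (Am (fun g => F1 g * F2 g)); [apply: A2|apply: Amm].
exact: (Aa _ _ (Am _ _ AE AE') (Aa _ _ (Aa _ _ (Aa _ _ (Aa _ _ (Aa _ _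
  (Q1 _ _ _ _ qu qu A1 B1) (Q1 _ _ _ _ qh qh A2' B2)) (Q1 _ _ _ _ qw qw A3 B3))
  (Q2 _ _ _ _ _ _ qu qh A1 B2 A2' B1)) (Q2 _ _ _ _ _ _ qu qw A1 B3 A3 B1))
  (Q2 _ _ _ _ _ _ qh qw A2' B3 A3 B2))).
Qed.

(** A symmetric matrix of rank one is the square of a vector. If [uu] is nonzero, the vector is
    found from a square root of [uu]; if [uu] = 0, the relations force [uh] = [uw] = 0 and [hh] = 1,
    and (0, 1, [hw]) works. *)
Lemma quad2_point (uu uh uw hh hw ww : k) :
  uu * hh = uh * uh -> uu * ww = uw * uw -> uu * hw = uh * uw ->
  hh * ww = hw * hw -> hh * uw = uh * hw -> hh - 4%:R * uw = 1 ->
  exists u h w : k, [/\ u * u = uu, u * h = uh, u * w = uw & h * h = hh] /\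
    [/\ h * w = hw & w * w = ww].
Proof.
move=> E1 E2 E3 E4 E5 E6; have [s Es] := sqrt_exists uu.
have [uu0|uu0] := eqVneq uu 0; last first.
  have s0 : s != 0 by apply: contraNneq uu0 => s0; rewrite -Es s0 expr0n.
  exists s, (uh / s), (uw / s); rewrite -expr2 Es; split; split => //.
  - by field.
  - by field.
  - by apply: (mulfI uu0); rewrite E1 -Es; field.
  - by apply: (mulfI uu0); rewrite E3 -Es; field.
  - by apply: (mulfI uu0); rewrite E2 -Es; field.
have sq0 (z : k) : z * z = 0 -> z = 0.
  by move/eqP; rewrite -expr2 expf_eq0 => /eqP.
have uh0 : uh = 0 by apply: sq0; rewrite -E1 uu0 mul0r.
have uw0 : uw = 0 by apply: sq0; rewrite -E2 uu0 mul0r.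
have hh1 : hh = 1 by rewrite -E6 uw0; ring.
exists 0, 1, hw; rewrite uu0 uh0 uw0 hh1; split; split; try ring.
by rewrite -E4 hh1 mul1r.
Qed.

(** [X] is the quadric modulo (u, h, w) -> -(u, h, w). A point of [X] gives the pairwise products,
    hence a vector up to sign, and the Weyl element realizes the sign. *)
Lemma isomorphic_normalizer : monomial_algebra (pull x1) (@quad_u k) 2 ->
  SL2_isomorphic (space_of X) (homogeneous_space (normalizer (@torus k))).
Proof.
case=> _ Hi HR.
have linA := pull_linear hX x1; have leftA := pull_left hX (x := x1).
case: (linA) => Ae Aa Az.
have Aq F : quad2 F -> pull x1 F.
  apply: (quad2_polarize char0 linA leftA); first exact: pull_const.
  exact/Hi.
have [qu qh qw] : [/\ quad (@quad_u k), quad (@quad_h k) & quad (@quad_w k)].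
  by split; [apply: Or31|apply: Or32|apply: Or33].
have Ag F : pull x1 F -> gen_alg (@quad2 k) F.
  apply: HR; [exact: gen_linear|exact: gen_quad2_left|move=> i].
  apply: (gen_ext (F := fun g => (quad_u g * quad_u g) ^+ i)).
    by move=> g; rewrite exprM expr2.
  by apply: gen_exp; apply: gen_base; exists (@quad_u k), (@quad_u k).
have inv t : monomial_matrix t -> forall F, pull x1 F -> forall g, F (g * t)%g = F g.
  move=> Mt F /Ag; move: F; apply: gen_invariant => _ [F1 [F2 [q1 q2 ->]]] g.
  have [e [ee He]] := monomial_matrix_quad Mt.
  by rewrite !He // -[RHS]mul1r -ee; ring.
have fixE g : aact g x1 = x1 <-> monomial_matrix g.
  split=> [Eg|Mg].
    have E F : quad2 F -> F g = F 1%g.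
      by move=> /Aq AF; rewrite -[g]mul1g (pull_fixed 1%g Eg AF).
    have := E _ (ex_intro _ _ (ex_intro _ _ (And3 qu qu erefl))).
    have := E _ (ex_intro _ _ (ex_intro _ _ (And3 qw qw erefl))).
    have [u1 w1] : quad_u (1%g : SL2 k) = 0 /\ quad_w (1%g : SL2 k) = 0.
      by rewrite /quad_u /quad_w !mx_1; split; ring.
    rewrite u1 w1 mul0r => /eqP; rewrite mulf_eq0 orbb => /eqP w0.
    by move/eqP; rewrite mulf_eq0 orbb => /eqP u0; apply: monomial_matrixP.
  apply: (gen_alg_fixed Ag Aq) => F /Aq AF.
  by rewrite -(inv g Mg F AF 1%g) mul1g.
apply: (homogeneous_isomorphic hX (x1 := x1)) => [x|g|p q y cp cq qy].
- have pr F1 F2 : quad F1 -> quad F2 -> exists2 f, coord f &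
      forall h, f (aact h x1) = F1 h * F2 h.
    move=> q1 q2; have [f cf Ef] : pull x1 (fun g => F1 g * F2 g).
      by apply: Aq; exists F1, F2.
    by exists f => // h; rewrite -Ef.
  have [fuu cuu Euu] := pr _ _ qu qu; have [fuh cuh Euh] := pr _ _ qu qh.
  have [fuw cuw Euw] := pr _ _ qu qw; have [fhh chh Ehh] := pr _ _ qh qh.
  have [fhw chw Ehw] := pr _ _ qh qw; have [fww cww Eww] := pr _ _ qw qw.
  have M := coord_mul hX.
  have [u [h [w [[xuu xuh xuw xhh] [xhw xww]]]]] : exists u h w : k,
      [/\ u * u = fuu x, u * h = fuh x, u * w = fuw x & h * h = fhh x] /\
      [/\ h * w = fhw x & w * w = fww x].
    apply: quad2_point.
    + apply: (generic_eq hX gx1 (M _ _ cuu chh) (M _ _ cuh cuh)) => g.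
      by rewrite Euu Ehh Euh; ring.
    + apply: (generic_eq hX gx1 (M _ _ cuu cww) (M _ _ cuw cuw)) => g.
      by rewrite Euu Eww Euw; ring.
    + apply: (generic_eq hX gx1 (M _ _ cuu chw) (M _ _ cuh cuw)) => g.
      by rewrite Euu Ehw Euh Euw; ring.
    + apply: (generic_eq hX gx1 (M _ _ chh cww) (M _ _ chw chw)) => g.
      by rewrite Ehh Eww Ehw; ring.
    + apply: (generic_eq hX gx1 (M _ _ chh cuw) (M _ _ cuh chw)) => g.
      by rewrite Ehh Euw Euh Ehw; ring.
    + rewrite -mulNr.
      apply: (generic_eq hX gx1 (coord_add hX chh (coord_scale hX (- 4%:R) cuw))
        (coord_const hX 1)) => g.
      by rewrite Ehh Euw -[RHS](quad_rel g); ring.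
  have rel : fhh x - 4%:R * fuw x = 1.
    rewrite -mulNr.
    apply: (generic_eq hX gx1 (coord_add hX chh (coord_scale hX (- 4%:R) cuw))
      (coord_const hX 1)) => g.
    by rewrite Ehh Euw -[RHS](quad_rel g); ring.
  have [|g [gu gh gw]] := @quad_point _ char0 u h w.
    by rewrite expr2 xhh xuw.
  exists g; apply: (gen_alg_point Ag Aq) => F f [F1 [F2 [q1 q2 EF]]] cf Ef.
  have fE f' : coord f' -> (forall h, f' (aact h x1) = F1 h * F2 h) -> f x = f' x.
    move=> cf' E'; apply: (generic_eq hX gx1 cf cf') => h'.
    by rewrite -Ef EF E'.
  have fE' f' : coord f' -> (forall h, f' (aact h x1) = F2 h * F1 h) -> f x = f' x.
    by move=> cf' E'; apply: fE => // h'; rewrite E' mulrC.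
  rewrite EF; case: q1 fE fE' => ->; case: q2 => -> fE fE'; rewrite ?gu ?gh ?gw.
  + by rewrite (fE fuu) // xuu.
  + by rewrite (fE fuh) // xuh.
  + by rewrite (fE fuw) // xuw.
  + by rewrite (fE' fuh) // mulrC xuh.
  + by rewrite (fE fhh) // xhh.
  + by rewrite (fE fhw) // xhw.
  + by rewrite (fE' fuw) // mulrC xuw.
  + by rewrite (fE' fhw) // mulrC xhw.
  + by rewrite (fE fww) // xww.
- by rewrite normalizer_torusE.
have [p0 [q0 [gp gq q0y H]]] := torus_fractions char0 cp cq qy.
have Mw : monomial_matrix (weyl k) by case: (weylE k) => Ea _ _ Ed; right.
have Ew : forall F, quad F -> forall g, F (g * weyl k)%g = - F g.
  case: (weylE k) => Ea Eb Ec Ed.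
  by move=> F [] -> g; rewrite /quad_u /quad_h /quad_w !mx_M Ea Eb Ec Ed; ring.
have [v qv vy] : exists2 v, quad v & v y != 0.
  have [u0|u0] := eqVneq (quad_u y) 0; last by exists (@quad_u k).
  have [h0|h0] := eqVneq (quad_h y) 0; last by exists (@quad_h k).
  have := quad_rel y; rewrite u0 h0 => /esym/eqP.
  by rewrite expr0n /= mul0r mulr0 subr0 oner_eq0.
(* [r] vanishes at [y * weyl k] and not at [y]: symmetrizing [r * q0] under
   [weyl k] gives an invariant that does not vanish at [y]. *)
pose r g := v g + v y.
have gr : gen_alg (@quad k) r by apply: gen_add; [apply: gen_base|apply: gen_const].
(* The odd part of [G] changes sign under the Weyl element, so the sum is twice the even part. *)
have sym G : gen_alg (@quad k) G -> pull x1 (fun g => G g + G (g * weyl k)%g).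
  move=> gG; have [E [C1 [C2 [C3 [[AE A1 A2 A3] EG]]]]] :=
    gen_quad_split linA (pull_const hX x1) (pull_mul hX (x := x1)) Aq gG.
  apply: Ae (Az 2%:R _ AE) => g; rewrite !EG.
  rewrite (inv _ Mw _ AE) (inv _ Mw _ A1) (inv _ Mw _ A2) (inv _ Mw _ A3).
  by rewrite (Ew _ qu) (Ew _ qh) (Ew _ qw); ring.
exists (fun g => r g * p0 g + r (g * weyl k)%g * p0 (g * weyl k)%g),
       (fun g => r g * q0 g + r (g * weyl k)%g * q0 (g * weyl k)%g); split.
- exact: (sym _ (gen_mul gr gp)).
- exact: (sym _ (gen_mul gr gq)).
- rewrite /r Ew // addNr mul0r addr0 mulf_neq0 //.
  by rewrite -[v y]mul1r -mulrDl mulf_neq0 // (two_neq0 char0).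
have NT t : torus t -> normalizer (@torus k) t.
  by case=> s s0 [_ b0 c0 _]; apply/normalizer_torusE; left.
have Nw : normalizer (@torus k) (weyl k) by apply/normalizer_torusE.
move=> W F Wt Ft HF g Wg.
have HF' := H W F (fun g t Tt => Wt g t (NT t Tt)) (fun g t Tt => Ft g t (NT t Tt)) HF.
rewrite -(HF' _ Wg) -(HF' _ (Wt _ _ Nw Wg)) (Ft _ _ Nw Wg).
by ring.
Qed.

(** The translate of b^f by [uup s] is (b + s d)^f, whose coefficients are the generators of
    [R_infty] up to binomials, invertible in characteristic 0. Conversely [R_infty] is left-stable
    and contains the powers of b^f. *)
Lemma isomorphic_cone (f : nat) : monomial_algebra (pull x1) (@mx_b k) f ->
  SL2_isomorphic (space_of X) (space_of (Spec (@R_infty_stable k f))).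
Proof.
case=> f_gt0 Hi HR; apply: (spec_isomorphic hX gx1) => F.
have linA := pull_linear hX x1; have leftA := pull_left hX (x := x1).
case: (linA) => Ae Aa Az.
split=> [|[p Hp]].
  apply: HR.
  - split=> [F' G E [p Hp]|F' G [p Hp] [q Hq]|c F' [p Hp]].
    + by exists p => x; rewrite -E.
    + by exists (p + q) => x; rewrite mevalD Hp Hq.
    + by exists (c *: p) => x; rewrite mevalZ Hp.
  - move=> h F' RF; have := R_infty_stable h^-1%g RF.
    by case=> p Hp; exists p => x; rewrite -Hp /left_regular invgK.
  - move=> i; exists ('X_0 ^+ i) => x.
    by rewrite rmorphXn /= mevalXU expr0 mul1r subn0 exprM.
have Agen (i : 'I_f.+1) : pull x1 (fun g => mx_d g ^+ i * mx_b g ^+ (f - i)).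
  pose C (i : 'I_f.+1) g := 'C(f, i)%:R * (mx_d g ^+ i * mx_b g ^+ (f - i)).
  have AC : pull x1 (C i).
    move: i; apply: (coef_extract char0
      (Phi := fun s g => mx_b (uup s * g)%g ^+ f) linA).
      move=> s _; apply: (leftA (uup s) (fun g => mx_b g ^+ f)).
      exact/Hi.
    move=> s g _; case: (uupE s) => Ea Eb _ _; rewrite mx_bM Ea Eb mul1r exprDn.
    apply: eq_bigr => i _; rewrite /C exprMn -mulr_natl; ring.
  have bin0 : 'C(f, i)%:R != 0 :> k.
    by apply: natr_neq0 => //; rewrite bin_gt0 -ltnS.
  by apply: Ae (Az 'C(f, i)%:R^-1 _ AC) => g; rewrite /C mulKf.
have {Hp}Hp : F =1 fun g => p.@[fun i : 'I_f.+1 => mx_d g ^+ i * mx_b g ^+ (f - i)].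
  exact: Hp.
apply: (Ae _ _ (fun g => esym (Hp g))); elim/mpolyind: p {Hp} => [|c m p _ _ IH].
  by apply: Ae (pull_const hX x1 0) => g; rewrite meval0.
apply: (Ae (fun g => c * ('X_[m] : {mpoly k[f.+1]}).@[fun i : 'I_f.+1 =>
   mx_d g ^+ i * mx_b g ^+ (f - i)] +
   p.@[fun i : 'I_f.+1 => mx_d g ^+ i * mx_b g ^+ (f - i)])).
  by move=> g; rewrite mevalD mevalZ.
apply: Aa => //; apply: Az.
apply: (Ae (fun g => \prod_(i < f.+1) (mx_d g ^+ i * mx_b g ^+ (f - i)) ^+ m i)).
  by move=> g; rewrite mevalX.
elim: (index_enum _) => [|i r IHr].
  by apply: Ae (pull_const hX x1 1) => g; rewrite big_nil.
apply: (Ae (fun g => (mx_d g ^+ i * mx_b g ^+ (f - i)) ^+ m i *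
  \prod_(i <- r) (mx_d g ^+ i * mx_b g ^+ (f - i)) ^+ m i)).
  by move=> g; rewrite big_cons.
apply: (pull_mul hX) => //; elim: (m i) => [|e IHe].
  exact: (pull_const hX x1 1).
by apply: Ae (pull_mul hX (Agen i) IHe) => g; rewrite exprS.
Qed.

End Cases.

(** * Stabilizers in the models *)

Section Stabilizers.
Variables (k : fieldType) (char0 : [pchar k] =i pred0).
Implicit Types (g h : SL2 k).

Lemma isomorphic_stabilizer (X Y Z : SL2_space k) :
  SL2_isomorphic X Y -> SL2_isomorphic X Z -> forall y : Y,
  exists z : Z, forall g, sact g y = y <-> sact g z = z.
Proof.
case=> phi [psi [phiK psiK act _ _]] [phi' [psi' [phiK' psiK' act' _ _]]] y.
exists (phi' (psi y)) => g; rewrite -act'; split=> [E|].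
  by rewrite -{2}E -{2}(psiK y) -act phiK.
by move/(can_inj phiK') => E; rewrite -{1}(psiK y) -act E psiK.
Qed.

Lemma subgroup_torus : subgroup (@torus k).
Proof.
split=> [|g h /torusE [t t0 ->] /torusE [s s0 ->]].
  by apply/torusE; exists 1; rewrite ?oner_neq0 ?tor1.
have ti : t^-1 != 0 by rewrite invr_eq0.
apply/torusE; exists (t^-1 * s); first by rewrite mulf_neq0.
have -> : (tor t)^-1%g = tor t^-1.
  by apply: (mulgI (tor t)); rewrite mulgV torM // mulfV // tor1.
by rewrite torM.
Qed.

Lemma subgroup_normalizer (H : SL2 k -> Prop) : subgroup (normalizer H).
Proof.
split=> [h|g h Ng Nh x]; first by rewrite invg1 mulg1 mul1g.
rewrite (Nh x) (Ng (g^-1 * h * x * (g^-1 * h)^-1)%g).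
by rewrite invgM invgK !mulgA mulgV mul1g mulgK.
Qed.

(** Conjugation preserves trace 2. An antidiagonal matrix has trace 0, and a diagonal one with trace
    2 and determinant 1 is the identity. *)
Lemma monomial_matrix_no_unipotent g h : mx_a g + mx_d g = 2%:R -> g <> 1%g ->
  ~ monomial_matrix (h^-1 * g * h)%g.
Proof.
move=> tr2 g1 M; pose x := (h^-1 * g * h)%g.
have trx : mx_a x + mx_d x = 2%:R.
  transitivity ((mx_a g + mx_d g) * (mx_a h * mx_d h - mx_b h * mx_c h)).
    by rewrite /x !mx_M !mx_V; ring.
  by rewrite SL2_det mulr1.
have D := SL2_det x; have t0 := two_neq0 char0.
case: M; rewrite -/x => -[E1 E2]; last first.
  by move: trx; rewrite E1 E2 addr0 => /esym/eqP; rewrite (negPf t0).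
apply: g1; suff Ex : x = 1%g.
  have -> : g = (h * x * h^-1)%g by rewrite /x !mulgA mulgV mul1g mulgK.
  by rewrite Ex mulg1 mulgV.
have a1 : mx_a x = 1.
  have : (mx_a x - 1) ^+ 2 = 0.
    transitivity (mx_a x * (mx_a x + mx_d x - 2%:R)
      - (mx_a x * mx_d x - mx_b x * mx_c x) + 1); last by rewrite trx D; ring.
    by rewrite E1; ring.
  by move/eqP; rewrite expf_eq0 /= subr_eq0 => /eqP.
have d1 : mx_d x = 1.
  by apply: (addrI (mx_a x)); rewrite trx a1.
by apply: SL2_eq; rewrite mx_1.
Qed.

Section Cone.
Variables (f : nat) (f_gt0 : (0 < f)%N).

Let cone_space := space_of (Spec (@R_infty_stable k f)).

Fact cone_base_subproof : is_kalg_hom (fun u : {F | @R_infty k f F} => sval u 1%g).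
Proof. by split=> [c u -> | u v w -> | u v w ->]. Qed.

(** Evaluation at the identity, the point (b, d) = (0, 1), whose stabilizer is the semidirect
    product of mu_f with the lower unipotent group. *)
Definition cone_base : cone_space := exist _ _ cone_base_subproof.

Definition cone_coord (i : 'I_f.+1) : {F | @R_infty k f F}.
Proof.
exists (fun x => mx_d x ^+ i * mx_b x ^+ (f - i)).
by exists 'X_i => x; rewrite mevalXU.
Defined.

Lemma cone_base_stabilizer g :
  sact g cone_base = cone_base <-> mx_b g = 0 /\ mx_d g ^+ f = 1.
Proof.
split=> [/(congr1 (fun z : cone_space => sval z))/= E|[b0 d1]].
  have EF (u : {F | @R_infty k f F}) : sval u g = sval u 1%g.
    by move/(congr1 (fun F => F u)): E; rewrite /= /left_regular invgK mulg1.
  split.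
    have /eqP := EF (cone_coord ord0).
    rewrite /= subn0 !expr0 !mul1r mx_1 expr0n gtn_eqF //.
    by rewrite expf_eq0 f_gt0 /= => /eqP.
  by have := EF (cone_coord ord_max); rewrite /= subnn !mulr1 mx_1 expr1n.
apply: sig_inj => /=; apply: functional_extensionality => -[F [p EF]] /=.
rewrite /left_regular invgK mulg1 !EF; apply: meval_eq => i.
rewrite !mx_1 b0 expr1n mul1r; have [lt|ge] := ltnP i f.
  by rewrite expr0n subn_eq0 leqNgt lt mulr0.
have -> : i = f :> nat by apply/eqP; rewrite eqn_leq ge -ltnS ltn_ord.
by rewrite d1 subnn mulr1.
Qed.

Lemma cone_hom_ext (y z : cone_space) :
  (forall i, sval y (cone_coord i) = sval z (cone_coord i)) -> y = z.
Proof.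
case: y z => y [y1 y2 y3] [z [z1 z2 z3]] /= E; apply: sig_inj.
apply: functional_extensionality => -[F [p EF]] /=.
pose v g := fun i : 'I_f.+1 => mx_d g ^+ i * mx_b g ^+ (f - i).
have RP (q : {mpoly k[f.+1]}) : @R_infty k f (fun g => q.@[v g]) by exists q.
pose ev q : {F | @R_infty k f F} := exist _ _ (RP q).
suff H (q : {mpoly k[f.+1]}) : y (ev q) = z (ev q).
  have -> : exist _ F (ex_intro _ p EF) = ev p; last exact: H.
  by apply: sig_inj; apply: functional_extensionality => g /=; rewrite EF.
elim/mpolyind: q => [|c m q _ _ IH].
  by rewrite (y1 0) ?(z1 0) // => g /=; rewrite meval0.
have HX : y (ev 'X_[m]) = z (ev 'X_[m]).
  rewrite mpolyXE_id; elim: (index_enum _) => [|i r IHr].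
    by rewrite (y1 1) ?(z1 1) // => g /=; rewrite big_nil meval1.
  have EM g : (\prod_(j <- i :: r) 'X_j ^+ m j).@[v g] =
      ('X_i ^+ m i).@[v g] * (\prod_(j <- r) 'X_j ^+ m j).@[v g].
    by rewrite big_cons mevalM.
  rewrite (y3 (ev ('X_i ^+ m i)) (ev (\prod_(j <- r) 'X_j ^+ m j))) //.
  rewrite (z3 (ev ('X_i ^+ m i)) (ev (\prod_(j <- r) 'X_j ^+ m j))) // IHr.
  congr (_ * _); elim: (m i) => [|e IHe].
    by rewrite (y1 1) ?(z1 1) // => g /=; rewrite meval1.
  pose Xi : {mpoly k[f.+1]} := 'X_i.
  have EX g : (Xi ^+ e.+1).@[v g] = Xi.@[v g] * (Xi ^+ e).@[v g].
    by rewrite exprS mevalM.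
  rewrite (y3 (ev Xi) (ev (Xi ^+ e))) // (z3 (ev Xi) (ev (Xi ^+ e))) // IHe.
  congr (_ * _); have -> : ev Xi = cone_coord i; last exact: E.
  by apply: sig_inj; apply: functional_extensionality => g /=; rewrite mevalXU.
have EZ g : (c *: 'X_[m]).@[v g] = c%:MP.@[v g] * ('X_[m]).@[v g].
  by rewrite mevalZ mevalC.
have ED g : (c *: 'X_[m] + q).@[v g] = (c *: 'X_[m]).@[v g] + q.@[v g].
  by rewrite mevalD.
rewrite (y2 (ev (c *: 'X_[m])) (ev q) (ev _) ED).
rewrite (z2 (ev (c *: 'X_[m])) (ev q) (ev _) ED) IH; congr (_ + _).
rewrite (y3 (ev c%:MP) (ev 'X_[m]) (ev _) EZ).
rewrite (z3 (ev c%:MP) (ev 'X_[m]) (ev _) EZ) HX.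
have EC g : c%:MP.@[v g] = c by rewrite mevalC.
by rewrite (y1 c (ev c%:MP) EC) (z1 c (ev c%:MP) EC).
Qed.

(* The lower unipotent group fixes a point only if all coordinates but the last
   vanish there, and the torus acts on the last one by the character [t ^ -f]. *)
Lemma cone_stabilizer_exponent (y : cone_space) :
  (forall z, sact (ulo z) y = y) ->
  (forall t, t != 0 -> sact (tor t) y = y) \/
  (forall t, t != 0 -> (sact (tor t) y = y <-> t ^+ f = 1)).
Proof.
case: y => [phi [h1 h2 h3]] Hy.
pose v i := phi (cone_coord i).
have act_coord g (i : 'I_f.+1) u :
    (forall x, sval u x = sval (cone_coord i) (g * x)%g) ->
    sval (sact g (exist _ phi (And3 h1 h2 h3) : cone_space)) (cone_coord i) = phi u.
  move=> Hu /=; congr phi; apply: sig_inj; apply: functional_extensionality => x.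
  by rewrite Hu /= /left_regular invgK.
have const_sub c : @R_infty k f (fun=> c) by exists c%:MP => x; rewrite mevalC.
pose cst c : {F | @R_infty k f F} := exist _ _ (const_sub c).
have scale_sub c i : @R_infty k f (fun x => c * sval (cone_coord i) x).
  by exists (c *: 'X_i) => x; rewrite mevalZ mevalXU.
pose scl c i : {F | @R_infty k f F} := exist _ _ (scale_sub c i).
have phi_scl c i : phi (scl c i) = c * v i.
  by rewrite (h3 (cst c) (cone_coord i)) // (h1 c).
(* [ulo 1] sends d b^(f-1) to d b^(f-1) + b^f, so v_0 = 0; then v_(i+1)^2 = v_i v_(i+2), the
   relation of the rational normal curve, propagates the vanishing up to index f - 1. *)
have v0 (i : 'I_f.+1) : (i < f)%N -> v i = 0.
  case: i => i Hi /= lt; elim: i Hi lt => [|i IH] Hi lt.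
    have H1 : (1 < f.+1)%N by rewrite ltnS.
    have su : @R_infty k f (fun x => sval (cone_coord (Ordinal H1)) x
        + sval (cone_coord (Ordinal Hi)) x).
      by exists ('X_(Ordinal H1) + 'X_(Ordinal Hi)) => x; rewrite mevalD !mevalXU.
    apply: (addrI (v (Ordinal H1))); rewrite addr0.
    have <- : phi (exist _ _ su) = v (Ordinal H1) + v (Ordinal Hi) by apply: (h2 _ _ (exist _ _ su)).
    rewrite -(act_coord (ulo 1) (Ordinal H1)) ?Hy // => x /=.
    case: (uloE (1 : k)) => Ea Eb Ec Ed; rewrite !mx_M Ea Eb Ec Ed !mul1r mul0r.
    by rewrite addr0 !expr1 subn0 addrC mulrDl -exprS subn1 prednK.
  have Hi1 : (i < f.+1)%N by lia.
  have Hi2 : (i.+2 < f.+1)%N by lia.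
  have vi : v (Ordinal Hi1) = 0 by apply: IH; lia.
  have sq : @R_infty k f (fun x => sval (cone_coord (Ordinal Hi)) x
      * sval (cone_coord (Ordinal Hi)) x).
    by exists ('X_(Ordinal Hi) * 'X_(Ordinal Hi)) => x; rewrite mevalM !mevalXU.
  have E1 := h3 (cone_coord (Ordinal Hi)) (cone_coord (Ordinal Hi))
    (exist _ _ sq) (fun=> erefl).
  have : phi (exist _ _ sq) = v (Ordinal Hi1) * v (Ordinal Hi2).
    apply: (h3 _ _ (exist _ _ sq)) => x /=.
    have -> : (f - i = (f - i.+2).+2)%N by lia.
    have -> : (f - i.+1 = (f - i.+2).+1)%N by lia.
    by rewrite !exprS; ring.
  by rewrite vi mul0r E1 => /eqP; rewrite mulf_eq0 orbb => /eqP.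
have tor_coord t (i : 'I_f.+1) : t != 0 ->
    sval (sact (tor t) (exist _ phi (And3 h1 h2 h3) : cone_space)) (cone_coord i)
      = t^-1 ^+ i * t ^+ (f - i) * v i.
  move=> t0; rewrite (act_coord _ _ (scl (t^-1 ^+ i * t ^+ (f - i)) i)) ?phi_scl //.
  move=> x; case: (torE t0) => Ea Eb Ec Ed; rewrite /= !mx_M Ea Eb Ec Ed.
  by rewrite !mul0r addr0 add0r !exprMn; ring.
have fixE t : t != 0 -> v ord_max = 0 \/ t ^+ f = 1 ->
    sact (tor t) (exist _ phi (And3 h1 h2 h3) : cone_space) = exist _ phi (And3 h1 h2 h3).
  move=> t0 H; apply: cone_hom_ext => i; rewrite tor_coord //= -/(v i).
  have [lt|ge] := ltnP i f; first by rewrite v0 ?mulr0.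
  have -> : i = ord_max by apply: val_inj; apply/eqP; rewrite eqn_leq ge -ltnS ltn_ord.
  by case: H => [->|H]; rewrite ?mulr0 // subnn exprVn H invr1 !mul1r.
have [vm|vm] := eqVneq (v ord_max) 0.
  by left=> t t0; apply: fixE => //; left.
right=> t t0; split=> [Et|H]; last by apply: fixE => //; right.
have := tor_coord t ord_max t0; rewrite Et /= -/(v ord_max) subnn mulr1 => H.
have : t^-1 ^+ f = 1 by apply: (mulIf vm); rewrite mul1r -H.
by rewrite exprVn => /(congr1 GRing.inv); rewrite invrK invr1.
Qed.

End Cone.
End Stabilizers.

(** * The models are pairwise non-isomorphic *)

Section Uniqueness.
Variables (k : closedFieldType) (char0 : [pchar k] =i pred0).

Definition stabilizer_of (Y : SL2_space k) (y : Y) (g : SL2 k) : Prop :=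
  sact g y = y.

(** X^m - 1 is separable in characteristic 0, and its m distinct roots are roots of X^n - 1. *)
Lemma unity_roots_exponent m n : (0 < m)%N -> (0 < n)%N ->
  (forall t : k, t ^+ m = 1 -> t ^+ n = 1) -> (m <= n)%N.
Proof.
move=> m_gt0 n_gt0 H; have [r Er] := closed_field_poly_normal ('X^m - 1 : {poly k}).
have lc : lead_coef ('X^m - 1 : {poly k}) = 1.
  by apply/monicP; rewrite -[1]/(1%:P) monicXnsubC.
rewrite lc scale1r in Er.
have ur : uniq r.
  by rewrite -separable_prod_XsubC -Er separable_Xn_sub_1 // natr_neq0.
have sr : size r = m.
  by apply: succn_inj; rewrite -(size_prod_XsubC r id) -Er -[1]/(1%:P) size_XnsubC.
have n0 : ('X^n - 1 : {poly k}) != 0.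
  by rewrite -[1]/(1%:P) monic_neq0 ?monicXnsubC.
rewrite -sr -ltnS -(size_XnsubC (1 : k) n_gt0); apply: max_poly_roots => //.
apply/allP => t tr; rewrite /root !hornerE subr_eq0; apply/eqP/H/eqP.
have : root ('X^m - 1 : {poly k}) t by rewrite Er root_prod_XsubC.
by rewrite /root !hornerE subr_eq0.
Qed.

Lemma uup_not_monomial_matrix : ~ monomial_matrix (uup (1 : k)).
Proof.
case: (uupE (1 : k)) => Ea Eb _ _.
by case=> -[]; rewrite ?Ea ?Eb => /eqP; rewrite oner_eq0.
Qed.

Lemma torus_monomial (g : SL2 k) : torus g -> monomial_matrix g.
Proof. by case=> t _ [_ b0 c0 _]; left. Qed.

Lemma homogeneous_uup (H : SL2 k -> Prop) : subgroup H ->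
  (forall g, H g -> monomial_matrix g) ->
  exists y : homogeneous_space H, ~ stabilizer_of y (uup 1).
Proof.
move=> sH HM; exists (coset_proj H 1%g) => /(coset_act_fixed _ _ sH).
by rewrite invg1 mul1g mulg1 => /HM; apply: uup_not_monomial_matrix.
Qed.

Lemma homogeneous_ulo (H : SL2 k -> Prop) : subgroup H ->
  (forall g, H g -> monomial_matrix g) ->
  forall y : homogeneous_space H, ~ stabilizer_of y (ulo 1).
Proof.
move=> sH HM y; have [h ->] := coset_rep y => /(coset_act_fixed _ _ sH)/HM.
case: (uloE (1 : k)) => Ea _ Ec Ed; apply: monomial_matrix_no_unipotent => //.
  by rewrite Ea Ed.
by move/(congr1 (@mx_c k)); rewrite Ec mx_1; apply/eqP; rewrite oner_eq0.
Qed.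

Lemma model_space_inj (X : SL2_space k) m1 m2 :
  SL2_isomorphic X (model_space k m1) -> SL2_isomorphic X (model_space k m2) ->
  m1 = m2.
Proof.
move=> I1 I2; have sT := @subgroup_torus k.
have sN : subgroup (normalizer (@torus k)) := subgroup_normalizer _.
have MN g : normalizer (@torus k) g -> monomial_matrix g.
  by move/(normalizer_torusE char0).
have transfer m m' (Q : (SL2 k -> Prop) -> Prop) :
    SL2_isomorphic X (model_space k m) -> SL2_isomorphic X (model_space k m') ->
    (exists y : model_space k m, Q (stabilizer_of y)) ->
    exists y : model_space k m', Q (stabilizer_of y).
  move=> I I' [y Qy]; have [z Hz] := isomorphic_stabilizer I I' y.
  exists z; suff <- : stabilizer_of y = stabilizer_of z by [].
  apply: functional_extensionality => g.
  exact/propositional_extensionality/Hz.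
(* Conditions on the stabilizer of some point, since the cone has more than one orbit. [Q1] excludes
   the one-point model, [Q2] singles out the cones, [Q3] separates the normalizer from the torus,
   and [Q4] recovers f. *)
pose Q1 (S : SL2 k -> Prop) := ~ S (uup 1).
pose Q2 (S : SL2 k -> Prop) := S (ulo 1) /\ ~ S (uup 1).
pose Q3 (S : SL2 k -> Prop) := [/\ S (weyl k), S (tor 2%:R) & ~ S (uup 1)].
pose Q4 n (S : SL2 k -> Prop) := (forall z, S (ulo z)) /\
  (forall t, t != 0 -> (S (tor t) <-> t ^+ n = 1)).
pose has (Q : (SL2 k -> Prop) -> Prop) m :=
  exists y : model_space k m, Q (stabilizer_of y).
have G1 : ~ has Q1 ModSL2.
  case=> y; apply; rewrite /stabilizer_of /=; have [h ->] := coset_rep y.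
  by apply/coset_act_fixed.
have T1 : has Q1 ModT by apply: homogeneous_uup => //; apply: torus_monomial.
have N1 : has Q1 ModNT by apply: homogeneous_uup.
have T2 : ~ has Q2 ModT.
  by case=> y [H _]; apply: homogeneous_ulo H => //; apply: torus_monomial.
have N2 : ~ has Q2 ModNT by case=> y [H _]; apply: homogeneous_ulo H.
have t0 : 2%:R != 0 :> k by apply: natr_neq0.
have N3 : has Q3 ModNT.
  exists (coset_proj _ 1%g); split.
  - apply/coset_act_fixed => //; rewrite invg1 mul1g mulg1.
    by apply/(normalizer_torusE char0); case: (weylE k) => Ea _ _ Ed; right.
  - apply/coset_act_fixed => //; rewrite invg1 mul1g mulg1.
    by apply/(normalizer_torusE char0); case: (torE t0) => _ Eb Ec _; left.
  - move=> /(coset_act_fixed _ _ sN); rewrite invg1 mul1g mulg1 => /MN.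
    exact: uup_not_monomial_matrix.
have T3 : ~ has Q3 ModT.
  case=> y; have [h ->] := coset_rep y => -[].
  move=> /(coset_act_fixed _ _ sT)/torusE [t t0' Et].
  move=> /(coset_act_fixed _ _ sT)/torusE [s s0 Es] _.
  (* The torus is commutative, while [weyl] and [tor 2] do not commute: the entries b of the two
     products are 1/2 and 2. *)
  have C : (h^-1 * weyl k * h * (h^-1 * tor 2%:R * h) =
            h^-1 * tor 2%:R * h * (h^-1 * weyl k * h))%g.
    by rewrite Et Es !torM // mulrC.
  have {}C : (weyl k * tor 2%:R = tor 2%:R * weyl k)%g.
    move: C; rewrite -!mulgA !mulVKg => /(mulgI h^-1%g).
    by rewrite !mulgA => /(mulIg h).
  have := congr1 (@mx_b k) C; case: (weylE k) => Ea Eb Ec Ed.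
  case: (torE t0) => Ea' Eb' Ec' Ed'.
  rewrite !mx_M Ea Eb Ea' Eb' Ed Ed' !mul0r add0r mul1r mulr1 addr0 => E2.
  have : 3%:R != 0 :> k by apply: natr_neq0.
  apply/negP; rewrite negbK; apply/eqP.
  transitivity (2%:R * 2%:R - 2%:R * 2%:R^-1 : k); last by rewrite E2 subrr.
  by rewrite mulfV //; ring.
have R1 f (f_gt0 : (0 < f)%N) :
    has Q2 (SpecRinfty (exist _ f f_gt0)) /\ has (Q4 f) (SpecRinfty (exist _ f f_gt0)).
  split; exists (cone_base k f).
    split; first by apply/cone_base_stabilizer => //; case: (uloE (1 : k)) => _ -> _ ->;
      rewrite expr1n.
    move=> /(cone_base_stabilizer f_gt0) []; case: (uupE (1 : k)) => _ -> _ _ /eqP.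
    by rewrite oner_eq0.
  split=> [z|t tn0].
    by apply/cone_base_stabilizer => //; case: (uloE z) => _ -> _ ->; rewrite expr1n.
  rewrite /stabilizer_of (cone_base_stabilizer f_gt0).
  case: (torE tn0) => _ -> _ ->; rewrite exprVn; split=> [[_ E]|->].
    by rewrite -[LHS]invrK E invr1.
  by rewrite invr1.
(* A point of the cone with exponent f' that is fixed by the lower unipotent group has torus
   stabilizer either everything or the f'-th roots of unity; both contain the latter. *)
have R2 f f' (p : (0 < f)%N) (p' : (0 < f')%N) :
    has (Q4 f) (SpecRinfty (exist _ f' p')) -> forall t : k, t ^+ f' = 1 -> t ^+ f = 1.
  case=> y [Hu Ht] t tf; have t0' : t != 0.
    by apply: contra_eq_neq tf => ->; rewrite expr0n gtn_eqF // eq_sym oner_eq0.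
  apply/(Ht t t0'); case: (cone_stabilizer_exponent p' Hu) => H; first exact: H.
  by apply/H.
have Q21 m : has Q2 m -> has Q1 m by case=> y []; exists y.
have tr12 Q := transfer m1 m2 Q I1 I2; have tr21 Q := transfer m2 m1 Q I2 I1.
move: tr12 tr21; case: m1 m2 {I1 I2} => [|||[f p]] [|||[f' p']] // tr12 tr21.
- by case: G1; apply: tr21 T1.
- by case: G1; apply: tr21 N1.
- by case: G1; apply/tr21/Q21; case: (R1 f' p').
- by case: G1; apply: tr12 T1.
- by case: T3; apply: tr21 N3.
- by case: T2; apply: tr21; case: (R1 f' p').
- by case: G1; apply: tr12 N1.
- by case: T3; apply: tr12 N3.
- by case: N2; apply: tr21; case: (R1 f' p').
- by case: G1; apply/tr12/Q21; case: (R1 f p).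
- by case: T2; apply: tr12; case: (R1 f p).
- by case: N2; apply: tr12; case: (R1 f p).
have Hff : f = f'.
  apply/eqP; rewrite eqn_leq; apply/andP; split.
    apply: unity_roots_exponent => //; apply: (R2 f' f p' p).
    by apply: tr21; case: (R1 f' p').
  apply: unity_roots_exponent => //; apply: (R2 f f' p p').
  by apply: tr12; case: (R1 f p).
by subst f'; rewrite (bool_irrelevance p p').
Qed.

End Uniqueness.

Theorem theorem4p10 (k : closedFieldType) (char0 : [pchar k]%R =i pred0)
    (X : affine_SL2 k) (hX : affine_spherical X) :
  exists! m : spherical_model, SL2_isomorphic (space_of X) (model_space k m).
Proof.
suff [m Hm] : exists m, SL2_isomorphic (space_of X) (model_space k m).
  by exists m; split=> // m' Hm'; apply: (model_space_inj char0 Hm Hm').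
have kcl (p : {poly k}) : size p != 1 -> exists x, root p x.
  by move/closed_rootP.
have [x [gx sx nx]] := exists_spherical_point hX.
(* The right translation found by the classification is absorbed by moving the base point within its
   orbit. *)
have trE y : pull (aact y x) = right_translate (pull x) y.
  apply: functional_extensionality => F; apply: propositional_extensionality.
  exact: pull_act.
have gx' y : generic (aact y x) by apply: generic_act.
case: (sa_classification char0 kcl sx nx) => [Hc|[y [f Hf]]|[y [f [Ef Hf]]]].
- exists ModSL2; exact: isomorphic_point Hc.
- have f_gt0 : (0 < f)%N by case: Hf.
  exists (SpecRinfty (exist _ f f_gt0)).
  by apply: (isomorphic_cone char0 hX (gx' y)); rewrite trE.
case: Ef Hf => -> Hf.
  by exists ModT; apply: (isomorphic_torus char0 hX (gx' y)); rewrite trE.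
exists ModNT; apply: (isomorphic_normalizer char0 kcl hX (gx' y)).
by rewrite trE.
Qed.
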